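(* Let $0<\nu<1$, $0<\lambda<1$, $\sigma>0$, and let $m\ge 0$ be an integer. Let $u$ be the solution of $$D_s^{2-\nu}u(x)=f(x),\quad x\in[0,\infty),\qquad u(0)=0,\qquad \lim_{x\to\infty}u(x)=0,$$ and let $u_N$ be its Petrov–Galerkin approximation (defined in the context). If $g_f(x):=f(x)e^{\sigma x}x^{2-\lambda-\nu}$ belongs to $B^m_{w^{\lambda+\nu-2}}([0,\infty))$, then there is a constant $C$ independent of $N$, $f$ and $u$ such that, for all $N\ge 1$ with $m\le N+1$, $$\|D_s^{2-\nu}(u-u_N)\|_{\hat w_2}\le C N^{-m/2}\,\|\partial_x^m g_f\|_{w^{\lambda+\nu+m-2}} .$$
   Context: Substantial fractional derivative: for $\mu>0$ and $k$ the smallest integer exceeding $\mu$, $$D_s^{\mu}f(x)=\frac{1}{\Gamma(k-\mu)}\Big(\frac{d}{dx}+\sigma\Big)^k\int_0^x (x-\tau)^{k-\mu-1}e^{-\sigma(x-\tau)}f(\tau)\,d\tau .$$ In particular, $D_s^{2-\nu}f(x)=\frac1{\Gamma(\nu)}\big(\frac{d}{dx}+\sigma\big)^2\int_0^x (x-\tau)^{\nu-1}e^{-\sigma(x-\tau)}f(\tau)\,d\tau$. For $\alpha>-1$, $L_n^\alpha$ denotes the generalized Laguerre polynomial of degree $n$ (standard normalization, orthogonal on $[0,\infty)$ with weight $x^\alpha e^{-x}$, squared norm $\Gamma(n+\alpha+1)/n!$). For $-2<\alpha\le -1$ the extended Laguerre polynomials are defined by $L_0^\alpha(x)=1$ and $L_n^\alpha(x)=L_n^{\alpha+1}(x)-L_{n-1}^{\alpha+1}(x)$,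 $n\ge1$. The modified Laguerre functions are $\hat L_n^{\alpha}(x)=x^{\alpha}e^{-\sigma x}L_n^{\alpha}(2\sigma x)$. For a weight $w$ on $(0,\infty)$, $(u,v)_w=\int_0^\infty uv\,w\,dx$ and $\|u\|_w=(u,u)_w^{1/2}$. Put $w^{\alpha}(x)=x^{\alpha}e^{-2\sigma x}$ and $\hat w_2(x)=x^{2-\lambda-\nu}$. The space $B^r_{w^\alpha}([0,\infty))$ consists of measurable $v$ with $\|v\|_{r,w^\alpha}=\big(\sum_{k=0}^r\|\partial_x^k v\|_{w^{\alpha+k}}^2\big)^{1/2}<\infty$. Petrov–Galerkin approximation: the trial space is $U_2=\mathrm{span}\{(n+1)^{-(\lambda-\nu+2)/2}\hat L_n^{\lambda}:0\le n\le N\}$, the test space is $V_2=\mathrm{span}\{(n+1)^{-(\lambda+\nu-2)/2}\hat L_n^{\lambda+\nu-2}:0\le n\le N\}$, and $u_N\in U_2$ is required to satisfy $(D_s^{2-\nu}u_N,v)_{\hat w_2}=(f,v)_{\hat w_2}$ for all $v\in V_2$. Using $D_s^{2-\nu}\hat L_k^\lambda=\frac{\Gamma(\lambda+k+1)}{\Gamma(\lambda+\nu+k-1)}\hat L_k^{\lambda+\nu-2}$ and the orthogonality relation for the (extended) Laguerre polynomials, the paper realizes this as the diagonal linear system that defines $u_N$: $u_N(x)=\sum_{k=0}^N \frac{c_k}{(k+1)^{(\lambda-\nu+2)/2}}\hat L_k^\lambda(x)$ with, for $0\le k\le N$, $$\Big(\frac1{2\sigma}\Big)^{\lambda+\nu-1}\frac{\Gamma(\lambda+k+1)}{\Gamma(k+1)(k+1)^\lambda}\,c_k=\frac{1}{(k+1)^{(\lambda+\nu-2)/2}}\int_0^\infty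 f(x)e^{-\sigma x}L_k^{\lambda+\nu-2}(2\sigma x)\,dx .$$
   Formalization: The integrals (D_s^{2-ν}u_N,v) and (f,v) in the Galerkin equation are required to converge for all v in V_2; without this, for λ+ν<1 the diagonal system can give an infinite error norm (e.g. 2σ=1, N=1, g_f=x²), so the claim fails. *)

(* Defs.v *)
From HB Require Import structures.
From mathcomp Require Import all_boot all_order all_algebra.
From mathcomp Require Import all_classical all_reals all_analysis.

Set Implicit Arguments.
Unset Strict Implicit.
Unset Printing Implicit Defensive.

Import Order.TTheory GRing.Theory Num.Theory.
Import numFieldNormedType.Exports.

Local Open Scope classical_set_scope.
Local Open Scope ring_scope.

Definition half_line {R : realType} : set R := [set` `]0, +oo[%R].

Definition integrable_on (R : realType) (D : set R) (f : R -> R) : Prop :=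
  (@lebesgue_measure R).-integrable D (EFin \o f).

(* Euler's integral; it is only used for z > 0, where it converges. *)
Definition Gamma (R : realType) (z : R) : R :=
  \int[@lebesgue_measure R]_(t in half_line) (t `^ (z - 1) * expR (- t)).

(* the smallest integer exceeding mu, for mu >= 0 *)
Definition frac_order (R : realType) (mu : R) : nat := (Num.truncn mu).+1.

Definition frac_kernel (R : realType) (sigma mu : R) (f : R -> R) (x tau : R) : R :=
  (x - tau) `^ ((frac_order mu)%:R - mu - 1) * expR (- sigma * (x - tau)) * f tau.

Definition frac_int (R : realType) (sigma mu : R) (f : R -> R) (x : R) : R :=
  \int[@lebesgue_measure R]_(tau in [set` `]0, x[%R]) frac_kernel sigma mu f x tau.

Definition subst_op (R : realType) (sigma : R) (F : R -> R) : R -> R :=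
  fun x => derive1 F x + sigma * F x.

Definition Ds (R : realType) (sigma mu : R) (f : R -> R) (x : R) : R :=
  (Gamma ((frac_order mu)%:R - mu))^-1 *
  iter (frac_order mu) (subst_op sigma) (frac_int sigma mu f) x.

(* [Ds] is total, so its value at x is meaningful only when the integral
   converges near x and the successive derivatives exist. *)
Definition Ds_exists (R : realType) (sigma mu : R) (f : R -> R) (x : R) : Prop :=
  [/\ \forall y \near x, integrable_on [set` `]0, y[%R] (frac_kernel sigma mu f y),
      forall j : nat, (j.+1 < frac_order mu)%N ->
        \forall y \near x,
          derivable (iter j (subst_op sigma) (frac_int sigma mu f)) y 1
    & derivable (iter (frac_order mu).-1 (subst_op sigma) (frac_int sigma mu f)) x 1].

(* The source term may be singular at 0 and is an element of a weighted L^2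
   space, so the equation is imposed almost everywhere on (0, +oo). *)
Definition is_solution (R : realType) (sigma nu : R) (f u : R -> R) : Prop :=
  [/\ {ae @lebesgue_measure R, forall x, 0 < x ->
         Ds_exists sigma (2 - nu) u x /\ Ds sigma (2 - nu) u x = f x},
      u 0 = 0
    & u x @[x --> +oo] --> (0 : R)].

(* L_n^a(x) = \sum_(i <= n) (-1)^i binom(n + a, n - i) x^i / i!, where
   binom(n + a, n - i) = (a + i + 1) ... (a + n) / (n - i)! *)
Definition laguerre_std (R : realType) (a : R) (n : nat) : {poly R} :=
  \poly_(i < n.+1) ((-1) ^+ i * (\prod_(i <= j < n) (a + j.+1%:R))
                     / (n - i)`!%:R / i`!%:R).

(* the case a <= -1 is the extension to -2 < a <= -1 *)
Definition laguerre (R : realType) (a : R) (n : nat) : {poly R} :=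
  if -1 < a then laguerre_std a n
  else if n is n'.+1 then laguerre_std (a + 1) n - laguerre_std (a + 1) n'
  else 1.

Definition laguerre_hat (R : realType) (sigma a : R) (n : nat) (x : R) : R :=
  x `^ a * expR (- sigma * x) * (laguerre a n).[2 * sigma * x].

Definition wnorm (R : realType) (w v : R -> R) : \bar R :=
  sqrte (\int[@lebesgue_measure R]_(x in half_line) ((v x) ^+ 2 * w x)%:E).

Definition weight (R : realType) (sigma a : R) (x : R) : R :=
  x `^ a * expR (- (2 * sigma * x)).

Definition weight_hat2 (R : realType) (lambda nu : R) (x : R) : R :=
  x `^ (2 - lambda - nu).

Definition test_function (R : realType) (phi : R -> R) : Prop :=
  (forall (n : nat) (x : R), derivable (derive1n n phi) x 1) /\
  (exists a b : R, 0 < a /\ forall x, ~ (a <= x <= b) -> phi x = 0).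

Definition is_wderiv (R : realType) (v w : R -> R) : Prop :=
  [/\ locally_integrable half_line v,
      locally_integrable half_line w
    & forall phi : R -> R, test_function phi ->
        \int[@lebesgue_measure R]_(x in half_line) (v x * derive1 phi x) =
        - \int[@lebesgue_measure R]_(x in half_line) (w x * phi x)].

(* A choice of weak derivative; it is unique up to null sets, and is the zero
   function if there is none. *)
Definition wderiv (R : realType) (v : R -> R) : R -> R :=
  xget (fun=> 0) [set w : R -> R | is_wderiv v w].

Definition wderivn (R : realType) (k : nat) (v : R -> R) : R -> R :=
  iter k (@wderiv R) v.

Definition Bnorm (R : realType) (sigma a : R) (r : nat) (v : R -> R) : \bar R :=
  sqrte (\sum_(k < r.+1) wnorm (weight sigma (a + k%:R)) (wderivn k v) ^+ 2)%E.

Definition Bspace (R : realType) (sigma a : R) (r : nat) : set (R -> R) :=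
  [set v | [/\ measurable_fun half_line v,
               forall k, (k < r)%N -> is_wderiv (wderivn k v) (wderivn k.+1 v)
             & (Bnorm sigma a r v < +oo)%E]].

Definition g_of (R : realType) (sigma nu lambda : R) (f : R -> R) (x : R) : R :=
  f x * expR (sigma * x) * x `^ (2 - lambda - nu).

Definition trial_basis (R : realType) (sigma nu lambda : R) (n : nat) (x : R) : R :=
  n.+1%:R `^ (- ((lambda - nu + 2) / 2)) * laguerre_hat sigma lambda n x.

Definition test_basis (R : realType) (sigma nu lambda : R) (n : nat) (x : R) : R :=
  n.+1%:R `^ (- ((lambda + nu - 2) / 2)) *
  laguerre_hat sigma (lambda + nu - 2) n x.

Definition span_upto (R : realType) (phi : nat -> R -> R) (N : nat) : set (R -> R) :=
  [set v | exists c : nat -> R,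
     forall x, 0 < x -> v x = \sum_(n < N.+1) c n * phi n x].

(* The first clause says that both sides of the Galerkin equation
   (Ds u_N, v) = (f, v) are convergent integrals for all v in the test space.
   For Ds u_N this is automatic when lambda + nu >= 1, but not when
   lambda + nu < 1, since the modified Laguerre functions of index
   lambda + nu - 2 < -1 are then not in the weighted L^2 space.  The second
   clause is the diagonal system that realizes the Galerkin equations. *)
Definition petrov_galerkin (R : realType) (sigma nu lambda : R) (N : nat)
    (f uN : R -> R) : Prop :=
  (forall v, span_upto (test_basis sigma nu lambda) N v ->
     integrable_on half_line
       (fun x => Ds sigma (2 - nu) uN x * v x * weight_hat2 lambda nu x) /\
     integrable_on half_line
       (fun x => f x * v x * weight_hat2 lambda nu x)) /\
  (exists c : nat -> R,
     (forall x, 0 <= x ->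
        uN x = \sum_(k < N.+1) c k * trial_basis sigma nu lambda k x) /\
     (forall k, (k <= N)%N ->
        (1 / (2 * sigma)) `^ (lambda + nu - 1) *
        (Gamma (lambda + k%:R + 1) / (Gamma (k%:R + 1) * k.+1%:R `^ lambda)) * c k =
        (k.+1%:R `^ ((lambda + nu - 2) / 2))^-1 *
        \int[@lebesgue_measure R]_(x in half_line)
          (f x * expR (- sigma * x) *
           (laguerre (lambda + nu - 2) k).[2 * sigma * x]))).

(* Main.v *)
Require Import Defs.
From mathcomp Require Import all_boot all_order all_algebra.
From mathcomp Require Import all_classical all_reals all_analysis.
From mathcomp Require Import measurable_realfun.
From mathcomp Require Import ring lra zify.
Import Order.TTheory GRing.Theory Num.Theory.
Import numFieldNormedType.Exports.
Set Implicit Arguments.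
Unset Strict Implicit.
Unset Printing Implicit Defensive.
Local Open Scope classical_set_scope.
Local Open Scope ring_scope.

(** Put b = 2 sigma, al = lambda + nu - 2 in ]-2, 0[, and let w_a be the weight
    x^a e^{-bx}, so that g_f w_al = f e^{-sigma x}.

    The beta integral computes the fractional derivative of the trial functions:
    if u_N = x^lambda e^{-sigma x} U, with U a polynomial, then D_s^{2-nu} u_N =
    x^al e^{-sigma x} p, where p is obtained from U by multiplying the
    coefficient of x^i by Gamma(lambda+i+1) (al+i+1) / Gamma(al+i+2)
    ([Ds_powpoly]).  This operation sends L_k^lambda to a multiple of L_k^al
    ([frac_poly_laguerre]).  Hence the error of the theorem is
    x^al e^{-sigma x} (g_f - p), its norm is the norm of g_f - p for the weight
    w_al, and the diagonal system says that g_f - p is orthogonal to the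
    polynomials of degree at most N ([galerkin_error]).

    The estimate then follows from a Poincare inequality ([poincare]): if e is
    orthogonal for w_al to the polynomials of degree less than n, then
    n b int e^2 w_al <= int e'^2 w_{al+1}.  Integration by parts shows that e' is
    in turn orthogonal for w_{al+1} to one degree less
    ([derivative_orthogonal]), so the inequality can be iterated m times,
    starting from e = g_f - p and n = N + 1 ([laguerre_approximation]); the
    polynomial p is removed from the m-th derivative at the end, since the
    m-th derivative of p is the orthogonal projection of that of g_f.
    The constants multiply to b^m (N+1) N ... (N+2-m) >= (b/m)^m N^m.

    The Poincare inequality is proved by induction on n, without using that the
    Laguerre polynomials are complete.  Let h = (1/w_{al+1}) int_x^oo e w_al.
    Then x h' + (al+1-bx) h = - e; expanding the square of this relation and
    integrating gives int e^2 w_al = int h'^2 w_{al+2} + b int h^2 w_{al+1}, up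
    to boundary terms ([ladder_energy]).  As h is orthogonal for w_{al+1} to one
    degree less than e ([ladder_orthogonal]), the induction hypothesis bounds
    the first term below by (n-1) b int h^2 w_{al+1}, so that
    n b int h^2 w_{al+1} <= int e^2 w_al.  Since int e^2 w_al =
    int e' h w_{al+1} ([ladder_duality]), the Cauchy-Schwarz inequality
    concludes.

    Two points need care.  If al <= -1, then w_al is not integrable at 0: the
    moments of w_al are continued through Gamma(a+i+2) / (a+i+1), and the
    convergence of the Galerkin integrals forces p(0) = 0
    ([horner0_of_integrable]).  For al = -1 the zeroth moment is a pole, and
    orthogonality is only meant against polynomials that vanish at 0.
    Moreover the derivatives of g_f are weak derivatives: testing against
    smoothed indicator functions of segments shows that they are derivatives
    almost everywhere of absolutely continuous functions
    ([weak_derivative_ac]). *)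

(** * Integration on the half line *)

Section toolkit.
Context {R : realType}.
Notation mu := (@lebesgue_measure R).
Implicit Types (f g F : R -> R) (a b : nat -> R).

Lemma half_lineE (x : R) : half_line x = (0 < x) :> Prop.
Proof. by rewrite /half_line /= in_itv/= andbT. Qed.

Lemma measurable_half_line : measurable (@half_line R).
Proof. exact: measurable_itv. Qed.
Hint Resolve measurable_half_line : core.

Lemma segment_half_line (a b : R) : 0 < a -> `[a, b] `<=` half_line.
Proof.
by move=> a0 x /=; rewrite in_itv/= half_lineE => /andP[+ _]; exact: lt_le_trans.
Qed.

Lemma integrable_onP (D : set R) f : measurable D -> measurable_fun D f ->
  (\int[mu]_(x in D) `|(f x)%:E| < +oo)%E -> integrable_on D f.
Proof. by move=> mD mf foo; apply/integrableP; split => //; exact/measurable_EFinP. Qed.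

Lemma integrable_on_measurable (D : set R) f : integrable_on D f -> measurable_fun D f.
Proof. by move/(measurable_int mu)/measurable_EFinP. Qed.

Lemma integrable_onS (D E : set R) f : measurable D -> measurable E -> E `<=` D ->
  integrable_on D f -> integrable_on E f.
Proof. by move=> mD mE ED; rewrite /integrable_on; exact: integrableS. Qed.

Lemma integrable_on_le (D : set R) f g : measurable D -> measurable_fun D f ->
  (forall x, D x -> `|f x| <= g x) -> integrable_on D g -> integrable_on D f.
Proof.
move=> mD mf fg; apply: le_integrable => //; first exact/measurable_EFinP.
move=> x Dx /=; rewrite lee_fin; apply: le_trans (fg _ Dx) _; exact: ler_norm.
Qed.

Lemma integrable_onD (D : set R) f g : measurable D -> integrable_on D f ->
  integrable_on D g -> integrable_on D (fun x => f x + g x).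
Proof.
move=> mD fi gi; have := @integrableD _ _ _ mu D mD _ _ fi gi.
by apply: eq_integrable => // x _; rewrite /= EFinD.
Qed.

Lemma integrable_onZ (D : set R) k f : measurable D -> integrable_on D f ->
  integrable_on D (fun x => k * f x).
Proof. by move=> mD fi; have := @integrableZl _ _ _ mu D mD k _ fi; apply: eq_integrable. Qed.

Lemma integrable_onB (D : set R) f g : measurable D -> integrable_on D f ->
  integrable_on D g -> integrable_on D (fun x => f x - g x).
Proof.
move=> mD fi gi; have := integrable_onD mD fi (integrable_onZ (- 1) mD gi).
by apply: eq_integrable => // x _; rewrite /= mulN1r.
Qed.

Lemma eq_integrable_on (D : set R) f g : measurable D -> {in D, f =1 g} ->
  integrable_on D f -> integrable_on D g.
Proof. by move=> mD fg; apply: eq_integrable => // x xD; rewrite /= fg. Qed.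

Lemma integrable_on_norm (D : set R) f : measurable D -> integrable_on D f ->
  integrable_on D (fun x => `|f x|).
Proof. by move=> mD; exact: integrable_norm. Qed.

Lemma integrable_on_EFin (D : set R) f : measurable D -> integrable_on D f ->
  (\int[mu]_(x in D) (f x)%:E)%E = (\int[mu]_(x in D) f x)%:E.
Proof.
by move=> mD fi; rewrite /Rintegral fineK//; exact: integrable_fin_num.
Qed.

Lemma Rintegral_lincomb (D : set R) (c : nat -> R) (F : nat -> R -> R) n :
  measurable D -> (forall k, integrable_on D (F k)) ->
  integrable_on D (fun x => \sum_(k < n) c k * F k x) /\
  \int[mu]_(x in D) (\sum_(k < n) c k * F k x) = \sum_(k < n) c k * \int[mu]_(x in D) F k x.
Proof.
move=> mD Fi; elim: n => [|n [IH1 IH2]].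
  split.
    apply: eq_integrable_on (integrable_onZ 0 mD (Fi 0%N)) => // x _.
    by rewrite big_ord0 mul0r.
  rewrite big_ord0 (@eq_Rintegral _ _ _ mu _ (fun=> 0)) ?Rintegral_cst ?mul0r// => x _.
  by rewrite big_ord0.
have i2 := integrable_onZ (c n) mD (Fi n).
split.
  by apply: eq_integrable_on (integrable_onD mD IH1 i2) => // x _; rewrite big_ord_recr.
rewrite big_ord_recr/= -IH2 -(@RintegralZl _ _ _ mu _ _ _ mD (Fi n)).
rewrite -(@RintegralD _ _ _ mu _ _ _ mD IH1 i2).
by apply: eq_Rintegral => x _; rewrite big_ord_recr.
Qed.

Lemma Rdominated_convergence (D : set R) (f_ : nat -> R -> R) f g : measurable D ->
  (forall n, measurable_fun D (f_ n)) ->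
  (forall x, D x -> f_ ^~ x @ \oo --> f x) ->
  integrable_on D g -> (forall n x, D x -> `|f_ n x| <= g x) ->
  integrable_on D f /\
  (fun n => \int[mu]_(x in D) f_ n x) @ \oo --> \int[mu]_(x in D) f x.
Proof.
move=> mD mf_ f_f gi fg.
have mf : measurable_fun D f by exact: measurable_fun_cvg mf_ f_f.
have [] := @dominated_convergence _ _ _ mu D mD
   (fun n => EFin \o f_ n) (EFin \o f) (EFin \o g).
- by move=> n /=; apply/measurable_EFinP; exact: mf_.
- by apply/measurable_EFinP.
- apply: aeW => x Dx; apply: cvg_EFin; first exact: nearW.
  exact: f_f.
- exact: gi.
- by apply: aeW => x n Dx /=; rewrite lee_fin fg.
move=> fi _ H; split => //.
by apply: fine_cvg; rewrite -integrable_on_EFin.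
Qed.

Lemma Rintegral_sub (A D : set R) f : A `<=` D ->
  \int[mu]_(x in A) f x = \int[mu]_(x in D) (f \_ A) x.
Proof. by move=> AD; rewrite -Rintegral_mkcondr setIidr. Qed.

Definition exhausts a b := [/\ forall n, 0 < a n, forall n, a n <= b n,
  a @ \oo --> (0 : R) & b @ \oo --> +oo].

Lemma exhausts_near a b (x : R) : exhausts a b -> 0 < x ->
  \forall n \near \oo, a n < x < b n.
Proof.
move=> [_ _ a0 boo] x0; near=> n; apply/andP; split.
- near: n; exact: (cvgr_lt _ a0).
- near: n; exact: (cvgry_gt boo).
Unshelve. all: by end_near. Qed.

Lemma cvg_restrict a b f (x : R) : exhausts a b -> 0 < x ->
  (fun n => (f \_ `[a n, b n]) x) @ \oo --> f x.
Proof.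
move=> ab x0; apply: cvg_near_cst.
near=> n; rewrite patchE mem_set//= in_itv/=.
have : a n < x < b n by near: n; apply: exhausts_near ab x0.
by move=> /andP[/ltW -> /ltW ->].
Unshelve. all: by end_near. Qed.

(** Dominated convergence: the truncations of f to the segments are bounded by
    |f|. *)
Lemma cvg_trunc a b f : exhausts a b -> integrable_on half_line f ->
  (fun n => \int[mu]_(x in `[a n, b n]) f x) @ \oo --> \int[mu]_(x in half_line) f x.
Proof.
move=> ab fi; have [a0 _ _ _] := ab.
have [] := @Rdominated_convergence half_line (fun n => f \_ `[a n, b n]) f (fun x => `|f x|) => //.
- move=> n; apply/measurable_restrict => //.
  by rewrite setIidr; [apply: measurable_funS (integrable_on_measurable fi) => //|];
    exact: segment_half_line.
- by move=> x; rewrite half_lineE => x0; exact: cvg_restrict.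
- exact: integrable_on_norm.
- by move=> n x _; rewrite patchE; case: ifPn => // _; rewrite normr0.
move=> _; apply: cvg_trans; apply: near_eq_cvg; near=> n.
by rewrite -Rintegral_sub//; exact: segment_half_line.
Unshelve. all: by end_near. Qed.

Lemma cvg_vanish (A : nat -> set R) f : (forall n, measurable (A n)) ->
  (forall n, A n `<=` half_line) ->
  (forall x, 0 < x -> \forall n \near \oo, ~ A n x) ->
  integrable_on half_line f ->
  (fun n => \int[mu]_(x in A n) f x) @ \oo --> (0 : R).
Proof.
move=> mA Ah Av fi.
have [] := @Rdominated_convergence half_line (fun n => f \_ (A n)) (fun=> 0) (fun x => `|f x|) => //.
- move=> n; apply/measurable_restrict => //.
  by rewrite setIidr//; apply: measurable_funS (integrable_on_measurable fi).
- move=> x; rewrite half_lineE => x0.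
  apply: cvg_near_cst; near=> n; rewrite patchE memNset//.
  by near: n; exact: Av.
- exact: integrable_on_norm.
- by move=> n x _; rewrite patchE; case: ifPn => // _; rewrite normr0.
move=> _; rewrite Rintegral_cst// mul0r; apply: cvg_trans; apply: near_eq_cvg; near=> n.
by rewrite -Rintegral_sub.
Unshelve. all: by end_near. Qed.

(** Fatou's lemma along the exhausting segments. This is how integrability at
    both ends of the half line is obtained from bounds on segments away from
    0. *)
Lemma integrable_trunc a b f M : exhausts a b -> measurable_fun half_line f ->
  (forall x, 0 < x -> 0 <= f x) ->
  (forall n, integrable_on `[a n, b n] f) ->
  (forall n, \int[mu]_(x in `[a n, b n]) f x <= M) ->
  integrable_on half_line f /\ \int[mu]_(x in half_line) f x <= M.
Proof.
move=> ab mf f0 fi fM; have [a0 _ _ _] := ab.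
have H : (\int[mu]_(x in half_line) (f x)%:E <= M%:E)%E.
  have mfn n : measurable_fun half_line (f \_ `[a n, b n]).
    apply/measurable_restrict => //.
    by rewrite setIidr; [apply: measurable_funS mf => //|]; exact: segment_half_line.
  have := @fatou _ _ _ mu half_line measurable_half_line
     (fun n => EFin \o (f \_ `[a n, b n])).
  move=> /(_ (fun n => proj2 (measurable_EFinP _ _) (mfn n))).
  have p n x : half_line x -> (0 <= (EFin \o f \_ `[a n, b n]) x)%E.
    by rewrite half_lineE /= lee_fin patchE => x0; case: ifPn => // _; exact: f0.
  move=> /(_ p) H; apply: le_trans (le_trans H _).
    rewrite le_eqVlt; apply/orP; left; apply/eqP/eq_integral => x.
    rewrite inE half_lineE => x0.
    have /cvg_limn_einf_sup[-> _] // :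
        (fun n => ((f \_ `[a n, b n]) x)%:E) @ \oo --> (f x)%:E.
      by apply: cvg_EFin; [exact: nearW|exact: cvg_restrict].
  apply: le_trans (limn_einf_sup _) _; rewrite limn_esup_lim.
  apply: lime_le; first exact: is_cvg_esups.
  apply: nearW => n; apply: ge_ereal_sup => _ [k _ <-].
  have -> : (\int[mu]_(x in half_line) (EFin \o (f \_ `[a k, b k])) x =
            (\int[mu]_(x in `[a k, b k]) f x)%:E)%E.
    rewrite -integrable_on_EFin// -[in RHS](@setIidr _ half_line `[a k, b k]).
      by rewrite integral_mkcondr restrict_EFin.
    exact: segment_half_line.
  by rewrite lee_fin.
have fi0 : integrable_on half_line f.
  apply: integrable_onP => //; apply: le_lt_trans (ltry M); apply: le_trans H.
  rewrite le_eqVlt; apply/orP; left; apply/eqP/eq_integral => x.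
  by rewrite inE half_lineE => x0 /=; rewrite ger0_norm// f0.
by split => //; move: H; rewrite integrable_on_EFin.
Unshelve. all: by end_near. Qed.

Definition cont_hl f := forall x : R, 0 < x -> {for x, continuous f}.

Lemma cont_hl_within f (a b : R) : 0 < a -> cont_hl f ->
  {within `[a, b], continuous f}.
Proof.
move=> a0 cf; apply: continuous_in_subspaceT => x /set_mem.
by move=> /(segment_half_line a0); rewrite half_lineE; exact: cf.
Qed.

Lemma cont_hl_measurable f : cont_hl f -> measurable_fun half_line f.
Proof.
move=> cf; apply: open_continuous_measurable_fun; first exact: itv_open_ends_open.
by move=> x /set_mem; rewrite half_lineE; exact: cf.
Qed.

Lemma cont_hl_integrable f (a b : R) : 0 < a -> cont_hl f -> integrable_on `[a, b] f.
Proof.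
move=> a0 cf; apply: continuous_compact_integrable; first exact: segment_compact.
exact: cont_hl_within.
Qed.

Lemma FTC_hl F f (a b : R) : 0 < a -> a <= b -> cont_hl f ->
  (forall x : R, 0 < x -> is_derive x 1 F (f x)) ->
  \int[mu]_(x in `[a, b]) f x = F b - F a.
Proof.
move=> a0; rewrite le_eqVlt => /predU1P[<-|ab] cf dF.
  by rewrite set_itv1 Rintegral_set1 subrr.
have cF (x : R) : 0 < x -> {for x, continuous F}.
  move=> x0; apply: differentiable_continuous; apply/derivable1_diffP.
  by case: (dF x x0).
rewrite /Rintegral (@continuous_FTC2 _ f F)//.
- exact: cont_hl_within.
- split.
  + move=> x /[!in_itv]/= /andP[ax _]; by case: (dF x (lt_trans a0 ax)).
  + by apply: cvg_at_right_filter; exact: cF.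
  + by apply: cvg_at_left_filter; apply: cF; exact: lt_trans ab.
- move=> x /[!in_itv]/= /andP[ax _]; rewrite derive1E.
  by case: (dF x (lt_trans a0 ax)).
Qed.

(** The quadratic form of (s, t) given by the integral of (s f + t g)^2 is
    nonnegative, so its discriminant is at most 0. *)
Lemma cauchy_schwarz (D : set R) f g : measurable D ->
  measurable_fun D f -> measurable_fun D g ->
  integrable_on D (fun x => f x ^+ 2) -> integrable_on D (fun x => g x ^+ 2) ->
  integrable_on D (fun x => f x * g x) /\
  (\int[mu]_(x in D) (f x * g x)) ^+ 2 <=
  (\int[mu]_(x in D) (f x ^+ 2)) * (\int[mu]_(x in D) (g x ^+ 2)).
Proof.
move=> mD mf mg fi gi.
have fgi : integrable_on D (fun x => f x * g x).
  apply: (@integrable_on_le _ _ (fun x => f x ^+ 2 + g x ^+ 2)) => //.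
  - exact: measurable_funM.
  - move=> x _; rewrite normrM -(real_normK (num_real (f x))) -(real_normK (num_real (g x))).
    have := sqr_ge0 (`|f x| - `|g x|); have := normr_ge0 (f x); have := normr_ge0 (g x).
    nra.
  - exact: integrable_onD.
split => //.
set A := \int[mu]_(x in D) (f x ^+ 2); set B := \int[mu]_(x in D) (f x * g x).
set C := \int[mu]_(x in D) (g x ^+ 2).
have H (s t : R) : 0 <= s ^+ 2 * A + (2 * s * t) * B + t ^+ 2 * C.
  rewrite -!RintegralZl// -!RintegralD//; do ?[exact: integrable_onZ | exact: integrable_onD].
    by apply: Rintegral_ge0 => x _; have := sqr_ge0 (s * f x + t * g x); nra.
  by apply: integrable_onD => //; exact: integrable_onZ.
have A0 : 0 <= A by apply: Rintegral_ge0 => x _; exact: sqr_ge0.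
have [A_eq0|An0] := eqVneq A 0.
  have [->|Bn0] := eqVneq B 0; first by rewrite expr0n/= mulr_ge0//;
    apply: Rintegral_ge0 => x _; exact: sqr_ge0.
  have := H (- (C + 1) / (2 * B)) 1; rewrite A_eq0.
  by have -> : 2 * (- (C + 1) / (2 * B)) * 1 * B = - (C + 1); [field|lra].
have {}A0 : 0 < A by rewrite lt_neqAle eq_sym An0.
have := H (- B) A; nra.
Qed.

Lemma ln_FTC (a b : R) : 0 < a -> a <= b ->
  \int[mu]_(x in `[a, b]) x^-1 = ln b - ln a.
Proof.
move=> a0 ab; apply: (@FTC_hl (@ln R) (fun x => x^-1)) => // x x0.
by apply: continuousV; [rewrite gt_eqF|exact: id].
Qed.

Lemma le_Rintegral_sub (A D : set R) f : measurable D -> measurable A -> A `<=` D ->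
  integrable_on D f -> (forall x, D x -> 0 <= f x) ->
  \int[mu]_(x in A) f x <= \int[mu]_(x in D) f x.
Proof.
move=> mD mA AD fi f0.
rewrite -lee_fin -!integrable_on_EFin//; last exact: integrable_onS fi.
apply: ge0_subset_integral => //.
by apply/measurable_EFinP; exact: integrable_on_measurable fi.
Qed.

Lemma cvg0_le (u v : nat -> R) : (forall n, `|u n| <= v n) ->
  v @ \oo --> (0 : R) -> u @ \oo --> (0 : R).
Proof.
move=> uv v0; apply/norm_cvg0P; apply: squeeze_cvgr (cvg_cst _) v0.
by apply: nearW => n; rewrite normr_ge0 uv.
Qed.

Lemma cvg_mul0 (c : R) (u : nat -> R) : u @ \oo --> (0 : R) ->
  (fun n => c * u n) @ \oo --> (0 : R).
Proof.
by move=> u0; rewrite -[X in _ --> X](mulr0 c); apply: cvgM; [exact: cvg_cst|].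
Qed.

Lemma exhausts_around (x : R) : 0 < x ->
  exhausts (fun n => x / n.+1%:R) (fun n => x + n%:R).
Proof.
move=> x0; split => [n|n||].
- by rewrite divr_gt0.
- apply: (@le_trans _ _ x); last by rewrite lerDl.
  by rewrite ler_pdivrMr// ler_peMr ?ler1n// ltW.
- exact: cvg_mul0 cvg_harmonic.
- by apply: ger_cvgy (@cvgr_idn R); apply: nearW => n; rewrite lerDr ltW.
Qed.

(** Otherwise F would be at least e / x near 0, which is not integrable. *)
Lemma vanish0 F (e d : R) : (forall x, 0 < x -> 0 <= F x) ->
  integrable_on half_line F -> 0 < e -> 0 < d ->
  exists x, [/\ 0 < x, x < d & x * F x < e].
Proof.
move=> F0 Fi e0 d0; apply: contrapT => H.
have {}H (x : R) : 0 < x -> x < d -> e / x <= F x.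
  move=> x0 xd; rewrite ler_pdivrMr// mulrC leNgt; apply/negP => Fx; apply: H.
  by exists x.
set I := \int[mu]_(x in half_line) F x.
(* With this a, the integral of e / x over [a, d / 2] is I + 1. *)
pose a := d / 2 * expR (- ((I + 1) / e)).
have a0 : 0 < a by rewrite mulr_gt0 ?expR_gt0 ?divr_gt0.
have ge0I : 0 <= I by apply: Rintegral_ge0 => x; rewrite half_lineE; exact: F0.
have ad : a <= d / 2.
  rewrite ler_piMr ?divr_ge0 ?(ltW d0)// -expR0 ler_expR oppr_le0 divr_ge0 ?(ltW e0)//.
  by rewrite addr_ge0.
have sub : `[a, (d / 2)] `<=` half_line by exact: segment_half_line.
have iv : integrable_on `[a, (d / 2)] (fun x => x^-1).
  by apply: cont_hl_integrable => // x x0; apply: continuousV; [rewrite gt_eqF|exact: id].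
have := @le_Rintegral_sub `[a, (d / 2)] half_line F.
move=> /(_ measurable_half_line (measurable_itv _) sub Fi).
have hF0 (x : R) : half_line x -> 0 <= F x by rewrite half_lineE; exact: F0.
move=> /(_ hF0); apply/negP; rewrite -ltNge -/I.
apply: (@lt_le_trans _ _ (\int[mu]_(x in `[a, (d / 2)]) (e * x^-1))).
  rewrite RintegralZl// ln_FTC// /a [ln (_ * expR _)]lnM ?posrE ?divr_gt0 ?expR_gt0// expRK.
  by rewrite opprD addrA subrr sub0r opprK mulrC divfK ?gt_eqF// ltrDl.
apply: le_Rintegral => //.
- exact: integrable_onZ.
- exact: integrable_onS Fi.
- move=> x xad; apply: H.
    by have := sub _ xad; rewrite half_lineE.
  move: xad => /=; rewrite in_itv/= => /andP[_]; lra.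
Qed.

Lemma vanishoo F (e X : R) : (forall x, 0 < x -> 0 <= F x) ->
  integrable_on half_line F -> 0 < e -> 0 < X ->
  exists x, X < x /\ F x < e.
Proof.
move=> F0 Fi e0 X0; apply: contrapT => H.
have {}H (x : R) : X < x -> e <= F x.
  move=> x0; rewrite leNgt; apply/negP => Fx; apply: H.
  by exists x.
set I := \int[mu]_(x in half_line) F x.
have ge0I : 0 <= I by apply: Rintegral_ge0 => x; rewrite half_lineE; exact: F0.
pose Y := X + 1; pose b := Y + (I + 1) / e.
have Yb : Y <= b by rewrite lerDl divr_ge0 ?(ltW e0)// addr_ge0.
have sub : `[Y, b] `<=` half_line by apply: segment_half_line; rewrite /Y; lra.
have := @le_Rintegral_sub `[Y, b] half_line F.
move=> /(_ measurable_half_line (measurable_itv _) sub Fi).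
have hF0 (x : R) : half_line x -> 0 <= F x by rewrite half_lineE; exact: F0.
move=> /(_ hF0); apply/negP; rewrite -ltNge -/I.
apply: (@lt_le_trans _ _ (\int[mu]_(x in `[Y, b]) e)).
  rewrite Rintegral_cst//= lebesgue_measure_itv/= lte_fin.
  rewrite ifT; last by rewrite /b ltrDl divr_gt0// ltr_wpDl.
  by rewrite /= /b [Y + _]addrC addrK mulrC divfK ?gt_eqF// ltrDl.
apply: le_Rintegral => //.
- by apply: continuous_compact_integrable; [exact: segment_compact|move=> ?; exact: cvg_cst].
- exact: integrable_onS Fi.
- by move=> x; rewrite /= in_itv/= => /andP[Yx _]; apply: H; rewrite /Y in Yx; lra.
Qed.

(** In the integrations by parts, the boundary terms are controlled by x F x
    near 0 and by F near +oo, for an integrable function F; these need not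
    tend to 0, but they do along well chosen sequences. *)
Lemma vanish_seq F (d X : R) : 0 < d -> d <= X ->
  (forall x, 0 < x -> 0 <= F x) -> integrable_on half_line F ->
  exists a b, [/\ exhausts a b, (fun n => a n * F (a n)) @ \oo --> (0 : R),
    (fun n => F (b n)) @ \oo --> (0 : R), forall n, a n <= d & forall n, X <= b n].
Proof.
move=> d0 dX F0 Fi.
have X0 : 0 < X := lt_le_trans d0 dX.
have i0 n : 0 < n.+1%:R^-1 :> R by rewrite invr_gt0.
have /choice[a aP] : forall n : nat, exists x : R,
    [/\ 0 < x, x < d, x < n.+1%:R^-1 & x * F x < n.+1%:R^-1].
  move=> n; have m0 : 0 < Num.min d n.+1%:R^-1 by rewrite lt_min d0 i0.
  have [x [x0]] := vanish0 F0 Fi (i0 n) m0.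
  by rewrite lt_min => /andP[? ?] ?; exists x.
have /choice[b bP] : forall n : nat, exists x : R,
    [/\ X < x, n%:R < x & F x < n.+1%:R^-1].
  move=> n; have m0 : 0 < Num.max X n%:R by rewrite lt_max X0.
  have [x []] := vanishoo F0 Fi (i0 n) m0.
  by rewrite gt_max => /andP[? ?] ?; exists x.
have a0 n : 0 < a n by case: (aP n).
have bX n : X <= b n by case: (bP n) => /ltW.
have ad n : a n <= d by case: (aP n) => _ /ltW.
exists a, b; split => //.
- split => //.
  + by move=> n; exact: le_trans (ad n) (le_trans dX (bX n)).
  + apply: cvg0_le cvg_harmonic => n.
    by rewrite ger0_norm ?(ltW (a0 _))//; case: (aP n) => _ _ /ltW.
  + by apply: ger_cvgy (@cvgr_idn R); apply: nearW => n; case: (bP n) => _ /ltW.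
- apply: cvg0_le cvg_harmonic => n.
  by rewrite ger0_norm ?mulr_ge0 ?(ltW (a0 _)) ?F0//; case: (aP n) => _ _ _ /ltW.
- apply: cvg0_le cvg_harmonic => n.
  rewrite ger0_norm ?F0//; first by case: (bP n) => _ _ /ltW.
  by rewrite (lt_le_trans _ (bX n)).
Qed.

Lemma weighted_cauchy_schwarz (D : set R) (w : R -> R) f g : measurable D ->
  measurable_fun D w -> (forall x, D x -> 0 <= w x) ->
  measurable_fun D f -> measurable_fun D g ->
  integrable_on D (fun x => f x ^+ 2 * w x) -> integrable_on D (fun x => g x ^+ 2 * w x) ->
  integrable_on D (fun x => f x * g x * w x) /\
  (\int[mu]_(x in D) (f x * g x * w x)) ^+ 2 <=
  (\int[mu]_(x in D) (f x ^+ 2 * w x)) * (\int[mu]_(x in D) (g x ^+ 2 * w x)).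
Proof.
move=> mD mw w0 mf mg fi gi.
pose s x := w x `^ (2^-1).
have s2 x : D x -> s x ^+ 2 = w x.
  by move=> Dx; rewrite /s powR12_sqrt ?w0// sqr_sqrtr// w0.
have ms : measurable_fun D s by exact: measurableT_comp (measurable_powR _) mw.
have Ef h x : x \in D -> h x ^+ 2 * w x = (h x * s x) ^+ 2.
  by move=> /set_mem Dx; rewrite exprMn s2.
have Efg x : x \in D -> f x * g x * w x = (f x * s x) * (g x * s x).
  by move=> /set_mem Dx; rewrite -s2//; ring.
have [] := @cauchy_schwarz D (fun x => f x * s x) (fun x => g x * s x) mD.
- exact: measurable_funM.
- exact: measurable_funM.
- by apply: eq_integrable_on fi => // x; exact: Ef.
- by apply: eq_integrable_on gi => // x; exact: Ef.
move=> i1 i2; split; first by apply: eq_integrable_on i1 => // x xD; rewrite Efg.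
by rewrite (@eq_Rintegral _ _ _ mu _ _ _ Efg) (@eq_Rintegral _ _ _ mu _ _ _ (Ef f))
  (@eq_Rintegral _ _ _ mu _ _ _ (Ef g)).
Qed.

End toolkit.
#[global] Hint Extern 0 (measurable half_line) => exact: measurable_half_line : core.

(** * Absolutely continuous functions *)

Section absolutely_continuous.
Context {R : realType}.
Notation mu := (@lebesgue_measure R).
Implicit Types (e f g G : R -> R).

Lemma Rintegral_cat f (a b c : R) : a <= b -> b <= c -> integrable_on `[a, c] f ->
  \int[mu]_(x in `[a, c]) f x =
  \int[mu]_(x in `[a, b]) f x + \int[mu]_(x in `[b, c]) f x.
Proof.
move=> ab bc fi; have := @Rintegral_itvB R f (BLeft a) (BRight c) b fi.
rewrite !bnd_simp => /(_ ab bc) /eqP; rewrite subr_eq addrC => /eqP ->; congr (_ + _).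
apply: Rintegral_itv_obnd_cbnd; apply: integrable_onS fi => //.
by apply: subset_itv; rewrite bnd_simp.
Qed.

Lemma integrable_segS f (a b c d : R) : a <= b -> c <= d -> integrable_on `[a, d] f ->
  integrable_on `[b, c] f.
Proof.
by move=> ab cd; apply: integrable_onS => //; apply: subset_itv; rewrite bnd_simp.
Qed.

Lemma Rintegral_seg_cst (a b k : R) : a <= b -> \int[mu]_(x in `[a, b]) k = k * (b - a).
Proof.
move=> ab; rewrite Rintegral_cst//= lebesgue_measure_itv/= lte_fin; case: ltP => //= ba.
by rewrite (_ : b = a) ?subrr//; apply/le_anti/andP.
Qed.

Lemma integrable_seg_cst (a b k : R) : integrable_on `[a, b] (fun=> k).
Proof.
by apply: continuous_compact_integrable; [exact: segment_compact|move=> ?; exact: cvg_cst].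
Qed.

(** Local absolute continuity of e with derivative e1, expressed by the
    fundamental theorem of calculus: this is all that is used of it. *)
Definition ac_hl (e e1 : R -> R) := forall a b : R, 0 < a -> a <= b ->
  integrable_on `[a, b] e1 /\ \int[mu]_(x in `[a, b]) e1 x = e b - e a.

Lemma ac_hl_cont e e1 : ac_hl e e1 -> cont_hl e.
Proof.
move=> ace x x0.
pose a := x / 2; pose b := 2 * x.
have a0 : 0 < a by rewrite /a divr_gt0.
have ax : a < x by rewrite /a; lra.
have xb : x < b by rewrite /b; lra.
have ab : a < b by lra.
have [e1i _] := ace a b a0 (ltW ab).
have := @parameterized_integral_continuous R a b e1 (ltW ab) e1i.
move=> /(continuous_within_itvP _ ab)[+ _ _] => /(_ x).
rewrite in_itv/= ax xb => /(_ isT) cI.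
have : (fun y => e a + parameterized_integral mu a y e1) @ x --> e a + parameterized_integral mu a x e1.
  by apply: cvgD => //; exact: cvg_cst.
rewrite {2}/parameterized_integral (ace _ _ a0 (ltW ax)).2 addrC subrK.
apply: cvg_trans; apply: near_eq_cvg; near=> y.
rewrite /parameterized_integral (ace a y a0 _).2 1?addrC ?subrK//.
by apply/ltW; near: y; exact: lt_nbhsr.
Unshelve. all: by end_near. Qed.

Lemma bounded_seg g (a b : R) : 0 < a -> a <= b -> cont_hl g ->
  exists2 K, 0 <= K & forall x, a <= x <= b -> `|g x| <= K.
Proof.
move=> a0 ab cg.
have [c _ cP] := @EVT_max R (fun x => `|g x|) a b ab
  (@cont_hl_within _ (fun x => `|g x|) a b a0 (fun x x0 => continuous_comp (cg x x0) (@norm_continuous _ _ _))).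
by exists `|g c| => // x xab; apply: cP; rewrite in_itv/=.
Qed.

(** Cut the segment into n + 1 equal parts. On each of them the increment of F
    is at most K (b - a) / (n + 1) times that of V, and the increments of V
    add up to V b - V a. *)
Lemma second_order_const (F V : R -> R) (a b K : R) : a <= b ->
  (forall x y, a <= x -> x <= y -> y <= b -> `|F y - F x| <= K * (y - x) * (V y - V x)) ->
  F b = F a.
Proof.
move=> ab H.
have key n : `|F b - F a| <= (K * (b - a) * (V b - V a)) * n.+1%:R^-1.
  pose t i := a + i%:R * ((b - a) / n.+1%:R).
  have n0 : (n.+1%:R : R) != 0 by rewrite pnatr_eq0.
  have t0 : t 0%N = a by rewrite /t mul0r addr0.
  have tn : t n.+1 = b by rewrite /t mulrC divfK// addrC subrK.
  have ts i : t i.+1 - t i = (b - a) / n.+1%:R by rewrite /t -natr1; ring.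
  have d0 : 0 <= (b - a) / n.+1%:R by rewrite divr_ge0 ?subr_ge0.
  have ti i : (i <= n)%N -> `|F (t i.+1) - F (t i)| <=
      K * ((b - a) / n.+1%:R) * (V (t i.+1) - V (t i)).
    move=> ni; rewrite -(ts i); apply: H.
    - by rewrite lerDl mulr_ge0.
    - by rewrite -subr_ge0 ts.
    - by rewrite -tn lerD2l ler_wpM2r// ler_nat.
  have tk k : (k <= n.+1)%N -> `|F (t k) - F (t 0%N)| <=
      K * ((b - a) / n.+1%:R) * (V (t k) - V (t 0%N)).
    elim: k => [_|k IH kn]; first by rewrite !subrr normr0 mulr0.
    rewrite -(subrKA (F (t k))) (le_trans (ler_normD _ _))//.
    apply: le_trans (lerD (ti k kn) (IH (ltnW kn))) _.
    by rewrite -mulrDr subrKA.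
  by have := tk _ (leqnn _); rewrite tn t0; congr (_ <= _); ring.
have : `|F b - F a| <= 0.
  have C0 : (fun n => K * (b - a) * (V b - V a) * n.+1%:R^-1) @ \oo --> (0 : R).
    by rewrite -[0](mulr0 (K * (b - a) * (V b - V a))); apply: cvgM; [exact: cvg_cst|exact: cvg_harmonic].
  by apply: (@cvgr_to_ge _ _ _ _ _ _ _ C0); exact: nearW.
by rewrite normr_le0 subr_eq0 => /eqP.
Qed.

(** The difference F of the two sides, as a function of the upper bound,
    satisfies |F y - F x| <= 2 K (y - x) (V y - V x), where V is the variation
    of e and K bounds the derivative of G, so [second_order_const] applies. *)
Lemma ac_integration_by_parts (e e1 G g : R -> R) (a b : R) : 0 < a -> a <= b -> ac_hl e e1 ->
  cont_hl g -> (forall x : R, 0 < x -> is_derive x 1 G (g x)) ->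
  integrable_on `[a, b] (fun x => e1 x * G x) /\
  \int[mu]_(x in `[a, b]) (e1 x * G x) =
  e b * G b - e a * G a - \int[mu]_(x in `[a, b]) (e x * g x).
Proof.
move=> a0 ab ace cg dG.
have ce := ac_hl_cont ace.
have cG : cont_hl G.
  move=> x x0; apply: differentiable_continuous; apply/derivable1_diffP.
  by case: (dG x x0).
have [e1i _] := ace a b a0 ab.
have [K K0 gK] := bounded_seg a0 ab cg.
have [L L0 GL] := bounded_seg a0 ab cG.
have mseg f (c d : R) : 0 < c -> cont_hl f -> measurable_fun `[c, d] f.
  by move=> c0 cf; apply: integrable_on_measurable; exact: cont_hl_integrable.
have e1Gi : integrable_on `[a, b] (fun x => e1 x * G x).
  apply: (@integrable_on_le _ _ _ (fun x => L * `|e1 x|)) => //.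
  - by apply: measurable_funM; [exact: integrable_on_measurable|exact: mseg].
  - by move=> x; rewrite /= in_itv/= => xab; rewrite normrM mulrC ler_wpM2r// GL.
  - by apply: integrable_onZ => //; exact: integrable_on_norm.
split => //.
have egi : integrable_on `[a, b] (fun x => e x * g x).
  by apply: cont_hl_integrable => // x x0; apply: continuousM; [exact: ce|exact: cg].
have ii : integrable_on `[a, b] (fun x => e1 x * G x + e x * g x) by exact: integrable_onD.
pose F x := e x * G x - \int[mu]_(t in `[a, x]) (e1 t * G t + e t * g t).
pose V x := \int[mu]_(t in `[a, x]) `|e1 t|.
have ne1i : integrable_on `[a, b] (fun x => `|e1 x|) by exact: integrable_on_norm.
suff : F b = F a.
  rewrite /F set_itv1 Rintegral_set1 subr0 RintegralD//; lra.
apply: (@second_order_const _ V _ _ (2 * K)) => // x y ax xy yb.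
have ay := le_trans ax xy; have xb := le_trans xy yb.
have x0 : 0 < x := lt_le_trans a0 ax.
have -> : V y - V x = \int[mu]_(t in `[x, y]) `|e1 t|.
  rewrite /V (@Rintegral_cat _ a x y)//; first ring.
  exact: integrable_segS ne1i.
have e1xy := integrable_segS ax yb e1i.
have ne1xy := integrable_segS ax yb ne1i.
set W := \int[mu]_(t in `[x, y]) `|e1 t|.
have e1Gxy := integrable_segS ax yb e1Gi.
have egxy := integrable_segS ax yb egi.
have gxy : integrable_on `[x, y] g by exact: cont_hl_integrable.
have -> : F y - F x = \int[mu]_(t in `[x, y]) (e1 t * (G y - G t) + (e x - e t) * g t).
  rewrite /F (@Rintegral_cat _ a x y)//; last exact: integrable_segS ii.
  transitivity (\int[mu]_(t in `[x, y]) ((G y * e1 t + e x * g t) - (e1 t * G t + e t * g t))).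
    rewrite RintegralB//; [|by apply: integrable_onD => //; exact: integrable_onZ
      |by apply: integrable_onD].
    rewrite [X in _ = X - _]RintegralD//; [|exact: integrable_onZ..].
    by rewrite !RintegralZl// (ace x y x0 xy).2 (FTC_hl x0 xy cg dG); ring.
  by apply: eq_Rintegral => t _; ring.
have t_ t : `[x, y]%classic t -> [/\ 0 < t, a <= t <= b, x <= t & t <= y].
  rewrite /= in_itv/= => /andP[xt ty]; split => //; first exact: lt_le_trans xt.
  by rewrite (le_trans ax xt) (le_trans ty yb).
have B1 t : `[x, y]%classic t -> `|G y - G t| <= K * (y - x).
  move=> /t_[t0 tab xt ty].
  rewrite -(FTC_hl t0 ty cg dG).
  have gty : integrable_on `[t, y] g by exact: cont_hl_integrable.
  apply: le_trans (le_normr_Rintegral _ gty) _ => //.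
  apply: (@le_trans _ _ (\int[mu]_(s in `[t, y]) K)).
    apply: le_Rintegral => //; [exact: integrable_on_norm|exact: integrable_seg_cst|].
    move=> s; rewrite /= in_itv/= => /andP[ts sy]; apply: gK.
    by rewrite (le_trans _ ts) ?(le_trans sy)//; case/andP: tab.
  by rewrite Rintegral_seg_cst// ler_wpM2l// lerD2l lerN2.
have B2 t : `[x, y]%classic t -> `|e x - e t| <= W.
  move=> /t_[t0 tab xt ty].
  rewrite distrC -(ace _ _ x0 xt).2.
  have e1xt : integrable_on `[x, t] e1 by exact: integrable_segS e1xy.
  apply: le_trans (le_normr_Rintegral _ e1xt) _ => //.
  apply: le_Rintegral_sub => //.
  by apply: subset_itv; rewrite bnd_simp.
have cs1 : integrable_on `[x, y] (fun t => e1 t * (G y - G t)).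
  have := integrable_onB (measurable_itv _) (integrable_onZ (G y) (measurable_itv _) e1xy) e1Gxy.
  by apply: eq_integrable_on => // t _; ring.
have cs2 : integrable_on `[x, y] (fun t => (e x - e t) * g t).
  have := integrable_onB (measurable_itv _) (integrable_onZ (e x) (measurable_itv _) gxy) egxy.
  by apply: eq_integrable_on => // t _; ring.
rewrite RintegralD// (le_trans (ler_normD _ _))//.
have -> : 2 * K * (y - x) * W = K * (y - x) * W + W * K * (y - x) by ring.
apply: lerD.
  apply: le_trans (le_normr_Rintegral _ cs1) _ => //.
  rewrite -RintegralZl//; apply: le_Rintegral => //.
  - exact: integrable_on_norm.
  - exact: integrable_onZ.
  - by move=> t txy; rewrite normrM mulrC ler_wpM2r// B1.
apply: le_trans (le_normr_Rintegral _ cs2) _ => //.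
rewrite -Rintegral_seg_cst//; apply: le_Rintegral => //.
- exact: integrable_on_norm.
- exact: integrable_seg_cst.
- move=> t txy; rewrite normrM ler_pM// ?B2// gK//.
  by have [_ + _ _] := t_ _ txy.
Qed.

End absolutely_continuous.

(** * The weight x^a e^{-bx} *)

Section derivatives.
Context {R : realType}.
Implicit Types (f g : R -> R) (x : R).

Lemma is_derive_mul f g x df dg : is_derive x 1 f df -> is_derive x 1 g dg ->
  is_derive x 1 (fun y => f y * g y) (df * g x + f x * dg).
Proof.
move=> hf hg; have := is_deriveM hf hg.
by rewrite /GRing.scale/= addrC (mulrC _ df).
Qed.

Lemma is_derive_congr f g x df dg : is_derive x 1 f df -> f =1 g -> df = dg ->
  is_derive x 1 g dg.
Proof. by move=> + /funext <- <-. Qed.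

Lemma is_derive_expl c x : is_derive x 1 (fun y => expR (c * y)) (c * expR (c * x)).
Proof.
have h : is_derive x 1 (fun y => c * y) c.
  have := is_deriveZ c (is_derive_id x (1 : R)).
  by rewrite /GRing.scale/= mulr1.
by rewrite mulrC; exact: (is_derive1_comp (is_derive_expR (c * x)) h).
Qed.

Lemma is_derive_cont f x d : is_derive x 1 f d -> {for x, continuous f}.
Proof.
by move=> [df _]; apply: differentiable_continuous; apply/derivable1_diffP.
Qed.

End derivatives.

Section laguerre_weight.
Context {R : realType}.
Notation mu := (@lebesgue_measure R).
Variable b : R.
Hypothesis b0 : 0 < b.

Definition wt (a x : R) : R := x `^ a * expR (- (b * x)).

Lemma wt_ge0 a x : 0 <= wt a x.
Proof. by rewrite mulr_ge0 ?powR_ge0 ?expR_ge0. Qed.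

Lemma wt_gt0 a x : 0 < x -> 0 < wt a x.
Proof. by move=> x0; rewrite mulr_gt0 ?powR_gt0 ?expR_gt0. Qed.

Lemma wtD a n x : 0 < x -> wt (a + n%:R) x = x ^+ n * wt a x.
Proof.
by move=> x0; rewrite /wt (@powRD R x a) ?(gt_eqF x0) ?implybT// powR_mulrn ?(ltW x0)//; ring.
Qed.

Lemma wtS a x : 0 < x -> wt (a + 1) x = x * wt a x.
Proof. by move=> x0; rewrite (wtD a 1). Qed.

Lemma is_derive_wt a (x : R) : 0 < x ->
  is_derive x 1 (wt (a + 1)) ((a + 1 - b * x) * wt a x).
Proof.
move=> x0; apply: is_derive_congr (is_derive_mul (is_derive1_powR (a + 1) x0)
  (is_derive_expl (- b) x)) _ _.
- by move=> y; rewrite /wt mulNr.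
- by rewrite /wt addrK mulNr (@powRD R x a) ?(gt_eqF x0) ?implybT// powRr1 ?(ltW x0)//; ring.
Qed.

Lemma continuous_affine (c d x : R) : {for x, continuous (fun t => c - d * t)}.
Proof.
apply: continuousB; first exact: cst_continuous.
by apply: continuousM; [exact: cst_continuous|exact: id].
Qed.

Lemma cont_hl_wt a : cont_hl (wt a).
Proof.
move=> x x0; have := is_derive_wt (a - 1) x0; rewrite subrK.
exact: is_derive_cont.
Qed.

Lemma cont_hl_sqr_wt (f : R -> R) a : cont_hl f -> cont_hl (fun x => f x ^+ 2 * wt a x).
Proof.
move=> cf x x0; apply: continuousM; last exact: cont_hl_wt.
by apply: continuousM; exact: cf.
Qed.

Lemma integral_sqr_wt_ge0 (D : set R) (f : R -> R) a :
  0 <= \int[mu]_(x in D) (f x ^+ 2 * wt a x).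
Proof. by apply: Rintegral_ge0 => x _; rewrite mulr_ge0 ?sqr_ge0 ?wt_ge0. Qed.

Lemma measurable_wt a (D : set R) : measurable_fun D (wt a).
Proof.
apply: measurable_funTS; apply: measurable_funM; first exact: measurable_powR.
by apply: measurableT_comp => //; exact: measurableT_comp.
Qed.

(** For large t the derivative (a - b t) t^(a-1) e^{-bt} of the weight is at
    most - (b / 2) times the weight: integrate this inequality. *)
Lemma segment_wt_tail a : exists2 X, 1 <= X & forall x y, X <= x -> x <= y ->
  \int[mu]_(t in `[x, y]) wt a t <= 2 / b * wt a x.
Proof.
exists (1 + 2 * `|a| / b); first by rewrite lerDl divr_ge0 ?mulr_ge0 ?(ltW b0).
move=> x y Xx xy.
have x0 : 0 < x.
  by apply: lt_le_trans Xx; rewrite ltr_pwDl// divr_ge0 ?mulr_ge0 ?(ltW b0).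
have dwt (t : R) : 0 < t -> is_derive t 1 (wt a) ((a - b * t) * wt (a - 1) t).
  by move=> t0; have := is_derive_wt (a - 1) t0; rewrite subrK.
have cd : cont_hl (fun t => (a - b * t) * wt (a - 1) t).
  move=> t t0; apply: continuousM; last exact: cont_hl_wt.
  exact: continuous_affine.
have := FTC_hl x0 xy cd dwt.
set I := Rintegral _ _ _ => IE.
have : I <= - (b / 2) * \int[mu]_(t in `[x, y]) wt a t.
  rewrite -RintegralZl//; last exact: cont_hl_integrable (@cont_hl_wt a).
  apply: le_Rintegral => //.
  - exact: cont_hl_integrable.
  - by apply: integrable_onZ => //; exact: cont_hl_integrable (@cont_hl_wt a).
  move=> t; rewrite /= in_itv/= => /andP[xt ty].
  have t0 : 0 < t := lt_le_trans x0 xt.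
  have -> : wt a t = t * wt (a - 1) t by rewrite -{1}(subrK 1 a) wtS.
  rewrite mulrA ler_wpM2r ?wt_ge0//.
  have : 2 * `|a| / b <= t by lra.
  rewrite ler_pdivrMr//; have := ler_norm a; nra.
have := wt_ge0 a y; have := wt_ge0 a x.
rewrite IE => wx wy le.
have -> : 2 / b * wt a x = wt a x / (b / 2) by field; rewrite gt_eqF.
rewrite ler_pdivlMr ?divr_gt0//; lra.
Qed.

(** For small t the derivative of t^(a+1) e^{-bt} is at least (a + 1) / 2
    times the weight: integrate this inequality. *)
Lemma segment_wt_head a : -1 < a -> exists2 d, 0 < d <= 1 & forall x y, 0 < x -> x <= y ->
  y <= d -> \int[mu]_(t in `[x, y]) wt a t <= 2 / (a + 1) * wt (a + 1) y.
Proof.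
move=> a1; have {}a1 : 0 < a + 1 by lra.
exists (Num.min 1 ((a + 1) / (2 * b))).
  by rewrite lt_min ge_min lexx andbT ltr01 divr_gt0 ?mulr_gt0.
move=> x y x0 xy; rewrite le_min => /andP[_]; rewrite ler_pdivlMr ?mulr_gt0// => yd.
have cd : cont_hl (fun t => (a + 1 - b * t) * wt a t).
  move=> t t0; apply: continuousM; last exact: cont_hl_wt.
  exact: continuous_affine.
have := FTC_hl x0 xy cd (@is_derive_wt a).
set I := Rintegral _ _ _ => IE.
have : (a + 1) / 2 * \int[mu]_(t in `[x, y]) wt a t <= I.
  rewrite -RintegralZl//; last exact: cont_hl_integrable (@cont_hl_wt a).
  apply: le_Rintegral => //.
  - by apply: integrable_onZ => //; exact: cont_hl_integrable (@cont_hl_wt a).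
  - exact: cont_hl_integrable.
  move=> t; rewrite /= in_itv/= => /andP[xt ty].
  have t0 : 0 < t := lt_le_trans x0 xt.
  rewrite ler_wpM2r ?wt_ge0//; nra.
have := wt_ge0 (a + 1) x; rewrite IE => wx le.
have -> : 2 / (a + 1) * wt (a + 1) y = wt (a + 1) y / ((a + 1) / 2) by field; rewrite gt_eqF.
rewrite ler_pdivlMr ?divr_gt0//; lra.
Qed.

Lemma integrable_wt a : -1 < a -> integrable_on half_line (wt a).
Proof.
move=> a1; have [X X1 tail] := segment_wt_tail a.
have [d /andP[d0 d1] head] := segment_wt_head a1.
have dX : d <= X := le_trans d1 X1.
have X0 : 0 < X := lt_le_trans d0 dX.
pose M := 2 / (a + 1) * wt (a + 1) d + \int[mu]_(t in `[d, X]) wt a t + 2 / b * wt a X.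
have iw (x y : R) : 0 < x -> integrable_on `[x, y] (wt a).
  by move=> x0; exact: cont_hl_integrable (@cont_hl_wt a).
have [] // := integrable_trunc (f := wt a) (M := M) (exhausts_around ltr01).
- exact: measurable_wt.
- by move=> x _; exact: wt_ge0.
- by move=> n; apply: iw; rewrite divr_gt0.
move=> n; have a0 : 0 < 1 / n.+1%:R :> R by rewrite divr_gt0.
set x := Num.min (1 / n.+1%:R) d; set y := Num.max (1 + n%:R) X.
have x0 : 0 < x by rewrite lt_min a0 d0.
have xd : x <= d by rewrite ge_min lexx orbT.
have Xy : X <= y by rewrite le_max lexx orbT.
apply: (@le_trans _ _ (\int[mu]_(t in `[x, y]) wt a t)).
  apply: le_Rintegral_sub => //; last by move=> t _; exact: wt_ge0.
    by apply: subset_itv; rewrite bnd_simp ?ge_min ?le_max lexx.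
  exact: iw.
rewrite (@Rintegral_cat _ _ x d y)//; last by exact: iw.
  rewrite (@Rintegral_cat _ _ d X y)//; last by exact: iw.
  by rewrite /M -addrA lerD ?head// lerD2l; exact: tail.
exact: le_trans dX Xy.
Qed.

Lemma integrable_horner_wt a (p : {poly R}) : -1 < a ->
  integrable_on half_line (fun x => p.[x] * wt a x).
Proof.
elim/poly_ind: p a => [|p c IH] a a1.
  apply: eq_integrable_on (integrable_onZ 0 _ (integrable_wt a1)) => // x _.
  by rewrite horner0.
have a11 : -1 < a + 1 by lra.
apply: eq_integrable_on (integrable_onD _ (IH _ a11) (integrable_onZ c _ (integrable_wt a1))) => // x.
by move=> /set_mem; rewrite half_lineE => x0 /=; rewrite hornerMXaddC wtS//; ring.
Qed.

End laguerre_weight.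

(** * Functions orthogonal to polynomials *)

Section orthogonality.
Context {R : realType}.
Notation mu := (@lebesgue_measure R).
Variable b : R.
Hypothesis b0 : 0 < b.
Notation wt := (wt b).

Lemma primitive_poly (q : {poly R}) :
  exists Q : {poly R}, [/\ Q^`() = q, Q.[0] = 0 & (size Q <= (size q).+1)%N].
Proof.
exists (\poly_(i < (size q).+1) (q`_i.-1 / i%:R)); split.
- apply/polyP => i; rewrite coef_deriv coef_poly ltnS.
  case: ltnP => [iq|/leq_sizeP/(_ i (leqnn i)) ->]; last by rewrite mul0rn.
  by rewrite -[LHS]mulr_natr /= divfK// pnatr_eq0.
- by rewrite horner_coef0 coef_poly/= invr0 mulr0.
- exact: size_poly.
Qed.

(** The hypothesis that the induction of the Poincare inequality carries: a
    function with the required integrability that is orthogonal, for the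
    weight of exponent al, to the polynomials of degree less than n. For al =
    -1 the constants are left out: the weight is not integrable, and the
    Laguerre polynomials of positive degree all vanish at 0. *)
Definition wt_orthogonal (al : R) n (e : R -> R) := [/\ measurable_fun half_line e,
  integrable_on half_line (fun x => e x ^+ 2 * wt al x),
  integrable_on half_line (fun x => e x * wt al x) &
  forall q : {poly R}, (size q <= n)%N -> (al = -1 -> q.[0] = 0) ->
    \int[mu]_(x in half_line) (e x * q.[x] * wt al x) = 0].

Lemma measurable_horner (q : {poly R}) (D : set R) : measurable_fun D (horner q).
Proof.
apply: measurable_funTS; apply: continuous_measurable_fun; exact: continuous_horner.
Qed.

Lemma wt_cauchy_schwarz (al : R) (D : set R) (f g : R -> R) : measurable D ->
  measurable_fun D f -> measurable_fun D g ->
  integrable_on D (fun x => f x ^+ 2 * wt al x) -> integrable_on D (fun x => g x ^+ 2 * wt al x) ->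
  integrable_on D (fun x => f x * g x * wt al x) /\
  (\int[mu]_(x in D) (f x * g x * wt al x)) ^+ 2 <=
  (\int[mu]_(x in D) (f x ^+ 2 * wt al x)) * (\int[mu]_(x in D) (g x ^+ 2 * wt al x)).
Proof.
move=> mD mf mg fi gi; apply: weighted_cauchy_schwarz => //.
- exact: measurable_wt.
- by move=> x _; exact: wt_ge0.
Qed.

Lemma integrable_of_sqr (al : R) (f : R -> R) : -1 < al -> measurable_fun half_line f ->
  integrable_on half_line (fun x => f x ^+ 2 * wt al x) ->
  integrable_on half_line (fun x => f x * wt al x).
Proof.
move=> al1 mf if2.
have i1 : integrable_on half_line (fun x => 1 ^+ 2 * wt al x).
  by apply: eq_integrable_on (integrable_wt b0 al1) => // x _; rewrite expr1n mul1r.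
have m1 : measurable_fun (@half_line R) (fun=> 1 : R) by exact: measurable_cst.
have [i _] := wt_cauchy_schwarz measurable_half_line mf m1 if2 i1.
by apply: eq_integrable_on i => // x _; rewrite mulr1.
Qed.

Lemma integrable_sqr_horner (al : R) (q : {poly R}) : -1 < al ->
  integrable_on half_line (fun x => q.[x] ^+ 2 * wt al x).
Proof.
move=> al1; have := integrable_horner_wt b0 (q ^+ 2) al1.
by apply: eq_integrable_on => // x _; rewrite horner_exp.
Qed.

Lemma integrable_sqr_horner0 (al : R) (q : {poly R}) : -2 < al -> q.[0] = 0 ->
  integrable_on half_line (fun x => q.[x] ^+ 2 * wt al x).
Proof.
move=> al2 q0.
have /factor_theorem[r ->] : root q 0 by apply/eqP.
have al1 : -1 < al + 2%:R by lra.
have := integrable_sqr_horner r al1.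
apply: eq_integrable_on => // x /set_mem; rewrite half_lineE => x0 /=.
by rewrite wtD// subr0 hornerMX; ring.
Qed.

(** When al <= -1 the constant term of q must be treated apart: q - q(0) is
    square integrable for the weight, hence the Cauchy-Schwarz inequality
    applies to it, while e itself is assumed integrable for the weight. *)
Lemma wt_orthogonal_int al n e (q : {poly R}) : -2 < al -> wt_orthogonal al n e ->
  integrable_on half_line (fun x => e x * q.[x] * wt al x).
Proof.
move=> al2 [me e2 e1 _].
have q0 : (q - q.[0]%:P).[0] = 0 by rewrite !hornerE subrr.
have [i1 _] := wt_cauchy_schwarz measurable_half_line me (@measurable_horner _ _) e2 (integrable_sqr_horner0 al2 q0).
have := integrable_onD _ i1 (integrable_onZ q.[0] _ e1).
move=> /(_ measurable_half_line measurable_half_line); apply: eq_integrable_on => // x _.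
by rewrite hornerD hornerN hornerC; ring.
Qed.

Lemma integral_wt_tail al : exists2 X, 1 <= X & forall x, X <= x ->
  integrable_on `]x, +oo[ (wt al) /\ \int[mu]_(t in `]x, +oo[) wt al t <= 2 / b * wt al x.
Proof.
have [X X1 H] := segment_wt_tail b0 al; exists X => // x Xx.
have x0 : 0 < x by lra.
have sub : `]x, +oo[ `<=` @half_line R.
  by move=> t; rewrite /= in_itv/= andbT half_lineE; exact: lt_trans.
have ex := exhausts_around x0.
have itw (s t : R) : 0 < s -> integrable_on `[s, t] (wt al).
  by move=> s0; exact: cont_hl_integrable (@cont_hl_wt R b al).
have [] := @integrable_trunc _ _ _ (wt al \_ `]x, +oo[) (2 / b * wt al x) ex.
- by apply/measurable_restrict => //; exact: measurable_wt.
- by move=> t _; rewrite patchE; case: ifPn => // _; exact: wt_ge0.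
- move=> n; have e0 : 0 < x / n.+1%:R by rewrite divr_gt0.
  apply: integrable_on_le (itw _ (x + n%:R) e0) => //.
    by apply/measurable_restrict => //; exact: measurable_wt.
  move=> t _; rewrite patchE; case: ifPn => _; last by rewrite normr0 wt_ge0.
  by rewrite ger0_norm ?wt_ge0.
- move=> n; rewrite -Rintegral_mkcondr.
  have -> : `[x / n.+1%:R, x + n%:R] `&` `]x, +oo[ = `]x, x + n%:R]%classic.
    apply/seteqP; split => t; rewrite /= !in_itv/= andbT.
      by move=> [/andP[_ ->] ->].
    move=> /andP[xt ->]; rewrite xt andbT; split => //.
    by apply: le_trans (ltW xt); rewrite ler_pdivrMr// ler_peMr ?ler1n// ltW.
  rewrite Rintegral_itv_obnd_cbnd; last first.
    by apply: integrable_onS (itw x (x + n%:R) x0) => //; apply: subset_itv; rewrite bnd_simp.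
  by apply: H => //; rewrite lerDl.
move=> i1; rewrite -Rintegral_sub// => le; split => //.
have := integrable_onS measurable_half_line (measurable_itv _) sub i1.
by apply: eq_integrable_on => // t tx; rewrite patchE tx.
Qed.

Lemma integral_wt_head al : -1 < al -> exists2 d, 0 < d <= 1 & forall x, 0 < x -> x <= d ->
  \int[mu]_(t in `]0, x]) wt al t <= 2 / (al + 1) * wt (al + 1) x.
Proof.
move=> al1; have [d d01 H] := segment_wt_head b0 al1; exists d => // x x0 xd.
have sub : `]0, x] `<=` @half_line R.
  by move=> t; rewrite /= in_itv/= half_lineE => /andP[].
have ex := exhausts_around x0.
have iw := integrable_wt b0 al1.
have [] := @integrable_trunc _ _ _ (wt al \_ `]0, x]) (2 / (al + 1) * wt (al + 1) x) ex.
- by apply/measurable_restrict => //; exact: measurable_wt.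
- by move=> t _; rewrite patchE; case: ifPn => // _; exact: wt_ge0.
- move=> n; have e0 : 0 < x / n.+1%:R by rewrite divr_gt0.
  apply: integrable_on_le (integrable_onS _ _ (@segment_half_line _ _ _ e0) iw) => //.
    by apply/measurable_restrict => //; exact: measurable_wt.
  move=> t _; rewrite patchE; case: ifPn => _; last by rewrite normr0 wt_ge0.
  by rewrite ger0_norm ?wt_ge0.
- move=> n; rewrite -Rintegral_mkcondr.
  have e0 : 0 < x / n.+1%:R by rewrite divr_gt0.
  have ex' : x / n.+1%:R <= x by rewrite ler_pdivrMr// ler_peMr ?ler1n// ltW.
  have -> : `[x / n.+1%:R, x + n%:R] `&` `]0, x] = `[x / n.+1%:R, x]%classic.
    apply/seteqP; split => t; rewrite /= !in_itv/=.
      by move=> [/andP[-> _] /andP[_ ->]].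
    move=> /andP[xt tx]; rewrite xt tx (lt_le_trans e0 xt)/=; split => //.
    by apply: le_trans tx _; rewrite lerDl.
  exact: H.
by move=> _; rewrite -Rintegral_sub.
Qed.

End orthogonality.

(** * The ladder: dividing the tail integral by the weight *)

Section ladder_definition.
Context {R : realType}.
Notation mu := (@lebesgue_measure R).
Variable b : R.
Hypothesis b0 : 0 < b.
Notation wt := (wt b).
Variables (al : R) (e : R -> R).
Hypothesis ce : cont_hl e.
Hypothesis ie : integrable_on half_line (fun x => e x * wt al x).
Hypothesis ie2 : integrable_on half_line (fun x => e x ^+ 2 * wt al x).

Let w := wt al.
Let w1 := wt (al + 1).
Let me_ : measurable_fun half_line e := cont_hl_measurable ce.

Definition tail_int (x : R) : R := \int[mu]_(t in `]x, +oo[) (e t * wt al t).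
Notation G := tail_int.

Lemma sub_tail (x : R) : 0 < x -> `]x, +oo[ `<=` @half_line R.
Proof. by move=> x0 t; rewrite /= in_itv/= andbT half_lineE; exact: lt_trans. Qed.

Lemma sub_head (x : R) : `]0, x] `<=` @half_line R.
Proof. by move=> t; rewrite /= in_itv/= half_lineE => /andP[]. Qed.

Lemma tail_intE (x : R) : 0 < x ->
  G x = \int[mu]_(t in half_line) (e t * wt al t) - \int[mu]_(t in `]0, x]) (e t * wt al t).
Proof.
move=> x0; have := @Rintegral_itvB R _ (BRight 0) (BInfty R false) x ie.
by rewrite /tail_int !bnd_simp => /(_ (ltW x0) isT) <-.
Qed.

Lemma is_derive_tail (x : R) : 0 < x -> is_derive x 1 G (- (e x * wt al x)).
Proof.
move=> x0.
pose F (y : R) := \int[mu]_(t in `]0, y]) (e t * wt al t).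
have cew : {for x, continuous (fun t => e t * wt al t)}.
  by apply: continuousM; [exact: ce|exact: cont_hl_wt].
have x1 : x < x + 1 by rewrite ltrDl.
have iu := integrable_onS measurable_half_line (measurable_itv `]0, (x + 1)]) (@sub_head _) ie.
have [//|dF F'] := @continuous_FTC1 R _ (BRight 0) x (x + 1) x1 iu _ cew.
have hF : is_derive x 1 F (e x * wt al x).
  by split; [exact: dF|rewrite -derive1E].
have := is_deriveB (is_derive_cst (\int[mu]_(t in half_line) (e t * wt al t)) x 1) hF.
rewrite sub0r; apply: near_eq_is_derive.
near=> y; rewrite tail_intE//.
by near: y; exact: lt_nbhsr.
Unshelve. all: by end_near. Qed.

(** The Cauchy-Schwarz inequality for e and 1 on ]x, +oo[. *)
Lemma tail_sqr_bound (x : R) : 0 < x -> integrable_on `]x, +oo[ w ->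
  \int[mu]_(t in `]x, +oo[) w t <= 2 / b * w x ->
  G x ^+ 2 <= (\int[mu]_(t in `]x, +oo[) (e t ^+ 2 * w t)) * (2 / b * w x).
Proof.
move=> x0 iw bw.
have mt : measurable (`]x, +oo[ : set R) by exact: measurable_itv.
have [] := @wt_cauchy_schwarz R b al `]x, +oo[ e (fun=> 1) mt.
- exact: measurable_funS (sub_tail x0) me_.
- exact: measurable_cst.
- exact: integrable_onS (sub_tail x0) ie2.
- by apply: eq_integrable_on iw => // t _; rewrite expr1n mul1r.
move=> _; under eq_Rintegral do rewrite mulr1.
under [X in _ <= _ * X]eq_Rintegral do rewrite expr1n mul1r.
move=> h; apply: le_trans h _; rewrite ler_wpM2l//.
exact: integral_sqr_wt_ge0.
Qed.

(** As the whole integral vanishes, the tail integral is the opposite of the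
    integral over ]0, x], to which the Cauchy-Schwarz inequality for e and 1
    applies. *)
Lemma head_sqr_bound (x : R) : 0 < x -> -1 < al ->
  \int[mu]_(t in half_line) (e t * wt al t) = 0 ->
  \int[mu]_(t in `]0, x]) w t <= 2 / (al + 1) * w1 x ->
  G x ^+ 2 <= (\int[mu]_(t in `]0, x]) (e t ^+ 2 * w t)) * (2 / (al + 1) * w1 x).
Proof.
move=> x0 al1 I0 bw.
have mt : measurable (`]0, x] : set R) by exact: measurable_itv.
have [] := @wt_cauchy_schwarz R b al `]0, x] e (fun=> 1) mt.
- exact: measurable_funS (@sub_head _) me_.
- exact: measurable_cst.
- exact: integrable_onS (@sub_head _) ie2.
- apply: eq_integrable_on (integrable_onS _ _ (@sub_head _) (integrable_wt b0 al1)) => // t _.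
  by rewrite expr1n mul1r.
move=> _; under eq_Rintegral do rewrite mulr1.
under [X in _ <= _ * X]eq_Rintegral do rewrite expr1n mul1r.
rewrite tail_intE// I0 sub0r sqrrN.
move=> h; apply: le_trans h _; rewrite ler_wpM2l//.
exact: integral_sqr_wt_ge0.
Qed.

(** For b = 1 and n > 0 it maps L_n^al to its derivative divided by n: like
    the derivation, it lowers the degree by 1 and raises the index by 1. *)
Definition ladder (x : R) : R := G x / wt (al + 1) x.
(** The derivative of [ladder], as read from the equation x h' + (al + 1 - b
    x) h = - e. *)
Definition ladder' (x : R) : R := - (e x + (al + 1 - b * x) * ladder x) / x.

Lemma is_derive_ladder (x : R) : 0 < x -> is_derive x 1 ladder (ladder' x).
Proof.
move=> x0.
have wn0 : wt (al + 1) x != 0 by rewrite gt_eqF ?wt_gt0.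
have wn : wt al x != 0 by rewrite gt_eqF ?wt_gt0.
have := is_derive_mul (is_derive_tail x0) (is_deriveV wn0 (is_derive_wt b al x0)).
move=> h; apply: (is_derive_congr h); first by [].
rewrite /ladder' /ladder /GRing.scale/= wtS//; field.
by rewrite gt_eqF.
Qed.

Lemma cont_ladder : cont_hl ladder.
Proof. by move=> x x0; exact: is_derive_cont (is_derive_ladder x0). Qed.

Lemma cont_ladder' : cont_hl ladder'.
Proof.
move=> x x0; apply: continuousM; last first.
  by apply: continuousV; [rewrite gt_eqF|exact: id].
apply: continuousN; apply: continuousD; first exact: ce.
apply: continuousM; last exact: cont_ladder.
exact: continuous_affine.
Qed.

Definition ladder_boundary (x : R) : R := (al + 1 - b * x) * ladder x ^+ 2 * wt (al + 1) x.

(** Square e = - (x h' + (al + 1 - b x) h): the double product is the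
    derivative of the boundary function, up to terms in h^2 that add up to b
    h^2 w_{al+1}. *)
Lemma ladder_identity (s t : R) : 0 < s -> s <= t ->
  \int[mu]_(x in `[s, t]) (e x ^+ 2 * wt al x) =
  \int[mu]_(x in `[s, t]) (ladder' x ^+ 2 * wt (al + 2) x) +
  b * \int[mu]_(x in `[s, t]) (ladder x ^+ 2 * wt (al + 1) x) + (ladder_boundary t - ladder_boundary s).
Proof.
move=> s0 st.
pose f x := 2 * ladder x * ladder' x * (al + 1 - b * x) * wt (al + 1) x
  + ladder x ^+ 2 * ((al + 1 - b * x) ^+ 2 - b * x) * wt al x.
have cl : cont_hl (fun x => al + 1 - b * x).
  by move=> x x0; exact: continuous_affine.
have cf : cont_hl f.
  move=> x x0; apply: continuousD; (apply: continuousM; last exact: cont_hl_wt).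
    apply: continuousM; last exact: cl.
    apply: continuousM; last exact: cont_ladder'.
    by apply: continuousM; [exact: cst_continuous|exact: cont_ladder].
  apply: continuousM; first by apply: continuousM; exact: cont_ladder.
  apply: continuousB; first by apply: continuousM; exact: cl.
  by apply: continuousM; [exact: cst_continuous|exact: id].
have df (x : R) : 0 < x -> is_derive x 1 ladder_boundary (f x).
  move=> x0.
  have dl : is_derive x 1 (fun y => al + 1 - b * y) (- b).
    have := is_derive_poly ((al + 1)%:P - b *: 'X) x.
    move=> h; apply: (is_derive_congr h) => [y|]; first by rewrite !hornerE.
    by rewrite derivB derivC derivZ derivX !hornerE.
  have dh := is_derive_ladder x0.
  apply: is_derive_congr (is_derive_mul (is_derive_mul dl (is_derive_mul dh dh)) (is_derive_wt b al x0)) _ _.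
    by move=> y; rewrite /ladder_boundary expr2; ring.
  by rewrite /f wtS//; ring.
rewrite -(FTC_hl s0 st cf df).
have ci g : cont_hl g -> integrable_on `[s, t] g by move=> cg; exact: cont_hl_integrable.
have c1 := @cont_hl_sqr_wt R b _ (al + 2) cont_ladder'.
have c2 := @cont_hl_sqr_wt R b _ (al + 1) cont_ladder.
rewrite -RintegralZl//; last exact: ci.
rewrite -RintegralD//; [|exact: ci|by apply: integrable_onZ => //; exact: ci].
rewrite -RintegralD//; [|by apply: integrable_onD => //; [exact: ci|apply: integrable_onZ => //; exact: ci]|exact: ci].
apply: eq_Rintegral => x; rewrite inE/= in_itv/= => /andP[sx _].
have x0 : 0 < x := lt_le_trans s0 sx.
have -> : e x = - (x * ladder' x + (al + 1 - b * x) * ladder x).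
  by rewrite /ladder'; field; rewrite gt_eqF.
rewrite /f (wtD b al 2)// wtS//; ring.
Qed.

End ladder_definition.

(** * The energy identity of the ladder *)

Section ladder_step.
Context {R : realType}.
Notation mu := (@lebesgue_measure R).
Variable b : R.
Hypothesis b0 : 0 < b.
Notation wt := (wt b).
Variables (al : R) (e e1 : R -> R) (n : nat).
Hypothesis ace : ac_hl e e1.
Hypothesis ne : wt_orthogonal b al n.+1 e.

Let ce : cont_hl e := ac_hl_cont ace.
Let ie : integrable_on half_line (fun x => e x * wt al x).
Proof. by case: ne. Qed.
Let ie2 : integrable_on half_line (fun x => e x ^+ 2 * wt al x).
Proof. by case: ne. Qed.
Notation G := (tail_int b al e).
Notation h := (ladder b al e).
Notation h1 := (ladder' b al e).
Notation bd := (ladder_boundary b al e).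
Let A := \int[mu]_(x in half_line) (e x ^+ 2 * wt al x).
Let A0 : 0 <= A.
Proof. exact: integral_sqr_wt_ge0. Qed.
Let T x := \int[mu]_(t in `]x, +oo[) (e t ^+ 2 * wt al t).
Let Hd x := \int[mu]_(t in `]0, x]) (e t ^+ 2 * wt al t).

Let T_ge0 x : 0 <= T x.
Proof. exact: integral_sqr_wt_ge0. Qed.
Let Hd_ge0 x : 0 <= Hd x.
Proof. exact: integral_sqr_wt_ge0. Qed.

Let T_le x : 0 < x -> T x <= A.
Proof.
move=> x0; apply: le_Rintegral_sub => //; first exact: sub_tail.
by move=> t _; rewrite mulr_ge0 ?sqr_ge0 ?wt_ge0.
Qed.

Let Hd_le x : Hd x <= A.
Proof.
apply: le_Rintegral_sub => //; first exact: sub_head.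
by move=> t _; rewrite mulr_ge0 ?sqr_ge0 ?wt_ge0.
Qed.

Let bdE x : 0 < x -> bd x = (al + 1 - b * x) * G x ^+ 2 / wt (al + 1) x.
Proof.
by move=> x0; rewrite /ladder_boundary /ladder; field; rewrite gt_eqF ?wt_gt0.
Qed.

(** The second bound makes the boundary term at +oo vanish in the limit, as
    the remaining integral of e^2 does. The first one serves for the products
    of the tail integral with square integrable functions. *)
Lemma ladder_tail_bounds : exists2 X, 1 <= X & forall x, X <= x ->
  G x ^+ 2 <= A * (2 / b) * wt al x /\ `|bd x| <= (`|al + 1| + b) * (2 / b) * T x.
Proof.
have [X X1 XP] := integral_wt_tail b0 al; exists X => // x Xx.
have x1 : 1 <= x := le_trans X1 Xx.
have x0 : 0 < x by lra.
have [iw bw] := XP x Xx.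
have GT := tail_sqr_bound ce ie2 x0 iw bw.
have b2 : 0 <= 2 / b by rewrite divr_ge0 ?(ltW b0).
split.
  apply: le_trans GT _; rewrite -[leRHS]mulrA ler_wpM2r ?T_le// mulr_ge0 ?wt_ge0//.
have w1 := wt_gt0 b (al + 1) x0.
have w0 := wt_gt0 b al x0.
rewrite bdE// normrM normrM [`|_^-1|]ger0_norm ?invr_ge0 ?wt_ge0//.
rewrite [`|_ ^+ 2|]ger0_norm ?sqr_ge0// ler_pdivrMr// wtS//.
have -> : (`|al + 1| + b) * (2 / b) * T x * (x * wt al x) =
  (`|al + 1| + b) * x * (T x * (2 / b * wt al x)) by ring.
apply: ler_pM => //; first exact: sqr_ge0.
apply: le_trans (ler_normB _ _) _; rewrite mulrDl [`|b * x|]ger0_norm ?mulr_ge0 ?(ltW b0) ?(ltW x0)//.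
by rewrite lerD2r ler_peMr.
Qed.

(** If al > -1, orthogonality to the constants gives G x = - int_0^x e w,
    which is small near 0. If al <= -1, then al + 1 - b x <= 0 and the
    boundary term has the favourable sign; moreover G is bounded, and w_{al+1}
    is at least e^{-b} on ]0, 1]. *)
Lemma ladder_head_bounds : exists2 d, 0 < d <= 1 & exists C, forall x, 0 < x -> x <= d ->
  G x ^+ 2 <= C * wt (al + 1) x /\ bd x <= 2 * Hd x.
Proof.
have [al1|al1] := ltP (-1) al.
  have [d d01 dP] := integral_wt_head b0 al1; exists d => //.
  exists (A * (2 / (al + 1))) => x x0 xd.
  have a10 : 0 < al + 1 by lra.
  have I0 : \int[mu]_(t in half_line) (e t * wt al t) = 0.
    have [_ _ _ /(_ 1)] := ne; rewrite size_poly1 => /(_ isT) H.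
    rewrite -[RHS]H; last by move=> E; move: al1; rewrite E ltxx.
    by apply: eq_Rintegral => x' _; rewrite hornerC mulr1.
  have GH := head_sqr_bound b0 ce ie ie2 x0 al1 I0 (dP _ x0 xd).
  have w1 := wt_gt0 b (al + 1) x0.
  split.
    by apply: le_trans GH _; rewrite -[leRHS]mulrA ler_wpM2r ?Hd_le// mulr_ge0 ?(ltW w1)// divr_ge0 ?ltW.
  rewrite bdE// ler_pdivrMr//.
  apply: (@le_trans _ _ ((al + 1) * G x ^+ 2)).
    rewrite ler_wpM2r ?sqr_ge0// gerDl oppr_le0 mulr_ge0 ?ltW//.
  rewrite mulrC -ler_pdivlMr//; apply: le_trans GH _.
  by rewrite le_eqVlt; apply/orP; left; apply/eqP; rewrite /Hd; field; rewrite gt_eqF.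
exists 1; first by rewrite ltr01 lexx.
pose L := \int[mu]_(t in half_line) `|e t * wt al t|.
exists (L ^+ 2 * expR b) => x x0 x1.
have w1 := wt_gt0 b (al + 1) x0.
split.
  have GL : `|G x| <= L.
    apply: le_trans (le_normr_Rintegral _ (integrable_onS _ _ (sub_tail x0) ie)) _ => //.
    apply: le_Rintegral_sub => //; first exact: sub_tail.
    exact: integrable_on_norm.
  have w1ge : expR (- b) <= wt (al + 1) x.
    rewrite /wt -[leLHS]mul1r ler_pM ?expR_ge0//.
      by rewrite -[leLHS](powRr0 x); apply: ger_powR; rewrite ?x0 ?x1//; lra.
    by rewrite ler_expR lerN2 -[leRHS]mulr1 ler_wpM2l ?(ltW b0).
  rewrite -[leLHS]mulr1 -[leRHS]mulrA; apply: ler_pM => //; first exact: sqr_ge0.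
    rewrite -(real_normK (num_real (G x))); apply: lerXn2r => //.
    by rewrite nnegrE; exact: (le_trans (normr_ge0 _) GL).
  by rewrite -[leLHS](expRxMexpNx_1 b) ler_wpM2l ?expR_ge0.
apply: (@le_trans _ _ 0); last by rewrite mulr_ge0.
rewrite bdE// -mulrA mulr_le0_ge0//; last by rewrite divr_ge0 ?sqr_ge0 ?ltW.
have : 0 <= b * x by rewrite mulr_ge0 ?ltW.
lra.
Qed.

(** Integrate [ladder_identity] over exhausting segments and discard the
    boundary terms. The inequality only takes a one-sided bound on the
    boundary term at 0. *)
Lemma ladder_energy : [/\ integrable_on half_line (fun x => h1 x ^+ 2 * wt (al + 2) x),
  integrable_on half_line (fun x => h x ^+ 2 * wt (al + 1) x) &
  \int[mu]_(x in half_line) (h1 x ^+ 2 * wt (al + 2) x) +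
  b * \int[mu]_(x in half_line) (h x ^+ 2 * wt (al + 1) x) <= A].
Proof.
have [X X1 tl] := ladder_tail_bounds.
have [d /andP[d0 d1] [C hd]] := ladder_head_bounds.
have dX : d <= X := le_trans d1 X1.
have F0 x : 0 < x -> 0 <= e x ^+ 2 * wt al x by move=> _; rewrite mulr_ge0 ?sqr_ge0 ?wt_ge0.
have [a_ [b_ [exh _ _ ad bX]]] := vanish_seq d0 dX F0 ie2.
have [apos ab a0 boo] := exh.
pose f x := h1 x ^+ 2 * wt (al + 2) x + b * (h x ^+ 2 * wt (al + 1) x).
have c1 := @cont_hl_sqr_wt R b _ (al + 2) (cont_ladder' ce ie).
have c2 := @cont_hl_sqr_wt R b _ (al + 1) (cont_ladder ce ie).
have c2b : cont_hl (fun x => b * (h x ^+ 2 * wt (al + 1) x)).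
  by move=> x x0; apply: continuousM; [exact: cst_continuous|exact: c2].
have cf : cont_hl f by move=> x x0; apply: continuousD; [exact: c1|exact: c2b].
have p1 x : 0 <= h1 x ^+ 2 * wt (al + 2) x by rewrite mulr_ge0 ?sqr_ge0 ?wt_ge0.
have p2 x : 0 <= b * (h x ^+ 2 * wt (al + 1) x).
  by rewrite mulr_ge0 ?(ltW b0)// mulr_ge0 ?sqr_ge0 ?wt_ge0.
pose K := (`|al + 1| + b) * (2 / b).
have K0 : 0 <= K by rewrite mulr_ge0 ?addr_ge0 ?divr_ge0 ?(ltW b0).
have step k : \int[mu]_(x in `[a_ k, b_ k]) f x <=
    \int[mu]_(x in `[a_ k, b_ k]) (e x ^+ 2 * wt al x) + (K * T (b_ k) + 2 * Hd (a_ k)).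
  rewrite RintegralD//; [|exact: cont_hl_integrable c1|exact: cont_hl_integrable c2b].
  rewrite RintegralZl//; last exact: cont_hl_integrable c2.
  rewrite (ladder_identity ce ie (apos k) (ab k)).
  have [_ t1] := tl _ (bX k); have [_ t2] := hd _ (apos k) (ad k).
  have := ler_norm (- bd (b_ k)); rewrite normrN => t3.
  rewrite /K; lra.
have fi : integrable_on half_line f.
  have [] // := @integrable_trunc _ a_ b_ f (A + (K * A + 2 * A)) exh.
  - exact: cont_hl_measurable.
  - by move=> x x0; rewrite addr_ge0.
  - by move=> k; exact: cont_hl_integrable.
  move=> k; apply: le_trans (step k) _; apply: lerD.
    apply: le_Rintegral_sub => //; first exact: segment_half_line.
    by move=> x; rewrite half_lineE; exact: F0.
  apply: lerD; last by rewrite ler_wpM2l.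
  by rewrite ler_wpM2l// T_le// (lt_le_trans (apos k)).
have i1 : integrable_on half_line (fun x => h1 x ^+ 2 * wt (al + 2) x).
  apply: integrable_on_le fi => //; first exact: cont_hl_measurable.
  by move=> x _; rewrite ger0_norm// lerDl.
have i2 : integrable_on half_line (fun x => h x ^+ 2 * wt (al + 1) x).
  have := integrable_onZ b^-1 measurable_half_line fi; apply: integrable_on_le => //.
    exact: cont_hl_measurable.
  move=> x _ /=; rewrite ger0_norm; last by rewrite mulr_ge0 ?sqr_ge0 ?wt_ge0.
  by rewrite ler_pdivlMl// lerDr.
split => //.
rewrite -RintegralZl// -RintegralD//; last exact: integrable_onZ.
have v1 : (fun k => T (b_ k)) @ \oo --> (0 : R).
  apply: cvg_vanish => //.
  - by move=> k; apply: sub_tail; apply: lt_le_trans (ab k).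
  - move=> x x0; near=> k; rewrite /= in_itv/= andbT; apply/negP; rewrite -leNgt.
    have /andP[_ /ltW//] : a_ k < x < b_ k by near: k; exact: exhausts_near exh x0.
have v2 : (fun k => Hd (a_ k)) @ \oo --> (0 : R).
  apply: cvg_vanish => //.
  - by move=> k; exact: sub_head.
  - move=> x x0; near=> k; rewrite /= in_itv/= x0/=; apply/negP; rewrite -ltNge.
    have /andP[//] : a_ k < x < b_ k by near: k; exact: exhausts_near exh x0.
have v3 : (fun k => \int[mu]_(x in `[a_ k, b_ k]) (e x ^+ 2 * wt al x) +
    (K * T (b_ k) + 2 * Hd (a_ k))) @ \oo --> A + (0 + 0).
  apply: cvgD; first exact: cvg_trunc.
  by apply: cvgD; exact: cvg_mul0.
rewrite !addr0 in v3.
have H : \int[mu]_(x in half_line) f x <= A.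
  refine (ler_cvg_to (cvg_trunc exh fi) v3 _).
  by apply: nearW => k; exact: step.
exact: H.
Unshelve. all: by end_near. Qed.

End ladder_step.

(** * Descending the ladder *)

Section ladder_descent.
Context {R : realType}.
Notation mu := (@lebesgue_measure R).
Variable b : R.
Hypothesis b0 : 0 < b.
Notation wt := (wt b).

Lemma cvg_sqr0 (u v : nat -> R) : (forall n, u n ^+ 2 <= v n) ->
  v @ \oo --> (0 : R) -> u @ \oo --> (0 : R).
Proof.
move=> uv v0; apply/cvgr0Pnorm_lt => eps e0.
have e20 : 0 < eps ^+ 2 by rewrite exprn_gt0.
near=> n.
have : v n < eps ^+ 2 by near: n; exact: (cvgr_lt _ v0).
move=> vn; have := le_lt_trans (uv n) vn.
rewrite -(real_normK (num_real (u n))) => h.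
rewrite ltNge; apply/negP => le; move: h; apply/negP; rewrite -leNgt.
by apply: lerXn2r => //; rewrite nnegrE ltW.
Unshelve. all: by end_near. Qed.

Lemma eq_sub_cvg0 (u v r : nat -> R) (l1 l2 : R) : (forall n, u n - v n = r n) ->
  u @ \oo --> l1 -> v @ \oo --> l2 -> r @ \oo --> (0 : R) -> l1 = l2.
Proof.
move=> uv u1 v2 r0; apply/eqP; rewrite -subr_eq0; apply/eqP.
have c : r @ \oo --> l1 - l2 by rewrite -(funext uv : _ = r); exact: cvgB.
exact: (cvg_unique _ c r0).
Qed.

Variables (al : R) (e e1 : R -> R) (n : nat).
Hypothesis al2 : -2 < al.
Hypothesis ace : ac_hl e e1.
Hypothesis ne : wt_orthogonal b al n.+1 e.
Hypothesis me1 : measurable_fun half_line e1.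
Hypothesis ie1 : integrable_on half_line (fun x => e1 x ^+ 2 * wt (al + 1) x).

Let ce : cont_hl e := ac_hl_cont ace.
Let ie : integrable_on half_line (fun x => e x * wt al x).
Proof. by case: ne. Qed.
Let ie2 : integrable_on half_line (fun x => e x ^+ 2 * wt al x).
Proof. by case: ne. Qed.
Notation G := (tail_int b al e).
Notation h := (ladder b al e).
Notation h1 := (ladder' b al e).
Let A := \int[mu]_(x in half_line) (e x ^+ 2 * wt al x).

Let ih2 : integrable_on half_line (fun x => h x ^+ 2 * wt (al + 1) x).
Proof. by have [] := ladder_energy b0 ace ne. Qed.

Let hw1 x : 0 < x -> h x * wt (al + 1) x = G x.
Proof. by move=> x0; rewrite /ladder divfK// gt_eqF ?wt_gt0. Qed.

Lemma ac_ladder : ac_hl h h1.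
Proof.
move=> s t s0 st; split; first exact: cont_hl_integrable (cont_ladder' ce ie).
by apply: FTC_hl => //; [exact: cont_ladder'|exact: is_derive_ladder].
Qed.

(** If Q is the primitive of q that vanishes at 0, then (G Q)' = G q - e Q
    w_al with G = h w_{al+1}: testing h against q amounts to testing e against
    Q. *)
Lemma ladder_orthogonal : wt_orthogonal b (al + 1) n h.
Proof.
have al1 : -1 < al + 1 by move: al2; lra.
have mh : measurable_fun half_line h by apply: cont_hl_measurable; exact: cont_ladder.
split; [exact: mh|exact: ih2|exact: integrable_of_sqr|].
move=> q qn _.
have [Q [Qq Q0 Qs]] := primitive_poly q.
have orth : \int[mu]_(x in half_line) (e x * Q.[x] * wt al x) = 0.
  by case: ne => _ _ _; apply=> //; exact: leq_trans Qs _.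
have iQ := integrable_sqr_horner0 b0 al2 Q0.
have [X X1 tl] := ladder_tail_bounds b0 ace ne.
have X0 : 0 < X by lra.
have [a_ [b_ [exh _ Fb a1 bX]]] := vanish_seq ltr01 X1
  (fun x _ => mulr_ge0 (sqr_ge0 Q.[x]) (wt_ge0 b al x)) iQ.
have [apos ab a0 boo] := exh.
have ieQ := wt_orthogonal_int b0 Q al2 ne.
have ihq : integrable_on half_line (fun x => h x * q.[x] * wt (al + 1) x).
  have [] // := @wt_cauchy_schwarz R b (al + 1) half_line h (horner q) measurable_half_line mh.
  - exact: measurable_horner.
  - exact: integrable_sqr_horner.
rewrite -orth.
apply: (@eq_sub_cvg0 _ _ (fun k => G (b_ k) * Q.[b_ k] - G (a_ k) * Q.[a_ k])
  _ _ _ (cvg_trunc exh ihq) (cvg_trunc exh ieQ)).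
  move=> k.
  have cq : cont_hl (horner q) by move=> x _; exact: continuous_horner.
  have cQ : cont_hl (horner Q) by move=> x _; exact: continuous_horner.
  have cG : cont_hl G by move=> x x0; exact: is_derive_cont (is_derive_tail ce ie x0).
  have c1 : cont_hl (fun x => G x * q.[x]).
    by move=> x x0; apply: continuousM; [exact: cG|exact: cq].
  have c2 : cont_hl (fun x => e x * Q.[x] * wt al x).
    by move=> x x0; apply: continuousM; [apply: continuousM; [exact: ce|exact: cQ]|exact: cont_hl_wt].
  have c12 : cont_hl (fun x => G x * q.[x] - e x * Q.[x] * wt al x).
    by move=> x x0; apply: continuousB; [exact: c1|exact: c2].
  have dGQ (x : R) : 0 < x -> is_derive x 1 (fun x => G x * Q.[x]) (G x * q.[x] - e x * Q.[x] * wt al x).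
    move=> x0; apply: is_derive_congr (is_derive_mul (is_derive_tail ce ie x0) (is_derive_poly Q x)) _ _ => //.
    by rewrite Qq; ring.
  rewrite -(FTC_hl (apos k) (ab k) c12 dGQ) RintegralB//; [|exact: cont_hl_integrable..].
  congr (_ - _); apply: eq_Rintegral => x; rewrite inE/= in_itv/= => /andP[ax _].
  by rewrite -hw1 ?(lt_le_trans (apos k) ax)//; ring.
have v1 : (fun k => G (b_ k) * Q.[b_ k]) @ \oo --> (0 : R).
  apply: cvg_sqr0 (cvg_mul0 (A * (2 / b)) Fb) => k.
  have [t1 _] := tl _ (bX k).
  by rewrite exprMn [leRHS]mulrCA mulrC ler_wpM2l ?sqr_ge0.
have v2 : (fun k => G (a_ k) * Q.[a_ k]) @ \oo --> (0 : R).
  pose L := \int[mu]_(t in half_line) `|e t * wt al t|.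
  have Qa : (fun k => `|Q.[a_ k]|) @ \oo --> (0 : R).
    have cQ0 : horner Q @ (0 : R) --> Q.[0] by exact: continuous_horner.
    by apply/norm_cvg0P; rewrite -Q0; exact: cvg_comp a0 cQ0.
  apply: cvg0_le (cvg_mul0 L Qa) => k; rewrite normrM ler_wpM2r//.
  apply: le_trans (le_normr_Rintegral _ (integrable_onS _ _ (sub_tail (apos k)) ie)) _ => //.
  apply: le_Rintegral_sub => //; first exact: sub_tail.
  exact: integrable_on_norm.
by rewrite -[X in _ --> X](subr0 0); exact: cvgB.
Qed.

(** Integrate e' G by parts, where G = h w_{al+1} has derivative - e w_al;
    this gives int e' h w_{al+1} = int e^2 w_al. Then apply the Cauchy-Schwarz
    inequality. *)
Lemma ladder_duality : A ^+ 2 <=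
  \int[mu]_(x in half_line) (e1 x ^+ 2 * wt (al + 1) x) *
  \int[mu]_(x in half_line) (h x ^+ 2 * wt (al + 1) x).
Proof.
have mh : measurable_fun half_line h by apply: cont_hl_measurable; exact: cont_ladder.
have [i le] := wt_cauchy_schwarz measurable_half_line me1 mh ie1 ih2.
apply: le_trans le; rewrite le_eqVlt; apply/orP; left; apply/eqP; congr (_ ^+ 2).
have [X X1 tl] := ladder_tail_bounds b0 ace ne.
have [d /andP[d0 d1] [C hd]] := ladder_head_bounds b0 ace ne.
have dX : d <= X := le_trans d1 X1.
have [a_ [b_ [exh Fa Fb ad bX]]] := vanish_seq d0 dX
  (fun x _ => mulr_ge0 (sqr_ge0 (e x)) (wt_ge0 b al x)) ie2.
have [apos ab a0 boo] := exh.
apply: (@eq_sub_cvg0 _ _ (fun k => e (a_ k) * G (a_ k) - e (b_ k) * G (b_ k))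
  _ _ _ (cvg_trunc exh ie2) (cvg_trunc exh i)).
  move=> k.
  have cew : cont_hl (fun x => - (e x * wt al x)).
    by move=> x x0; apply: continuousN; apply: continuousM; [exact: ce|exact: cont_hl_wt].
  have [_] := ac_integration_by_parts (apos k) (ab k) ace cew (fun x => @is_derive_tail _ _ _ _ ce ie x).
  have -> : \int[mu]_(x in `[a_ k, b_ k]) (e1 x * G x) =
      \int[mu]_(x in `[a_ k, b_ k]) (e1 x * h x * wt (al + 1) x).
    apply: eq_Rintegral => x; rewrite inE/= in_itv/= => /andP[ax _].
    by rewrite -hw1 ?(lt_le_trans (apos k) ax)//; ring.
  have -> : \int[mu]_(x in `[a_ k, b_ k]) (e x * - (e x * wt al x)) =
      - \int[mu]_(x in `[a_ k, b_ k]) (e x ^+ 2 * wt al x).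
    rewrite -mulN1r -RintegralZl//; last first.
      by apply: integrable_onS ie2 => //; exact: segment_half_line.
    by apply: eq_Rintegral => x _; ring.
  move=> ->; ring.
have v1 : (fun k => e (b_ k) * G (b_ k)) @ \oo --> (0 : R).
  apply: cvg_sqr0 (cvg_mul0 (A * (2 / b)) Fb) => k.
  have [t1 _] := tl _ (bX k).
  by rewrite exprMn [leRHS]mulrCA ler_wpM2l ?sqr_ge0.
have v2 : (fun k => e (a_ k) * G (a_ k)) @ \oo --> (0 : R).
  apply: cvg_sqr0 (cvg_mul0 C Fa) => k.
  have [t1 _] := hd _ (apos k) (ad k).
  have -> : C * (a_ k * (e (a_ k) ^+ 2 * wt al (a_ k))) = e (a_ k) ^+ 2 * (C * wt (al + 1) (a_ k)).
    by rewrite wtS//; ring.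
  by rewrite exprMn ler_wpM2l ?sqr_ge0.
by rewrite -[X in _ --> X](subr0 0); exact: cvgB.
Qed.

(** The derivative of q w_{al+1} is P w_al with P = x q' + (al + 1 - b x) q,
    one degree higher than q: testing e' against q amounts to testing - e
    against P. For al = -1, P vanishes at 0. *)
Lemma derivative_orthogonal : wt_orthogonal b (al + 1) n e1.
Proof.
have al1 : -1 < al + 1 by move: al2; lra.
split; [exact: me1|exact: ie1|exact: integrable_of_sqr|].
move=> q qn _.
pose P : {poly R} := q^`() * 'X + (al + 1) *: q - b *: (q * 'X).
have PE x : P.[x] = x * q^`().[x] + (al + 1 - b * x) * q.[x] by rewrite /P hornerD hornerN hornerD !hornerZ !hornerMX; ring.
have Ps : (size P <= n.+1)%N.
  apply/leq_sizeP => -[//|j] nj.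
  have qj i : (n <= i)%N -> q`_i = 0 by move=> ni; apply: nth_default; exact: leq_trans ni.
  rewrite /P !coefE/= (qj j nj) (qj j.+1 (leqW nj)) !(mul0rn, mulr0, addr0, subr0). by case: ifP.
have orth : \int[mu]_(x in half_line) (e x * P.[x] * wt al x) = 0.
  case: ne => _ _ _; apply=> // alE.
  by rewrite PE alE; ring.
have ieP := wt_orthogonal_int b0 P al2 ne.
have ieq := wt_orthogonal_int b0 q al2 ne.
have ieqX := wt_orthogonal_int b0 (q * 'X) al2 ne.
have ie1q : integrable_on half_line (fun x => e1 x * q.[x] * wt (al + 1) x).
  have [] // := @wt_cauchy_schwarz R b (al + 1) half_line e1 (horner q) measurable_half_line me1.
  - exact: measurable_horner.
  - exact: integrable_sqr_horner.
(* The boundary term e q w_{al+1} is x times the first summand near 0, and is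
   the second one near +oo. *)
pose F x := `|e x * q.[x] * wt al x| + `|e x * (q * 'X).[x] * wt al x|.
have iF : integrable_on half_line F.
  by apply: integrable_onD => //; exact: integrable_on_norm.
have [a_ [b_ [exh Fa Fb ad bX]]] := vanish_seq ltr01 (lexx 1) (fun x _ => addr_ge0 (normr_ge0 _) (normr_ge0 _) : 0 <= F x) iF.
have [apos ab a0 boo] := exh.
have mI : integrable_on half_line (fun x => - 1 * (e x * P.[x] * wt al x)) by exact: integrable_onZ.
have -> : 0 = \int[mu]_(x in half_line) (- 1 * (e x * P.[x] * wt al x)).
  by rewrite RintegralZl// orth mulr0.
pose W x := e x * (q.[x] * wt (al + 1) x).
apply: (@eq_sub_cvg0 _ _ (fun k => W (b_ k) - W (a_ k)) _ _ _ (cvg_trunc exh ie1q) (cvg_trunc exh mI)).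
  move=> k.
  have cg : cont_hl (fun x => P.[x] * wt al x).
    by move=> x x0; apply: continuousM; [exact: continuous_horner|exact: cont_hl_wt].
  have dg (x : R) : 0 < x -> is_derive x 1 (fun x => q.[x] * wt (al + 1) x) (P.[x] * wt al x).
    move=> x0; apply: is_derive_congr (is_derive_mul (is_derive_poly q x) (is_derive_wt b al x0)) _ _ => //.
    by rewrite PE wtS//; ring.
  have [_] := ac_integration_by_parts (apos k) (ab k) ace cg dg.
  rewrite RintegralZl; last 2 first.
  - exact: measurable_itv.
  - by apply: integrable_onS ieP => //; exact: segment_half_line.
  under eq_Rintegral do rewrite mulrA.
  under [X in _ - X]eq_Rintegral do rewrite mulrA.
  move=> ->; rewrite /W; ring.
have v1 : (fun k => W (b_ k)) @ \oo --> (0 : R).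
  apply: cvg0_le Fb => k; rewrite /F /W hornerMX wtS; last exact: lt_le_trans (apos k) (ab k).
  by rewrite [X in `|X|](_ : _ = e (b_ k) * (q.[b_ k] * b_ k) * wt al (b_ k)) ?lerDr//; ring.
have v2 : (fun k => W (a_ k)) @ \oo --> (0 : R).
  apply: cvg0_le Fa => k; rewrite /F /W wtS//.
  rewrite [X in `|X| <= _](_ : _ = a_ k * (e (a_ k) * q.[a_ k] * wt al (a_ k))); last by ring.
  rewrite normrM [`|a_ k|]ger0_norm; last exact: ltW.
  by rewrite ler_wpM2l ?lerDl// ltW.
by rewrite -[X in _ --> X](subr0 0); exact: cvgB.
Qed.

End ladder_descent.

(** * The weighted Poincare inequality and its iteration *)

Section spectral.
Context {R : realType}.
Notation mu := (@lebesgue_measure R).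

Lemma ae_imp (P Q : R -> Prop) : (forall x, P x -> Q x) ->
  {ae mu, forall x, P x} -> {ae mu, forall x, Q x}.
Proof. by move=> PQ; apply: filterS => //; exact: (ae_filter_ringOfSetsType mu). Qed.

Definition ae_hl (f g : R -> R) := {ae mu, forall x, half_line x -> f x = g x}.

Lemma ae_hl_Rintegral (f g : R -> R) : measurable_fun half_line f ->
  measurable_fun half_line g -> ae_hl f g ->
  \int[mu]_(x in half_line) f x = \int[mu]_(x in half_line) g x.
Proof.
move=> mf mg fg; rewrite /Rintegral; congr fine; apply: ae_eq_integral => //.
- exact/measurable_EFinP.
- exact/measurable_EFinP.
- by apply: ae_imp fg => x h /h ->.
Qed.

Lemma ae_hl_integrable (f g : R -> R) : measurable_fun half_line f ->
  measurable_fun half_line g -> ae_hl f g ->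
  integrable_on half_line f -> integrable_on half_line g.
Proof.
move=> mf mg fg fi; apply: integrable_onP => //.
rewrite -(@ae_eq_integral _ _ _ mu half_line _ (fun x => `|(f x)%:E|%E)) //.
- by case/integrableP: fi.
- by do 2 apply: measurableT_comp => //; exact/measurable_EFinP.
- by do 2 apply: measurableT_comp => //; exact/measurable_EFinP.
- by apply: ae_imp fg => x h /h ->.
Qed.

Variable b : R.
Hypothesis b0 : 0 < b.
Notation wt := (wt b).

(** With A = int e^2 w_al, B = int e'^2 w_{al+1} and H = int h^2 w_{al+1},
    where h is the ladder of e: the energy inequality and the induction
    hypothesis for h give n b H <= A, and duality gives A^2 <= B H. Hence n b
    A <= B. *)
Lemma poincare n (al : R) (e e1 : R -> R) : -2 < al -> ac_hl e e1 -> wt_orthogonal b al n e ->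
  measurable_fun half_line e1 ->
  integrable_on half_line (fun x => e1 x ^+ 2 * wt (al + 1) x) ->
  n%:R * b * \int[mu]_(x in half_line) (e x ^+ 2 * wt al x) <=
  \int[mu]_(x in half_line) (e1 x ^+ 2 * wt (al + 1) x).
Proof.
elim: n al e e1 => [|n IH] al e e1 al2 ace ne me1 ie1.
  rewrite !mul0r; apply: Rintegral_ge0 => x _.
  by rewrite mulr_ge0 ?sqr_ge0 ?wt_ge0.
have [i1 i2 energy] := ladder_energy b0 ace ne.
have dual := ladder_duality b0 ace ne me1 ie1.
have nl := ladder_orthogonal b0 al2 ace ne.
have ie : integrable_on half_line (fun x => e x * wt al x) by case: ne.
have ce := ac_hl_cont ace.
have := IH _ _ _ _ (ac_ladder ace ne) nl.
have -> : al + 1 + 1 = al + 2 by ring.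
have al12 : -2 < al + 1 by rewrite (lt_trans al2)// ltrDl.
move=> /(_ al12 (cont_hl_measurable (cont_ladder' ce ie)) i1) step.
set A := \int[mu]_(x in half_line) (e x ^+ 2 * wt al x) in energy dual *.
set B := \int[mu]_(x in half_line) (e1 x ^+ 2 * wt (al + 1) x) in dual *.
set H := \int[mu]_(x in half_line) (_ ^+ 2 * wt (al + 1) x) in energy dual step *.
have A0 : 0 <= A by exact: integral_sqr_wt_ge0.
have B0 : 0 <= B by exact: integral_sqr_wt_ge0.
have H0 : 0 <= H by exact: integral_sqr_wt_ge0.
have key : n.+1%:R * b * H <= A by rewrite -natr1; lra.
have [->|An0] := eqVneq A 0; first by rewrite mulr0.
have Ap : 0 < A by rewrite lt_neqAle eq_sym An0.
rewrite -(ler_pM2r Ap).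
have -> : n.+1%:R * b * A * A = n.+1%:R * b * A ^+ 2 by ring.
have c0 : 0 <= n.+1%:R * b by rewrite mulr_ge0 ?ltW.
apply: le_trans (ler_wpM2l c0 dual) _.
by rewrite mulrCA ler_wpM2l.
Qed.

Lemma wt_orthogonal_ae (al : R) n (e v : R -> R) : measurable_fun half_line v -> ae_hl e v ->
  -2 < al -> wt_orthogonal b al n e -> wt_orthogonal b al n v.
Proof.
move=> mv ev al2 ne; have [me ie2 ie orth] := ne.
have mw : measurable_fun half_line (wt al) by exact: measurable_wt.
split => //.
- apply: ae_hl_integrable ie2; [by apply: measurable_funM => //; exact: measurable_funX
    |by apply: measurable_funM => //; exact: measurable_funX|].
  by apply: ae_imp ev => x h /h ->.
- apply: ae_hl_integrable ie; [exact: measurable_funM|exact: measurable_funM|].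
  by apply: ae_imp ev => x h /h ->.
- move=> q qn q0; rewrite -[RHS](orth q qn q0); apply/esym/ae_hl_Rintegral.
  + by apply: measurable_funM => //; apply: measurable_funM => //; exact: measurable_horner.
  + by apply: measurable_funM => //; apply: measurable_funM => //; exact: measurable_horner.
  + by apply: ae_imp ev => x h /h ->.
Qed.

Lemma integrable_sqrB (al : R) (f g : R -> R) : measurable_fun half_line f ->
  measurable_fun half_line g ->
  integrable_on half_line (fun x => f x ^+ 2 * wt al x) ->
  integrable_on half_line (fun x => g x ^+ 2 * wt al x) ->
  integrable_on half_line (fun x => (f x - g x) ^+ 2 * wt al x).
Proof.
move=> mf mg if2 ig2.
have [ifg _] := wt_cauchy_schwarz measurable_half_line mf mg if2 ig2.
have := integrable_onD measurable_half_line (integrable_onB measurable_half_line if2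
  (integrable_onZ 2 measurable_half_line ifg)) ig2.
by apply: eq_integrable_on => // x _; ring.
Qed.

(** The functions g 1, ..., g m are the successive derivatives of g 0. An
    absolutely continuous representative is only required almost everywhere,
    since weak derivatives are only defined up to null sets. *)
Definition deriv_chain m (g : nat -> R -> R) := forall k, (k < m)%N ->
  exists2 V, ac_hl V (g k.+1) & ae_hl (g k) V.

Lemma spectral_chain (al : R) n m (g : nat -> R -> R) : -2 < al -> (m <= n)%N ->
  (forall k, (k <= m)%N -> measurable_fun half_line (g k)) ->
  (forall k, (k <= m)%N -> integrable_on half_line (fun x => g k x ^+ 2 * wt (al + k%:R) x)) ->
  deriv_chain m g -> wt_orthogonal b al n (g 0%N) ->
  wt_orthogonal b (al + m%:R) (n - m) (g m) /\
  \prod_(i < m) ((n - i)%:R * b) * \int[mu]_(x in half_line) (g 0%N x ^+ 2 * wt al x) <=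
  \int[mu]_(x in half_line) (g m x ^+ 2 * wt (al + m%:R) x).
Proof.
move=> al2; elim: m => [|m IH] mn mg ig dg n0.
  by rewrite addr0 subn0 big_ord0 mul1r.
have [|||nm le] := IH (ltnW mn) _ _ _ n0.
- by move=> k km; apply: mg; exact: leqW.
- by move=> k km; apply: ig; exact: leqW.
- by move=> k km; apply: dg; exact: leqW.
have [V acV gV] := dg m (ltnSn m).
have mV : measurable_fun half_line V by apply: cont_hl_measurable; exact: ac_hl_cont acV.
have alm : -2 < al + m%:R by rewrite (lt_le_trans al2)// lerDl.
have nV := wt_orthogonal_ae mV gV alm nm.
have E : (n - m = (n - m.+1).+1)%N by rewrite subnSK.
have mg1 := mg m.+1 (leqnn _).
have ig1 := ig m.+1 (leqnn _).
have Ea : al + m.+1%:R = al + m%:R + 1 by rewrite -natr1 addrA.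
rewrite Ea in ig1 *.
split; first by rewrite E in nV; exact: (derivative_orthogonal b0 alm acV nV mg1 ig1).
have p := poincare alm acV nV mg1 ig1.
apply: le_trans p.
have <- : \int[mu]_(x in half_line) (g m x ^+ 2 * wt (al + m%:R) x) =
    \int[mu]_(x in half_line) (V x ^+ 2 * wt (al + m%:R) x).
  have mw : measurable_fun half_line (wt (al + m%:R)) by exact: measurable_wt.
  apply: ae_hl_Rintegral.
  - by apply: measurable_funM => //; apply: measurable_funX; apply: mg.
  - by apply: measurable_funM => //; exact: measurable_funX.
  - by apply: ae_imp gV => x h /h ->.
have c0 : 0 <= (n - m)%:R * b by rewrite mulr_ge0// ltW.
by rewrite big_ord_recr/= mulrAC mulrC ler_wpM2l.
Qed.

(** The function g - p is orthogonal to p, so g is the sum of two orthogonal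
    functions. *)
Lemma projection_le (al : R) n (g : R -> R) (p : {poly R}) : -2 < al ->
  measurable_fun half_line g -> (size p <= n)%N -> (al <= -1 -> p.[0] = 0) ->
  integrable_on half_line (fun x => g x ^+ 2 * wt al x) ->
  wt_orthogonal b al n (fun x => g x - p.[x]) ->
  \int[mu]_(x in half_line) ((g x - p.[x]) ^+ 2 * wt al x) <=
  \int[mu]_(x in half_line) (g x ^+ 2 * wt al x).
Proof.
move=> al2 mg pn p0 ig ne; have [me ie2 ie orth] := ne.
have o := orth p pn (fun E => p0 (eq_ind_r (fun z => z <= -1) (lexx _) E)).
have iep := wt_orthogonal_int b0 p al2 ne.
have ip2 : integrable_on half_line (fun x => p.[x] ^+ 2 * wt al x).
  have [al1|al1] := ltP (-1) al; first exact: integrable_sqr_horner.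
  by apply: integrable_sqr_horner0 => //; exact: p0.
rewrite -[leLHS]addr0 -[X in _ + X](mulr0 2) -o -RintegralZl//.
rewrite -RintegralD//; last exact: integrable_onZ.
apply: le_Rintegral => //; first by apply: integrable_onD => //; exact: integrable_onZ.
move=> x _; have := wt_ge0 b al x; have := sqr_ge0 p.[x] => h1 h2.
have := mulr_ge0 h1 h2; lra.
Qed.

Lemma size_derivn_le (p : {poly R}) k n : (size p <= n)%N -> (size p^`(k) <= n - k)%N.
Proof.
move=> pn; apply/leq_sizeP => j nj; rewrite coef_derivn nth_default ?mul0rn//.
by apply: leq_trans pn _; rewrite -leq_subLR.
Qed.

(** Iterate the Poincare inequality on g - p. At step m the polynomial can be
    dropped from the right-hand side: the m-th derivative of g - p is
    orthogonal to the m-th derivative of p, which has degree less than n - m. *)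
Lemma laguerre_approximation (al : R) n m (g : nat -> R -> R) (p : {poly R}) :
  -2 < al -> (m <= n)%N ->
  (forall k, (k <= m)%N -> measurable_fun half_line (g k)) ->
  (forall k, (k <= m)%N -> integrable_on half_line (fun x => g k x ^+ 2 * wt (al + k%:R) x)) ->
  deriv_chain m g -> (size p <= n)%N -> (al <= -1 -> p.[0] = 0) ->
  wt_orthogonal b al n (fun x => g 0%N x - p.[x]) ->
  \prod_(i < m) ((n - i)%:R * b) *
    \int[mu]_(x in half_line) ((g 0%N x - p.[x]) ^+ 2 * wt al x) <=
  \int[mu]_(x in half_line) (g m x ^+ 2 * wt (al + m%:R) x).
Proof.
move=> al2 mn mg ig dg pn p0 ne.
pose e k x := g k x - (p^`(k)).[x].
have mp k : measurable_fun half_line (horner p^`(k)) by exact: measurable_horner.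
have me k : (k <= m)%N -> measurable_fun half_line (e k).
  by move=> km; apply: measurable_funB => //; exact: mg.
have p0k k : al + k%:R <= -1 -> (p^`(k)).[0] = 0.
  case: k => [|k]; first by rewrite addr0 derivn0.
  by rewrite -natr1 => h; have := ler0n R k; lra.
have ip2 k : integrable_on half_line (fun x => (p^`(k)).[x] ^+ 2 * wt (al + k%:R) x).
  have [al1|al1] := ltP (-1) (al + k%:R); first exact: integrable_sqr_horner.
  by apply: integrable_sqr_horner0 (p0k _ al1) => //; rewrite (lt_le_trans al2)// lerDl.
have ie k : (k <= m)%N -> integrable_on half_line (fun x => e k x ^+ 2 * wt (al + k%:R) x).
  by move=> km; apply: integrable_sqrB => //; [exact: mg|exact: ig].
have de : deriv_chain m e.
  move=> k km; have [V acV gV] := dg k km.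
  exists (fun x => V x - (p^`(k)).[x]); last by apply: ae_imp gV => x h hx; rewrite /e h.
  have cp : cont_hl (horner p^`(k.+1)) by move=> x _; exact: continuous_horner.
  move=> s t s0 st; have [i E] := acV s t s0 st.
  have ip : integrable_on `[s, t] (horner p^`(k.+1)) by exact: cont_hl_integrable.
  split; first exact: integrable_onB.
  rewrite RintegralB// E (@FTC_hl _ (horner p^`(k)) _ _ _ s0 st cp); ring.
have n0 : wt_orthogonal b al n (e 0%N) by rewrite (_ : e 0%N = fun x => g 0%N x - p.[x]) //; exact/funext.
have [nm le] := spectral_chain al2 mn me ie de n0.
have alm : -2 < al + m%:R by rewrite (lt_le_trans al2)// lerDl.
have pl := projection_le alm (mg _ (leqnn m)) (size_derivn_le m pn) (@p0k m) (ig _ (leqnn m)) nm.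
exact: le_trans le pl.
Qed.

End spectral.

(** Each factor satisfies n <= m (n - i), since i < m <= n. *)
Lemma prod_lower_bound (R : realType) n m : (m <= n)%N ->
  n%:R ^+ m <= m%:R ^+ m * \prod_(i < m) (n - i)%:R :> R.
Proof.
move=> mn.
have -> : m%:R ^+ m * \prod_(i < m) (n - i)%:R = \prod_(i < m) (m%:R * (n - i)%:R) :> R.
  by rewrite big_split/= prodr_const card_ord.
rewrite -[leLHS]/(n%:R ^+ m) -[X in _ ^+ X]card_ord -prodr_const.
apply: ler_prod => i _; rewrite ler0n/= -natrM ler_nat.
have := ltn_ord i; move: (nat_of_ord i) => {}i im.
have [k nE] : exists k, n = (i + 1 + k)%N.
  by exists (n - (i + 1))%N; rewrite subnKC// addn1 (leq_trans im).
have [l mE] : exists l, m = (i + 1 + l)%N by exists (m - (i + 1))%N; rewrite subnKC// addn1.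
have -> : (n - i = k + 1)%N by rewrite nE; lia.
by subst n m; nia.
Qed.

(** * A smooth bump function *)

Section smooth_bump.
Context {R : realType}.
Notation mu := (@lebesgue_measure R).
Implicit Types (f g : R -> R).

(** Differentiability of all orders is obtained from closure properties of
    this predicate, which unlike the iterated derivative is stable under sums
    and products by a direct induction. *)
Fixpoint times_differentiable k f : Prop := if k is k'.+1 then
  exists2 f' : R -> R, (forall x : R, is_derive x 1 f (f' x)) & times_differentiable k' f'
  else True.
Notation Ck := times_differentiable.

Lemma Ck_le k f : Ck k.+1 f -> Ck k f.
Proof.
elim: k f => [//|k IH] f [f' df f'k].
by exists f' => //; exact: IH.
Qed.

Lemma Ck_add k f g : Ck k f -> Ck k g -> Ck k (fun x => f x + g x).
Proof.
elim: k f g => [//|k IH] f g [f' df f'k] [g' dg g'k].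
by exists (fun x => f' x + g' x); [move=> x; exact: is_deriveD|exact: IH].
Qed.

Lemma Ck_mul k f g : Ck k f -> Ck k g -> Ck k (fun x => f x * g x).
Proof.
elim: k f g => [//|k IH] f g fk gk; have [f' df f'k] := fk; have [g' dg g'k] := gk.
exists (fun x => f' x * g x + f x * g' x); first by move=> x; exact: is_derive_mul.
by apply: Ck_add; apply: IH => //; exact: Ck_le.
Qed.

Lemma is_derive_affine f (c d x f' : R) : is_derive (c * x + d) 1 f f' ->
  is_derive x 1 (fun y => f (c * y + d)) (c * f').
Proof.
move=> df; have h : is_derive x 1 (fun y => c * y + d) c.
  have h := is_derive_poly (c *: 'X + d%:P) x.
  apply: (is_derive_congr h) => [y|]; first by rewrite !hornerE.
  by rewrite derivD derivC derivZ derivX !hornerE.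
by rewrite mulrC; exact: (@is_derive1_comp R f (fun y => c * y + d) x f' c df h).
Qed.

Lemma Ck_cst k (c : R) : Ck k (fun=> c).
Proof.
elim: k c => [//|k IH] c; exists (fun=> 0) => // x; exact: is_derive_cst.
Qed.

Lemma Ck_affine k f (c d : R) : Ck k f -> Ck k (fun x => f (c * x + d)).
Proof.
elim: k f => [//|k IH] f [f' df f'k].
exists (fun x => c * f' (c * x + d)); first by move=> x; exact: is_derive_affine.
by apply: Ck_mul; [exact: Ck_cst|exact: IH].
Qed.

Lemma Ck_derive1n f : (forall k, Ck k f) ->
  forall n (x : R), derivable (derive1n n f) x 1.
Proof.
move=> fk n; have : Ck n.+1 f by exact: fk.
elim: n f {fk} => [|n IH] f [f' df f'k] x; first by have [] := df x.
have -> : derive1n n.+1 f = derive1n n f'.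
  rewrite /derive1n iterSr; congr (iter n _ _); apply/funext => y.
  by rewrite derive1E; case: (df y).
exact: IH.
Qed.

Lemma horner_le_expR (p : {poly R}) : exists2 C, 0 <= C & forall y, 0 <= y ->
  `|p.[y]| <= C * expR y.
Proof.
have mon n y : 0 <= y -> y ^+ n <= n`!%:R * expR y :> R.
  move=> y0; case: n => [|n]; first by rewrite expr0 mul1r -expR0 ler_expR.
  rewrite mulrC -ler_pdivrMr ?ltr0n ?fact_gt0//.
  by apply: le_trans (expR_ge1Dxn n y0); rewrite lerDr.
exists (\sum_(i < size p) `|p`_i| * i`!%:R).
  by apply: sumr_ge0 => i _; rewrite mulr_ge0.
move=> y y0; rewrite horner_coef mulr_suml (le_trans (ler_norm_sum _ _ _))//.
apply: ler_sum => i _; rewrite normrM -mulrA ler_wpM2l//.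
by rewrite ger0_norm ?exprn_ge0// mon.
Qed.

(** The functions p(1/x) e^{-1/x}, extended by 0, form a family that is stable
    under derivation: the derivative replaces p by x^2 (p - p'). They are
    therefore all smooth, including at 0. *)
Definition flat (p : {poly R}) (x : R) : R :=
  if 0 < x then p.[x^-1] * expR (- x^-1) else 0.

(** Being O(x^2) at 0 is what makes the derivative at 0 vanish; it amounts to
    y^2 p(y) = O(e^y). *)
Lemma flat_small (p : {poly R}) : exists2 C, 0 <= C & forall x, `|flat p x| <= C * x ^+ 2.
Proof.
have [C C0 H] := horner_le_expR (p * 'X^2); exists C => // x; rewrite /flat.
case: ifPn => x0; last by rewrite normr0 mulr_ge0 ?sqr_ge0.
have xi : 0 < x^-1 by rewrite invr_gt0.
have := H _ (ltW xi); rewrite hornerM hornerXn normrM [X in _ * X]ger0_norm ?sqr_ge0// => le.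
rewrite normrM [X in _ * X]ger0_norm ?expR_ge0// expRN ler_pdivrMr ?expR_gt0//.
rewrite mulrAC -ler_pdivrMr ?exprn_gt0//.
by apply: le_trans le; rewrite exprVn.
Qed.

Lemma is_derive_small f (x C : R) : (forall h, `|f (x + h) - f x| <= C * h ^+ 2) ->
  is_derive x 1 f 0.
Proof.
move=> fC; have C0 : 0 <= C by have := fC 1; rewrite expr1n mulr1; exact: le_trans.
suff c : h^-1 *: (f (h *: 1 + x) - f x) @[h --> 0^'] --> (0 : R).
  by split; [apply: (cvgP _ c)|exact: (cvg_lim _ c)].
apply/cvgr0Pnorm_lt => eps e0; near=> h.
have h0 : h != 0 by near: h; exact: nbhs_dnbhs_neq.
have hn : 0 < `|h| by rewrite normr_gt0.
rewrite /GRing.scale/= mulr1 normrM normfV mulrC ltr_pdivrMr//.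
rewrite [h + x]addrC; apply: le_lt_trans (fC h) _.
rewrite -(real_normK (num_real h)) expr2 mulrA ltr_pM2r//.
have : `|h| < eps / (C + 1).
  near: h; apply: dnbhs0_lt; rewrite divr_gt0// ltr_wpDl//.
rewrite ltr_pdivlMr ?ltr_wpDl// => h1.
apply: le_lt_trans h1; rewrite mulrC ler_wpM2l// lerDl//.
Unshelve. all: by end_near. Qed.

Lemma is_derive_flat (p : {poly R}) (x : R) :
  is_derive x 1 (flat p) (flat ('X^2 * (p - p^`())) x).
Proof.
have [x0|x0|->] := ltgtP x 0.
- have -> : flat ('X^2 * (p - p^`())) x = 0 by rewrite /flat ltNge ltW.
  apply: near_eq_is_derive (is_derive_cst (0 : R) x 1); near=> y.
  by rewrite /flat ltNge ltW//; near: y; exact: lt_nbhsl.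
- have xn0 : x != 0 by rewrite gt_eqF.
  have di : is_derive x 1 (fun y : R => y^-1) (- x ^- 2).
    have := is_deriveV xn0 (is_derive_id x (1 : R)).
    by rewrite /GRing.scale/= mulr1.
  have dp := is_derive1_comp (is_derive_poly p x^-1) di.
  have de := is_derive1_comp (is_derive_expl (-1) x^-1) di.
  have h : is_derive x 1 (fun y => p.[y^-1] * expR (-1 * y^-1)) (flat ('X^2 * (p - p^`())) x).
    apply: is_derive_congr (is_derive_mul dp de) _ _ => //.
    rewrite /flat x0 /= mulN1r hornerM hornerXn hornerD hornerN exprVn.
    by field.
  apply: near_eq_is_derive h; near=> y; rewrite /flat ifT ?mulN1r//.
  by near: y; exact: lt_nbhsr.
- have -> : flat ('X^2 * (p - p^`())) 0 = 0 by rewrite /flat ltxx.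
  have [C C0 H] := flat_small p.
  apply: (@is_derive_small _ _ C) => h.
  by rewrite add0r {2}/flat ltxx subr0.
Unshelve. all: by end_near. Qed.

Lemma Ck_flat k p : Ck k (flat p).
Proof. by elim: k p => [//|k IH] p; exists (flat ('X^2 * (p - p^`()))); [exact: is_derive_flat|]. Qed.

(** A smooth function that is positive exactly on ]0, 1[; its total mass is
    not normalized. *)
Definition cbump (x : R) : R := flat 1 x * flat 1 (- 1 * x + 1).

Lemma Ck_bump k : Ck k cbump.
Proof. by apply: Ck_mul; [exact: Ck_flat|apply: Ck_affine; exact: Ck_flat]. Qed.

Lemma bump_ge0 x : 0 <= cbump x.
Proof.
by rewrite /cbump mulr_ge0// /flat; case: ifP => // _; rewrite hornerE mul1r expR_ge0.
Qed.

Lemma bump_gt0 x : 0 < x < 1 -> 0 < cbump x.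
Proof.
move=> /andP[x0 x1]; rewrite /cbump mulN1r /flat x0 ifT; last by rewrite addrC subr_gt0.
by apply: mulr_gt0; rewrite hornerE mul1r expR_gt0.
Qed.

Lemma bump_out x : ~~ (0 < x < 1) -> cbump x = 0.
Proof.
rewrite negb_and /cbump mulN1r /flat [- x + 1]addrC subr_gt0 => /orP[/negbTE ->|/negbTE ->].
  by rewrite mul0r.
by rewrite mulr0.
Qed.

Lemma continuous_bump : continuous cbump.
Proof.
by move=> x; have [f' df _] := Ck_bump 1; exact: is_derive_cont (df x).
Qed.

Lemma integrable_bump (D : set R) : measurable D -> integrable_on D cbump.
Proof.
move=> mD.
have i1 : integrable_on (`[0, 1]) cbump.
  apply: continuous_compact_integrable; first exact: segment_compact.
  by apply: continuous_subspaceT; exact: continuous_bump.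
have iT : integrable_on setT (cbump \_ `[0, 1]).
  rewrite /integrable_on -restrict_EFin; apply/integrable_restrict => //=.
  by rewrite setTI.
have E : cbump \_ `[0, 1] = cbump.
  apply/funext => x; rewrite patchE; case: ifPn => // /negP xn.
  rewrite bump_out//; apply/negP => /andP[x0 x1]; apply: xn.
  by rewrite inE/= in_itv/= !ltW.
by rewrite E in iT; exact: integrable_onS iT.
Qed.

Definition cstep (x : R) : R := \int[mu]_(t in `]-oo, x]) cbump t.
Definition bump_mass : R := cstep 1.

Lemma is_derive_step (x : R) : is_derive x 1 cstep (cbump x).
Proof.
have x1 : x < x + 1 by rewrite ltrDl.
have nx : (BInfty R true < BRight x)%E by rewrite ltNyr.
have [] := @continuous_FTC1 R cbump (BInfty R true) x (x + 1) x1
  (integrable_bump (measurable_itv _)) nx (@continuous_bump x).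
by move=> d e; split; [exact: d|rewrite -derive1E].
Qed.

Lemma Ck_step k : Ck k cstep.
Proof.
by case: k => [//|k]; exists cbump; [exact: is_derive_step|exact: Ck_bump].
Qed.

Lemma step_le0 x : x <= 0 -> cstep x = 0.
Proof.
move=> x0; rewrite /cstep (@eq_Rintegral _ _ _ mu _ (fun=> 0)).
  by rewrite Rintegral_cst// mul0r.
move=> t; rewrite inE/= in_itv/= => tx; apply: bump_out.
by rewrite negb_and -leNgt (le_trans tx).
Qed.

Lemma step_cat x y : x <= y -> cstep y = cstep x + \int[mu]_(t in `[x, y]) cbump t.
Proof.
move=> xy; have := @Rintegral_itvB R cbump (BInfty R true) (BRight y) x (integrable_bump (measurable_itv _)).
rewrite bnd_simp => /(_ isT xy); rewrite -/(cstep x) -/(cstep y).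
rewrite Rintegral_itv_obnd_cbnd; last exact: integrable_bump.
by move=> <-; rewrite addrC subrK.
Qed.

Lemma step_ge1 x : 1 <= x -> cstep x = bump_mass.
Proof.
move=> x1; rewrite (step_cat x1) (@eq_Rintegral _ _ _ mu _ (fun=> 0)).
  by rewrite Rintegral_cst// mul0r addr0.
move=> t; rewrite inE/= in_itv/= => /andP[t1 _]; apply: bump_out.
by rewrite negb_and -!leNgt t1 orbT.
Qed.

Lemma step_bound x : 0 <= cstep x <= bump_mass.
Proof.
have s0 y : 0 <= cstep y by apply: Rintegral_ge0 => t _; exact: bump_ge0.
rewrite s0/=; have [x1|x1] := leP x 1; last by rewrite step_ge1// ltW.
by rewrite /bump_mass (step_cat x1) lerDl; apply: Rintegral_ge0 => t _; exact: bump_ge0.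
Qed.

Lemma bump_mass_gt0 : 0 < bump_mass.
Proof.
have /andP[s0 _] := step_bound 1; rewrite lt_neqAle eq_sym s0 andbT.
apply/negP => /eqP s1.
have h : is_derive (2^-1 : R) 1 cstep (cbump 2^-1) by exact: is_derive_step.
have z : cstep = cst 0.
  apply/funext => x; have /andP[? ?] := step_bound x.
  by apply/le_anti/andP; split => //; rewrite -s1.
rewrite z in h; have [_ e] := h.
have := @bump_gt0 2^-1; rewrite -e derive_cst ltxx invr_gt0 ltr0n invf_lt1// ltr1n.
by move=> /(_ isT).
Qed.

Lemma bump_bounded : exists2 M, 0 <= M & forall x, cbump x <= M.
Proof.
have [c _ cP] := @EVT_max R cbump 0 1 ler01 (continuous_subspaceT continuous_bump).
exists (cbump c) => [|x]; first exact: bump_ge0.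
have [xi|xo] := boolP (0 < x < 1); last by rewrite bump_out// bump_ge0.
by apply: cP; rewrite in_itv/=; case/andP: xi => /ltW -> /ltW ->.
Qed.

End smooth_bump.

(** * Mollification at Lebesgue points *)

Section weak_derivative.
Context {R : realType}.
Notation mu := (@lebesgue_measure R).

Lemma locally_integrable_segment (v : R -> R) (c d : R) : 0 < c ->
  locally_integrable half_line v -> integrable_on `[c, d] v.
Proof.
move=> c0 [mv _ vi].
have sub := @segment_half_line R c d c0.
apply: integrable_onP => //; first exact: measurable_funS mv.
under eq_integral do rewrite abse_EFin.
by apply: vi => //; exact: segment_compact.
Qed.

(** A smooth approximation of [bump_mass] times the indicator function of ]a,
    b]. Its derivative is the difference of two bumps that concentrate at a
    and b, on the right-hand sides. *)
Definition cutoff (a b : R) (n : nat) (x : R) : R :=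
  cstep (n.+1%:R * (x - a)) - cstep (n.+1%:R * (x - b)).

Lemma is_derive_stepn (a : R) (n : nat) (x : R) :
  is_derive x 1 (fun y => cstep (n.+1%:R * (y - a))) (n.+1%:R * cbump (n.+1%:R * (x - a))).
Proof.
have := is_derive_affine (@is_derive_step R (n.+1%:R * x + - (n.+1%:R * a))).
rewrite -mulrBr => h; apply: (is_derive_congr h) => // y.
by rewrite -mulrBr.
Qed.

Lemma is_derive_cutoff (a b : R) (n : nat) (x : R) : is_derive x 1 (cutoff a b n)
  (n.+1%:R * cbump (n.+1%:R * (x - a)) - n.+1%:R * cbump (n.+1%:R * (x - b))).
Proof. by apply: is_deriveB; exact: is_derive_stepn. Qed.

Lemma test_function_cutoff (a b : R) n : 0 < a -> a < b -> test_function (cutoff a b n).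
Proof.
move=> a0 ab.
have n0 : 0 < n.+1%:R :> R by [].
split.
  apply: Ck_derive1n => k.
  have st (c : R) : times_differentiable k (fun x : R => cstep (n.+1%:R * (x - c))).
    have := @Ck_affine R k cstep n.+1%:R (- (n.+1%:R * c)) (@Ck_step R k).
    by under eq_fun do rewrite -mulrBr.
  have := Ck_add (st a) (Ck_mul (@Ck_cst R k (-1)) (st b)).
  by rewrite /cutoff; under eq_fun do rewrite mulN1r.
exists a, (b + n.+1%:R^-1); split => // x xab.
have [xa|ax] := ltP x a.
  have neg (c : R) : a <= c -> n.+1%:R * (x - c) <= 0.
    by move=> ac; rewrite pmulr_rle0// subr_le0 (le_trans (ltW xa)).
  by rewrite /cutoff !step_le0 ?subrr ?neg// ltW.
have bx : b + n.+1%:R^-1 <= x.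
  by rewrite leNgt; apply/negP => xb; apply: xab; rewrite ax ltW.
have nb : 1 <= n.+1%:R * (x - b) by rewrite -ler_pdivrMl// mulr1 lerBrDl.
rewrite /cutoff !step_ge1 ?subrr//.
by apply: le_trans nb _; rewrite ler_wpM2l//; lra.
Qed.

(** The segment on the right of a lies in the ball of radius 2 / (n + 1)
    around a, and has a quarter of its length. *)
Lemma lebesgue_pt_mean (v : R -> R) (c d a : R) : c < a -> a < d ->
  integrable_on `[c, d] v -> lebesgue_pt (v \_ `[c, d]) a ->
  (fun n => n.+1%:R * \int[mu]_(x in `[a, a + n.+1%:R^-1]) `|v x - v a|) @ \oo --> (0 : R).
Proof.
move=> ca ad vi; rewrite /lebesgue_pt => lp.
have acd : a \in `[c, d]%classic by rewrite inE/= in_itv/= !ltW.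
pose r (n : nat) : R := 2 * n.+1%:R^-1.
have r0 n : 0 < r n by rewrite mulr_gt0.
have cr : r @ \oo --> (0 : R) by exact: cvg_mul0 cvg_harmonic.
have cr' : r @ \oo --> (0 : R)^'+.
  move=> U; rewrite /at_right /within/= => -[e e0 eU].
  have h : \forall n \near \oo, `|r n| < e by move/cvgr0Pnorm_lt: cr; apply.
  apply: filterS h => n rn; apply: eU => //=.
  by rewrite sub0r normrN.
have L := cvg_comp r _ cr' lp.
have {}L : (fun n => fine (davg (v \_ `[c, d]) a (r n))) @ \oo --> (0 : R) by exact: fine_cvg L.
have L4 := cvg_mul0 4 L.
suff : \forall n \near \oo, n.+1%:R * \int[mu]_(x in `[a, a + n.+1%:R^-1]) `|v x - v a| <=
    4 * fine (davg (v \_ `[c, d]) a (r n)).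
  move=> le; apply: squeeze_cvgr (cvg_cst 0) L4; apply: filterS le => n ->.
  by rewrite andbT mulr_ge0//; apply: Rintegral_ge0.
near=> n.
have rs : r n < Num.min (a - c) (d - a).
  by near: n; apply: (cvgr_lt _ cr); rewrite lt_min !subr_gt0 ca.
have {rs} [rc rd] : r n < a - c /\ r n < d - a by move: rs; rewrite lt_min => /andP[].
have ball_sub : ball a (r n) `<=` `[c, d].
  move: (r n) rc rd => s rc rd.
  by move=> x; rewrite ball_itv/= !in_itv/= => /andP[? ?]; apply/andP; split; lra.
have seg_sub : `[a, a + n.+1%:R^-1] `<=` ball a (r n).
  move=> x; rewrite ball_itv/= !in_itv/= => /andP[ax xa].
  have := r0 n; have : n.+1%:R^-1 < r n by rewrite /r ltr_pMl// ltr1n.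
  move: (r n) (n.+1%:R^-1) xa => s t xa ts s0.
  by apply/andP; split; lra.
have mb : measurable (ball a (r n)) by exact: measurable_ball.
have ii : integrable_on (ball a (r n)) (fun x => `|v x - v a|).
  apply: integrable_on_norm => //; apply: integrable_onS ball_sub _ => //.
  by apply: integrable_onB => //; exact: integrable_seg_cst.
have -> : fine (davg (v \_ `[c, d]) a (r n)) =
    (r n * 2)^-1 * \int[mu]_(x in ball a (r n)) `|v x - v a|.
  rewrite /davg /iavg lebesgue_measure_ball ?ltW//.
  have -> : (\int[mu]_(y in ball a (r n)) `|((center ((v \_ `[c, d]) a) \o v \_ `[c, d]) y)%:E| =
     (\int[mu]_(x in ball a (r n)) `|v x - v a|)%:E)%E.
    rewrite -integrable_on_EFin//; apply: eq_integral => y yb.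
    rewrite /= !patchE acd ifT//.
    by rewrite inE; apply: ball_sub; rewrite inE in yb.
  by rewrite inver gt_eqF ?pmulrn_lgt0//= mulr_natr.
rewrite (_ : 4 * _ = n.+1%:R * \int[mu]_(x in ball a (r n)) `|v x - v a|); last first.
  rewrite /r mulrA; congr (_ * _).
  have : (n.+1%:R : R) != 0 by rewrite pnatr_eq0.
  by move: (n.+1%:R) => t t0; field.
by rewrite ler_wpM2l//; apply: le_Rintegral_sub.
Unshelve. all: by end_near. Qed.

Lemma continuous_stepn (a : R) (n : nat) : continuous (fun x : R => n.+1%:R * cbump (n.+1%:R * (x - a))).
Proof.
have := Ck_mul (@Ck_cst R 1 n.+1%:R) (@Ck_affine R 1 cbump n.+1%:R (- (n.+1%:R * a)) (@Ck_bump R 1)).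
by under eq_fun do rewrite -mulrBr; move=> [f' df _] x; exact: is_derive_cont (df x).
Qed.

(** The bump of height n + 1 and width 1 / (n + 1) on the right of a has mass
    [bump_mass], so the difference with v a [bump_mass] is at most a multiple
    of the mean of |v - v a| near a. *)
Lemma mollify (v : R -> R) (c d a : R) : 0 < c -> c < a -> a + 1 <= d ->
  locally_integrable half_line v -> lebesgue_pt (v \_ `[c, d]) a ->
  (forall n, integrable_on half_line (fun x => v x * (n.+1%:R * cbump (n.+1%:R * (x - a))))) /\
  (fun n => \int[mu]_(x in half_line) (v x * (n.+1%:R * cbump (n.+1%:R * (x - a))))) @ \oo -->
  v a * bump_mass.
Proof.
move=> c0 ca ad vl lp.
have a0 : 0 < a := lt_trans c0 ca.
have vi := locally_integrable_segment d c0 vl.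
have ad' : a < d by lra.
have lm := lebesgue_pt_mean ca ad' vi lp.
have [M M0 MP] := @bump_bounded R.
have [mv _ _] := vl.
pose ph n x : R := n.+1%:R * cbump (n.+1%:R * (x - a)).
have ph0 n x : 0 <= ph n x by rewrite mulr_ge0 ?bump_ge0.
have phM n x : ph n x <= n.+1%:R * M by rewrite ler_wpM2l// MP.
have cph n : continuous (ph n) by exact: continuous_stepn.
pose I n : set R := `[a, a + n.+1%:R^-1]%classic.
have mI n : measurable (I n) by exact: measurable_itv.
have In n x : ~ I n x -> ph n x = 0.
  move=> nI; rewrite /ph bump_out ?mulr0//; apply/negP => /andP[h1 h2]; apply: nI.
  rewrite /I/= in_itv/=; apply/andP; split.
    by move: h1; rewrite pmulr_rgt0// subr_gt0 => /ltW.
  by move: h2; rewrite mulrC -ltr_pdivlMr// mul1r ltrBlDl => /ltW.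
have Isub n : I n `<=` half_line by exact: segment_half_line.
have Icd n : I n `<=` `[c, d].
  move=> x; rewrite /I/= !in_itv/= => /andP[ax xa].
  have : n.+1%:R^-1 <= 1 :> R by rewrite invf_le1// ler1n.
  move: (n.+1%:R^-1) xa => t xa t1.
  by apply/andP; split; lra.
have viI n : integrable_on (I n) v by exact: integrable_onS (Icd n) vi.
have phi n : integrable_on (I n) (ph n).
  apply: continuous_compact_integrable; first exact: segment_compact.
  exact: continuous_subspaceT.
have mph n (D : set R) : measurable_fun D (ph n).
  by apply: measurable_funTS; exact: continuous_measurable_fun.
have vphI n : integrable_on (I n) (fun x => v x * ph n x).
  apply: (@integrable_on_le _ _ _ (fun x => n.+1%:R * M * `|v x|)) => //.
  - by apply: measurable_funM => //; exact: measurable_funS mv.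
  - by move=> x _; rewrite normrM mulrC ler_wpM2r// ger0_norm.
  - by apply: integrable_onZ => //; exact: integrable_on_norm.
have res n : (fun x => v x * ph n x) \_ (I n) = (fun x => v x * ph n x).
  apply/funext => x; rewrite patchE; case: ifPn => // /negP xI.
  by rewrite In ?mulr0// => h; apply: xI; rewrite inE.
have iv n : integrable_on half_line (fun x => v x * ph n x).
  have h : integrable_on half_line ((fun x => v x * ph n x) \_ (I n)).
    rewrite /integrable_on -restrict_EFin; apply/integrable_restrict => //; first exact: mI.
    by rewrite (setIidr (Isub n)); exact: vphI.
  by rewrite res in h.
split; first exact: iv.
have E n : \int[mu]_(x in half_line) (v x * ph n x) =
    v a * bump_mass + \int[mu]_(x in I n) ((v x - v a) * ph n x).
  rewrite -{1}(res n) -Rintegral_sub//.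
  have st : \int[mu]_(x in I n) (ph n x) = bump_mass.
    have aI : a <= a + n.+1%:R^-1 by rewrite lerDl.
    rewrite /I (@FTC_hl _ (fun y => cstep (n.+1%:R * (y - a))) (ph n) _ _ a0 aI (fun x _ => cph n x)
      (fun x _ => is_derive_stepn a n x)).
    by rewrite [a + _]addrC addrK mulfV ?pnatr_eq0// subrr mulr0 (step_le0 (lexx 0)) subr0.
  have iz := integrable_onZ (v a) (mI n) (phi n).
  have ib : integrable_on (I n) (fun x => (v x - v a) * ph n x).
    have := integrable_onB (mI n) (vphI n) iz.
    by apply: eq_integrable_on => // x _; ring.
  rewrite -st -(@RintegralZl _ _ _ mu _ _ _ (mI n) (phi n)) -(@RintegralD _ _ _ mu _ _ _ (mI n) iz ib).
  by apply: eq_Rintegral => x _; ring.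
suff : (fun n => \int[mu]_(x in I n) ((v x - v a) * ph n x)) @ \oo --> (0 : R).
  move=> z; rewrite (_ : (fun n => \int[mu]_(x in half_line) (v x * ph n x)) =
    (fun n => v a * bump_mass + \int[mu]_(x in I n) ((v x - v a) * ph n x))); last exact/funext.
  by rewrite -[X in _ --> X]addr0; apply: cvgD => //; exact: cvg_cst.
apply: cvg0_le (cvg_mul0 M lm) => n.
have ivv : integrable_on (I n) (fun x => v x - v a).
  by apply: integrable_onB => //; exact: integrable_seg_cst.
have ii : integrable_on (I n) (fun x => (v x - v a) * ph n x).
  have := integrable_onB (mI n) (vphI n) (integrable_onZ (v a) (mI n) (phi n)).
  by apply: eq_integrable_on => // x _; ring.
apply: le_trans (@le_normr_Rintegral _ _ _ mu _ _ (mI n) ii) _.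
have -> : M * (n.+1%:R * \int[mu]_(x in `[a, a + n.+1%:R^-1]) `|v x - v a|) =
    (n.+1%:R * M) * \int[mu]_(x in I n) `|v x - v a| by rewrite /I; ring.
have nivv := integrable_on_norm (mI n) ivv.
rewrite -(@RintegralZl _ _ _ mu _ _ _ (mI n) nivv).
apply: (@le_Rintegral _ _ _ mu _ _ _ (mI n)).
- exact: integrable_on_norm.
- exact: integrable_onZ.
- by move=> x _; rewrite normrM mulrC ler_wpM2r// ger0_norm.
Qed.

End weak_derivative.

(** * Weak derivatives are derivatives almost everywhere *)

Section weak_derivative_ac.
Context {R : realType}.
Notation mu := (@lebesgue_measure R).

Lemma stepn_cvg (c x : R) : (fun n : nat => cstep (n.+1%:R * (x - c))) @ \oo -->
  (if c < x then bump_mass else 0 : R).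
Proof.
apply: cvg_near_cst; case: ltP => cx.
  have xc : 0 < x - c by rewrite subr_gt0.
  near=> n; apply: step_ge1; rewrite -ler_pdivrMr// mul1r.
  have : (x - c)^-1 <= n%:R by near: n; exact: nbhs_infty_ger.
  by move/le_trans; apply; rewrite ler_nat.
by apply: nearW => n; apply: step_le0; rewrite pmulr_rle0// subr_le0.
Unshelve. all: by end_near. Qed.

(** Test the weak derivative against [cutoff]: the left-hand side tends to (v
    a - v b) [bump_mass] by [mollify], and the right-hand side to -
    [bump_mass] times the integral of w by dominated convergence. *)
Lemma weak_derivative_increment (v w : R -> R) (c d a b : R) : is_wderiv v w ->
  0 < c -> c < a -> a < b -> b + 1 <= d ->
  lebesgue_pt (v \_ `[c, d]) a -> lebesgue_pt (v \_ `[c, d]) b ->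
  v b - v a = \int[mu]_(x in `[a, b]) w x.
Proof.
move=> [vl wl vw] c0 ca ab bd la lb.
have a0 : 0 < a := lt_trans c0 ca.
have ad : a + 1 <= d by lra.
have cb : c < b := lt_trans ca ab.
have [ia cva] := mollify c0 ca ad vl la.
have [ib cvb] := mollify c0 cb bd vl lb.
have s1 := @bump_mass_gt0 R.
have [mw _ _] := wl.
pose D : set R := `[a, b + 1]%classic.
have mD : measurable D by exact: measurable_itv.
have Dsub : D `<=` half_line by exact: segment_half_line.
have wi : integrable_on D w by exact: locally_integrable_segment.
have key n : \int[mu]_(x in half_line) (v x * (n.+1%:R * cbump (n.+1%:R * (x - a)))) -
    \int[mu]_(x in half_line) (v x * (n.+1%:R * cbump (n.+1%:R * (x - b)))) =
    - \int[mu]_(x in half_line) (w x * cutoff a b n x).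
  rewrite -(vw _ (test_function_cutoff n a0 ab)) -(@RintegralB _ _ _ mu _ _ _ measurable_half_line (ia n) (ib n)).
  apply: eq_Rintegral => x _; rewrite derive1E; have [_ ->] := is_derive_cutoff a b n x.
  by rewrite [RHS]mulrBr.
pose g := (fun x => bump_mass * `|w x|) \_ D.
have gi : integrable_on half_line g.
  rewrite /integrable_on -restrict_EFin; apply/integrable_restrict => //.
  by rewrite (setIidr Dsub); apply: integrable_onZ => //; exact: integrable_on_norm.
have mcut n : measurable_fun half_line (cutoff a b n).
  apply: measurable_funTS; apply: continuous_measurable_fun => x.
  exact: is_derive_cont (is_derive_cutoff a b n x).
pose f x := (fun x => w x * bump_mass) \_ `]a, b] x.
have [] := @Rdominated_convergence R half_line (fun n x => w x * cutoff a b n x) f g measurable_half_line.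
- by move=> n; apply: measurable_funM.
- move=> x _; have : (fun n => cutoff a b n x) @ \oo -->
      ((if (a < x)%R then bump_mass else 0) - (if (b < x)%R then bump_mass else 0) : R).
    by apply: cvgB; exact: stepn_cvg.
  move=> h; have -> : f x = w x * ((if (a < x)%R then bump_mass else 0) - (if (b < x)%R then bump_mass else 0)).
    rewrite /f patchE; case: ifPn; rewrite ?inE ?notin_setE/= in_itv/=.
      by move=> /andP[-> xb]; rewrite ltNge xb subr0.
    case: ltP => ax /=; first by move=> /negP; rewrite -ltNge => ->; rewrite subrr mulr0.
    by move=> _; rewrite ltNge (le_trans ax (ltW ab))/= subrr mulr0.
  by apply: cvgM => //; exact: cvg_cst.
- exact: gi.
- move=> n x _; rewrite /g patchE; case: ifPn => xD.
    rewrite normrM mulrC ler_wpM2r// /cutoff ler_norml.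
    have /andP[p1 p2] := step_bound (n.+1%:R * (x - a)).
    have /andP[p3 p4] := step_bound (n.+1%:R * (x - b)).
    by apply/andP; split; lra.
  suff -> : cutoff a b n x = 0 by rewrite mulr0 normr0.
  move: xD; rewrite notin_setE /D/= in_itv/= => /negP; rewrite negb_and -!ltNge /cutoff => /orP[xa|bx].
    by rewrite !step_le0 ?subrr// pmulr_rle0// subr_le0 ltW// (lt_trans xa).
  have nb : 1 <= n.+1%:R * (x - b).
    apply: (@le_trans _ _ (x - b)); first by lra.
    by rewrite ler_peMl ?ler1n//; lra.
  rewrite !step_ge1 ?subrr//.
  by apply: le_trans nb _; rewrite ler_wpM2l//; lra.
move=> _ lim.
have fE : \int[mu]_(x in half_line) f x = bump_mass * \int[mu]_(x in `[a, b]) w x.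
  have sub : `]a, b] `<=` @half_line R.
    by move=> x; rewrite /= in_itv/= half_lineE => /andP[ax _]; exact: lt_trans ax.
  have wi' : integrable_on `]a, b] w.
    apply: integrable_onS wi => //; rewrite /D; apply: subset_itv; rewrite bnd_simp//; lra.
  rewrite /f -Rintegral_sub//.
  under eq_Rintegral do rewrite mulrC.
  by rewrite RintegralZl// Rintegral_itv_obnd_cbnd.
have L1 : (fun n : nat => - \int[mu]_(x in half_line) (w x * cutoff a b n x)) @ \oo -->
    v a * bump_mass - v b * bump_mass.
  by rewrite -(funext key); exact: (cvgB cva cvb).
have L2 : (fun n : nat => - \int[mu]_(x in half_line) (w x * cutoff a b n x)) @ \oo -->
    - (bump_mass * \int[mu]_(x in `[a, b]) w x) by rewrite -fE; exact: cvgN.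
have E : v a * bump_mass - v b * bump_mass = - (bump_mass * \int[mu]_(x in `[a, b]) w x).
  exact: (cvg_unique _ L1 L2).
by apply: (mulfI (lt0r_neq0 s1)); lra.
Qed.

(** Almost every point is a Lebesgue point of v restricted to each segment of
    a countable exhausting family. The increments of v between two such points
    are integrals of w, so v agrees there with a primitive of w. *)
Lemma weak_derivative_ac (v w : R -> R) : is_wderiv v w ->
  exists2 V, ac_hl V w & ae_hl v V.
Proof.
move=> vw; have [vl wl _] := vw.
pose c (j : nat) : R := j.+1%:R^-1; pose d (j : nat) : R := j.+1%:R.
have c0 j : 0 < c j by rewrite invr_gt0.
pose good x := forall j, lebesgue_pt (v \_ `[c j, d j]) x.
have ae_good : {ae mu, forall x, good x}.
  apply/ae_foralln => j; apply: lebesgue_differentiation.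
  apply: integrable_locally_restrict => //.
  exact: locally_integrable_segment.
have inc (a b : R) : 0 < a -> a <= b -> good a -> good b ->
    v b - v a = \int[mu]_(x in `[a, b]) w x.
  move=> a0; rewrite le_eqVlt => /predU1P[<- _ _|ab ga gb].
    by rewrite subrr set_itv1 Rintegral_set1.
  have [j /andP[cj dj]] : exists j, (c j < a) && (b + 1 <= d j).
    near \oo => j; exists j; apply/andP; split.
      by near: j; exact: (cvgr_lt _ (@cvg_harmonic R)).
    have : b + 1 <= j%:R by near: j; exact: nbhs_infty_ger.
    by move/le_trans; apply; rewrite ler_nat.
  exact: (weak_derivative_increment vw (c0 j) cj ab dj (ga j) (gb j)).
have [x0 [x00 g0]] : exists x0, 0 < x0 /\ good x0.
  apply: contrapT => H.
  have N : mu.-negligible `[1, 2].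
    apply: (negligibleS _ ae_good) => x; rewrite /= in_itv/= => /andP[x1 _] gx.
    by apply: H; exists x; split => //; lra.
  have M : mu `[1, 2]%classic = 0%E by apply/negligibleP => //; exact: measurable_itv.
  move: M; rewrite lebesgue_measure_itv/= lte_fin ltr1n/= -EFinD => /eqP.
  by rewrite eqe => /eqP; lra.
pose V x := v x0 + (if x0 <= x then \int[mu]_(t in `[x0, x]) w t
                    else - \int[mu]_(t in `[x, x0]) w t).
have wi (s t : R) : 0 < s -> integrable_on `[s, t] w by move=> s0; exact: locally_integrable_segment.
exists V.
  move=> s t s0 st; split; first exact: wi.
  rewrite /V; case: leP => xt; case: leP => xs.
  - by rewrite (@Rintegral_cat _ _ x0 s t)//; [ring|exact: wi].
  - by rewrite (@Rintegral_cat _ _ s x0 t)//; [ring|exact: ltW|exact: wi].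
  - by move: (le_lt_trans st xt); rewrite ltNge xs.
  - by rewrite (@Rintegral_cat _ _ s t x0)//; [ring|exact: ltW|exact: wi].
apply: ae_imp ae_good => x gx; rewrite half_lineE => xp.
rewrite /V; case: leP => xx.
  by rewrite -(inc x0 x)//; ring.
by rewrite -(inc x x0 xp (ltW xx))//; ring.
Unshelve. all: by end_near. Qed.

End weak_derivative_ac.

(** * Gamma and beta integrals *)

Section affine_change_of_variable.
Context {R : realType}.
Notation mu := (@lebesgue_measure R).
Variables (c d : R).
Hypothesis c0 : 0 < c.

Let phi : R -> R := fun x => c * x + d.
Let mphi : measurable_fun setT (phi : measurableTypeR R -> measurableTypeR R).
Proof. by apply: measurable_funD => //; exact: measurable_funM. Qed.

Lemma lebesgue_measure_affine (A : set R) : measurable A ->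
  (c%:E * mu (phi @^-1` A))%E = mu A.
Proof.
move=> mA; apply/esym.
apply: (@lebesgue_measure_unique R (mscale (NngNum (ltW c0)) (measure_function_pushforward__canonical__measure_function_Measure mu mphi))) => //.
move=> _ [[a b]] _ <-; rewrite /mscale /= /pushforward.
rewrite [X in _ = (_ * mu X)%E](_ : _ = `](a - d) / c, (b - d) / c]%classic); last first.
  apply/seteqP; split => x; rewrite /= !in_itv/= /phi ltr_pdivrMr// ler_pdivlMr// ltrBlDr lerBrDr mulrC//.
rewrite !lebesgue_measure_itv/= !lte_fin ltr_pM2r ?invr_gt0// ltrD2r.
case: ifPn => // ab; last by rewrite mule0.
rewrite -!EFinD -EFinM; congr EFin; field.
by rewrite gt_eqF.
Qed.

Lemma ge0_integral_affine (f : R -> \bar R) : measurable_fun setT f -> (forall x, 0 <= f x)%E ->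
  (\int[mu]_x f x = c%:E * \int[mu]_x f (c * x + d)%R)%E.
Proof.
move=> mf f0.
transitivity (\int[mscale (NngNum (ltW c0)) (measure_function_pushforward__canonical__measure_function_Measure mu mphi)]_x f x)%E.
  by apply: eq_measure_integral => A mA _; apply/esym; exact: lebesgue_measure_affine.
rewrite ge0_integral_mscale//=; congr (_ * _)%E.
by rewrite ge0_integral_pushforward.
Qed.

End affine_change_of_variable.

Section gamma_beta.
Context {R : realType}.
Notation mu := (@lebesgue_measure R).
Implicit Types (p q x y : R).

Lemma GammaE p : Gamma p = \int[mu]_(t in half_line) wt 1 (p - 1) t.
Proof. by apply: eq_Rintegral => t _; rewrite /wt mul1r. Qed.

Lemma integrable_wt_gt0 p : 0 < p -> integrable_on half_line (wt 1 (p - 1)).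
Proof. by move=> p0; apply: integrable_wt => //; lra. Qed.

Lemma Rintegral_gt0 (f : R -> R) : integrable_on half_line f -> cont_hl f ->
  (forall x, 0 < x -> 0 < f x) -> 0 < \int[mu]_(x in half_line) f x.
Proof.
move=> fi cf f0.
have c1 : {within `[1, 2], continuous f} by apply: cont_hl_within.
have [c cI cP] := EVT_min (ler1n R 2) c1.
have c0 : 0 < c by move: cI; rewrite in_itv/= => /andP[h _]; lra.
apply: lt_le_trans (f0 c c0) _.
apply: (@le_trans _ _ (\int[mu]_(x in `[1, 2]) f x)); last first.
  apply: le_Rintegral_sub => //; first exact: segment_half_line.
  by move=> x; rewrite half_lineE => x0; rewrite ltW// f0.
have -> : f c = \int[mu]_(x in `[1, 2]) f c.
  by rewrite Rintegral_seg_cst ?ler1n//; ring.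
apply: le_Rintegral => //.
- exact: integrable_seg_cst.
- by apply: integrable_onS fi => //; exact: segment_half_line.
Qed.

Lemma Gamma_gt0 p : 0 < p -> 0 < Gamma p.
Proof.
move=> p0; rewrite GammaE; apply: Rintegral_gt0.
- exact: integrable_wt_gt0.
- exact: cont_hl_wt.
- by move=> x x0; exact: wt_gt0.
Qed.

(** Integrate the derivative (p - x) x^(p-1) e^{-x} of x^p e^{-x} over
    exhausting segments. *)
Lemma GammaS p : 0 < p -> Gamma (p + 1) = p * Gamma p.
Proof.
move=> p0; rewrite !GammaE addrK.
have i1 := integrable_wt_gt0 p0.
have i2 : integrable_on half_line (wt 1 p) by apply: integrable_wt => //; lra.
pose F x := wt 1 (p - 1) x + wt 1 p x.
have iF : integrable_on half_line F by exact: integrable_onD.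
have [a_ [b_ [exh Fa Fb _ _]]] := vanish_seq ltr01 (lexx 1)
  (fun x _ => addr_ge0 (wt_ge0 1 (p - 1) x) (wt_ge0 1 p x) : 0 <= F x) iF.
have [apos ab _ _] := exh.
have ip := integrable_onZ p measurable_half_line i1.
rewrite -RintegralZl//.
apply: (@eq_sub_cvg0 _ _ _ (fun k => wt 1 p (a_ k) - wt 1 p (b_ k)) _ _ _ (cvg_trunc exh i2) (cvg_trunc exh ip)).
  move=> k.
  have dw (x : R) : 0 < x -> is_derive x 1 (wt 1 p) ((p - x) * wt 1 (p - 1) x).
    by move=> x0; have := is_derive_wt 1 (p - 1) x0; rewrite subrK mul1r.
  have cd : cont_hl (fun x => (p - x) * wt 1 (p - 1) x).
    move=> x x0; apply: continuousM; last exact: cont_hl_wt.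
    by apply: continuousB; [exact: cst_continuous|exact: id].
  have := FTC_hl (apos k) (ab k) cd dw.
  have j1 : integrable_on `[a_ k, b_ k] (fun x => p * wt 1 (p - 1) x).
    by apply: integrable_onS ip => //; exact: segment_half_line.
  have j2 : integrable_on `[a_ k, b_ k] (wt 1 p).
    by apply: integrable_onS i2 => //; exact: segment_half_line.
  have -> : \int[mu]_(x in `[a_ k, b_ k]) ((p - x) * wt 1 (p - 1) x) =
     \int[mu]_(x in `[a_ k, b_ k]) (p * wt 1 (p - 1) x) - \int[mu]_(x in `[a_ k, b_ k]) wt 1 p x.
    rewrite -RintegralB//; apply: eq_Rintegral => x; rewrite inE/= in_itv/= => /andP[ax _].
    have x0 : 0 < x := lt_le_trans (apos k) ax.
    by rewrite -[in wt 1 p x](subrK 1 p) wtS//; ring.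
  lra.
rewrite -[X in _ --> X](subr0 0); apply: cvgB.
  apply: cvg0_le Fa => k; rewrite ger0_norm ?wt_ge0// /F.
  rewrite -[in wt 1 p (a_ k)](subrK 1 p) wtS// ler_wpM2l ?(ltW (apos k))// lerDl.
  by rewrite mulr_ge0 ?wt_ge0 ?(ltW (apos k)).
by apply: cvg0_le Fb => k; rewrite ger0_norm ?wt_ge0// /F lerDr wt_ge0.
Qed.

(** The power t^(p-1) extended by 0 to the negative numbers: integrals over
    moving domains become integrals over the whole line, to which Tonelli's
    theorem applies. *)
Definition hpow p (t : R) : R := (fun t => t `^ (p - 1)) \_ half_line t.

Lemma hpow_ge0 p t : 0 <= hpow p t.
Proof. by rewrite /hpow patchE; case: ifP => // _; exact: powR_ge0. Qed.

Lemma hpow_le0 p t : t <= 0 -> hpow p t = 0.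
Proof. by move=> t0; rewrite /hpow patchE memNset// half_lineE; apply/negP; rewrite -leNgt. Qed.

Lemma hpow_gt0 p t : 0 < t -> hpow p t = t `^ (p - 1).
Proof. by move=> t0; rewrite /hpow patchE mem_set// half_lineE. Qed.

Lemma measurable_hpow p : measurable_fun setT (hpow p).
Proof.
have h := @measurable_restrictT _ _ _ _ half_line (fun t : R => t `^ (p - 1)) measurable_half_line.
apply: (proj1 h).
by apply: measurable_funTS; exact: measurable_powR.
Qed.

Lemma hpowM p (c t : R) : 0 < c -> hpow p (c * t) = c `^ (p - 1) * hpow p t.
Proof.
move=> c0; have [t0|t0] := leP t 0.
  by rewrite !hpow_le0 ?mulr0// pmulr_rle0.
by rewrite !hpow_gt0 ?mulr_gt0// powRM// ltW.
Qed.

Lemma integral_hpow p (b : R) : 0 < p -> 0 < b ->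
  (\int[mu]_t (hpow p t * expR (- (b * t)))%:E = (\int[mu]_(t in half_line) wt b (p - 1) t)%:E)%E.
Proof.
move=> p0 b0; rewrite -integrable_on_EFin//; last by apply: integrable_wt => //; lra.
rewrite [RHS]integral_mkcond; apply: eq_integral => t _.
by rewrite /hpow !patchE; case: ifP => // _; rewrite mul0r.
Qed.

Lemma Gamma_scale p (b : R) : 0 < p -> 0 < b ->
  b `^ p * \int[mu]_(t in half_line) wt b (p - 1) t = Gamma p.
Proof.
move=> p0 b0; apply: EFin_inj; rewrite GammaE -integral_hpow//.
have mf : measurable_fun setT (fun t => (hpow p t * expR (- (1 * t)))%:E).
  apply/measurable_EFinP; apply: measurable_funM; first exact: measurable_hpow.
  by apply: measurableT_comp => //; exact: measurableT_comp.
rewrite (ge0_integral_affine 0 b0 mf); last first.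
  by move=> x; rewrite lee_fin mulr_ge0 ?hpow_ge0 ?expR_ge0.
under eq_integral do rewrite addr0 mul1r hpowM// -mulrA EFinM.
rewrite ge0_integralZl_EFin//; last 3 first.
- by move=> x _; rewrite lee_fin mulr_ge0 ?hpow_ge0 ?expR_ge0.
- apply/measurable_EFinP; apply: measurable_funM; first exact: measurable_hpow.
  by apply: measurableT_comp => //; apply: measurableT_comp => //; exact: measurable_funM.
- exact: powR_ge0.
rewrite integral_hpow// -!EFinM mulrA mulr_powRB1// ltW//.
Qed.

Lemma ge0_integralZ (k : R) (f : R -> \bar R) : 0 <= k -> measurable_fun setT f ->
  (forall x, 0 <= f x)%E -> (\int[mu]_x (k%:E * f x) = k%:E * \int[mu]_x f x)%E.
Proof. by move=> k0 mf f0; rewrite ge0_integralZl_EFin. Qed.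

Lemma convolution_hpow p q y : 0 < y ->
  (\int[mu]_t (hpow q t * hpow p (y - t))%:E =
   (y `^ (p + q - 1))%:E * \int[mu]_t (hpow q t * hpow p (1 - t))%:E)%E.
Proof.
move=> y0.
have mf (z : R) : measurable_fun setT (fun t => (hpow q t * hpow p (z - t))%:E).
  apply/measurable_EFinP; apply: measurable_funM; first exact: measurable_hpow.
  apply: measurableT_comp; first exact: measurable_hpow.
  by apply: measurable_funB.
rewrite (ge0_integral_affine 0 y0 (mf y)); last first.
  by move=> x; rewrite lee_fin mulr_ge0 ?hpow_ge0.
have -> : (fun x => (hpow q (y * x + 0)%R * hpow p (y - (y * x + 0)))%:E) =
  (fun x => (y `^ (q - 1) * y `^ (p - 1))%:E * (hpow q x * hpow p (1 - x))%:E)%E.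
  apply/funext => x; rewrite addr0 -[X in hpow p (X - _)](mulr1 y) -mulrBr !hpowM// -EFinM.
  by congr EFin; ring.
rewrite ge0_integralZl_EFin//; last 3 first.
- by move=> x _; rewrite lee_fin mulr_ge0 ?hpow_ge0.
- exact: (mf 1).
- by rewrite mulr_ge0 ?powR_ge0.
rewrite muleA -EFinM; congr (EFin _ * _)%E.
rewrite -powRD ?(gt_eqF y0) ?implybT//.
rewrite -{1}[y]powRr1 ?ltW// -powRD ?(gt_eqF y0) ?implybT//; congr (_ `^ _).
by ring.
Qed.

(** Integrate t^(q-1) (y - t)^(p-1) e^{-y} over 0 < t < y in both orders. One
    order gives Gamma p Gamma q; in the other one the inner integral is
    y^(p+q-1) times the beta integral, by homogeneity. *)
Lemma Gamma_convolution p q : 0 < p -> 0 < q ->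
  (\int[mu]_t (hpow q t * hpow p (1 - t))%:E = (Gamma p * Gamma q / Gamma (p + q))%:E)%E.
Proof.
move=> p0 q0.
have pq0 : 0 < p + q by rewrite addr_gt0.
have mexp (b : R) : measurable_fun setT (fun y : R => expR (- (b * y))).
  by apply: measurableT_comp => //; apply: measurableT_comp => //; exact: measurable_funM.
pose F (z : measurableTypeR R * measurableTypeR R) : \bar R :=
  (hpow q z.1 * hpow p (z.2 - z.1) * expR (- (1 * z.2)))%:E.
have F0 z : (0 <= F z)%E by rewrite lee_fin !mulr_ge0 ?hpow_ge0 ?expR_ge0.
have mF : measurable_fun setT F.
  apply/measurable_EFinP; apply: measurable_funM; first apply: measurable_funM.
  - by apply: (measurableT_comp (measurable_hpow q)); exact: measurable_fst.
  - apply: (measurableT_comp (measurable_hpow p)).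
    by apply: measurable_funB; [exact: measurable_snd|exact: measurable_fst].
  - by apply: (measurableT_comp (mexp 1)); exact: measurable_snd.
have T := @fubini_tonelli _ _ _ _ _ mu mu F mF F0.
have Gpq r : 0 < r -> (\int[mu]_t (hpow r t * expR (- (1 * t)))%:E = (Gamma r)%:E)%E.
  by move=> r0; rewrite (integral_hpow r0 ltr01) [in RHS]GammaE.
have mh r : measurable_fun setT (fun t => (hpow r t * expR (- (1 * t)))%:E).
  by apply/measurable_EFinP; apply: measurable_funM; [exact: measurable_hpow|exact: mexp].
have h0 r t : (0 <= (hpow r t * expR (- (1 * t)))%:E)%E.
  by rewrite lee_fin mulr_ge0 ?hpow_ge0 ?expR_ge0.
have L : (\int[mu]_x \int[mu]_y F (x, y) = (Gamma p * Gamma q)%:E)%E.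
  transitivity (\int[mu]_x ((Gamma p)%:E * (hpow q x * expR (- (1 * x)))%:E))%E; last first.
    by rewrite (ge0_integralZ (ltW (Gamma_gt0 p0)) (mh q) (h0 q)) (Gpq _ q0).
  apply: eq_integral => x _.
  transitivity (\int[mu]_y ((hpow q x * expR (- (1 * x)))%:E *
      (hpow p (1 * y + - x) * expR (- (1 * (1 * y + - x))))%:E))%E.
    apply: eq_integral => y _; rewrite /F/= -EFinM; congr EFin.
    by rewrite !mul1r (_ : - y = - x + - (y - x)) ?expRD; ring.
  have ms : measurable_fun setT (fun y : R => (hpow p (1 * y + - x) * expR (- (1 * (1 * y + - x))))%:E).
    apply: (measurableT_comp (mh p)); apply: measurable_funD => //; exact: measurable_funM.
  have k0 : 0 <= hpow q x * expR (- (1 * x)) by rewrite mulr_ge0 ?hpow_ge0 ?expR_ge0.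
  rewrite (ge0_integralZ k0 ms (fun y => h0 p (1 * y + - x))).
  have := ge0_integral_affine (- x) ltr01 (mh p) (h0 p).
  by rewrite (Gpq _ p0) mul1e => <-; rewrite muleC.
have Rr : (\int[mu]_y \int[mu]_x F (x, y) =
    (Gamma (p + q))%:E * \int[mu]_t (hpow q t * hpow p (1 - t))%:E)%E.
  set B := (\int[mu]_t (hpow q t * hpow p (1 - t))%:E)%E.
  have B0 : (0 <= B)%E by apply: integral_ge0 => t _; rewrite lee_fin mulr_ge0 ?hpow_ge0.
  transitivity (\int[mu]_y ((hpow (p + q) y * expR (- (1 * y)))%:E * B))%E; last first.
    rewrite (@ge0_integralZr _ _ _ mu setT measurableT _ (mh (p + q)) B (fun x _ => h0 (p + q) x) B0).
    by rewrite (Gpq _ pq0).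
  apply: eq_integral => y _; rewrite /F/=.
  transitivity ((expR (- (1 * y)))%:E * \int[mu]_x (hpow q x * hpow p (y - x))%:E)%E.
    have mk : measurable_fun setT (fun x => (hpow q x * hpow p (y - x))%:E).
      apply/measurable_EFinP; apply: measurable_funM; first exact: measurable_hpow.
      by apply: (measurableT_comp (measurable_hpow p)); exact: measurable_funB.
    have k0 x : (0 <= (hpow q x * hpow p (y - x))%:E)%E by rewrite lee_fin mulr_ge0 ?hpow_ge0.
    rewrite -(ge0_integralZ (expR_ge0 _) mk k0).
    by apply: eq_integral => x _; rewrite -EFinM; congr EFin; ring.
  have [y0|y0] := leP y 0.
    have -> : (\int[mu]_x (hpow q x * hpow p (y - x))%:E = 0)%E.
      apply: integral0_eq.
      move=> x _.
      have [x0|x0] := leP x 0.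
        by rewrite (hpow_le0 _ x0) mul0r.
      have yx : y - x <= 0 by rewrite subr_le0 (le_trans y0) ?ltW.
      by rewrite (hpow_le0 _ yx) mulr0.
    by rewrite (hpow_le0 _ y0) mul0r mul0e mule0.
  by rewrite (convolution_hpow p q y0) (hpow_gt0 _ y0) muleA -EFinM [in LHS]mulrC.
rewrite L Rr in T.
set B := (\int[mu]_t (hpow q t * hpow p (1 - t))%:E)%E in T *.
have G0 := Gamma_gt0 pq0.
have Gn : Gamma (p + q) != 0 by rewrite gt_eqF.
transitivity ((Gamma (p + q))^-1%:E * ((Gamma (p + q))%:E * B))%E.
  by rewrite muleA -EFinM mulVf// mul1e.
by rewrite -T -EFinM mulrC.
Qed.

Lemma beta_integral p q x : 0 < p -> 0 < q -> 0 < x ->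
  integrable_on `]0, x[ (fun t => (x - t) `^ (p - 1) * t `^ (q - 1)) /\
  \int[mu]_(t in `]0, x[) ((x - t) `^ (p - 1) * t `^ (q - 1)) =
  Gamma p * Gamma q / Gamma (p + q) * x `^ (p + q - 1).
Proof.
move=> p0 q0 x0.
have E : (\int[mu]_(t in [set` `]0%R, x[%R]) ((x - t) `^ (p - 1) * t `^ (q - 1))%:E =
   (Gamma p * Gamma q / Gamma (p + q) * x `^ (p + q - 1))%:E)%E.
  rewrite mulrC EFinM -Gamma_convolution// -convolution_hpow//.
  rewrite [LHS]integral_mkcond; apply: eq_integral => t _.
  rewrite patchE; case: ifPn; rewrite ?inE ?notin_setE/= in_itv/=.
    by move=> /andP[t0 tx]; rewrite !hpow_gt0 ?subr_gt0// mulrC.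
  move=> /negP; rewrite negb_and -!leNgt => /orP[t0|xt].
    by rewrite hpow_le0// mul0r.
  by rewrite [hpow p _]hpow_le0 ?mulr0// subr_le0.
split; last by rewrite /Rintegral E.
apply: integrable_onP => //.
  apply: measurable_funM; last by apply: measurable_funTS; exact: measurable_powR.
  apply: (measurableT_comp (measurable_powR _)); exact: measurable_funB.
under eq_integral do rewrite abse_EFin ger0_norm ?mulr_ge0 ?powR_ge0//.
by rewrite E ltry.
Qed.

End gamma_beta.

Section gamma_integer.
Context {R : realType}.

(** The beta integral with both exponents 0 says that the square of Gamma 1 is
    Gamma 2, that is, Gamma 1. *)
Lemma Gamma1 : Gamma 1 = 1 :> R.
Proof.
have [_] := beta_integral (@ltr01 R) (@ltr01 R) (@ltr01 R).
have -> : \int[@lebesgue_measure R]_(t in `]0, 1[) ((1 - t) `^ (1 - 1) * t `^ (1 - 1)) =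
   \int[@lebesgue_measure R]_(t in `]0, 1[) 1.
  by apply: eq_Rintegral => t _; rewrite subrr !powRr0 mulr1.
rewrite Rintegral_cst//= lebesgue_measure_itv/= lte_fin ltr01 /= subr0 mulr1.
rewrite powR1 mulr1 (GammaS (@ltr01 R)) mul1r mulfK//.
by rewrite gt_eqF// Gamma_gt0.
Qed.

Lemma Gamma_fact k : Gamma (k%:R + 1) = k`!%:R :> R.
Proof.
elim: k => [|k IH]; first by rewrite add0r Gamma1.
rewrite GammaS ?ltr0n// factS natrM -IH -natr1//.
Qed.

End gamma_integer.

(** * Laguerre polynomials and their moments *)

Section laguerre_algebra.
Context {R : realType}.
Implicit Types (a : R) (q r : {poly R}) (n i : nat).

Lemma factn0 n : n`!%:R != 0 :> R.
Proof. by rewrite pnatr_eq0 -lt0n fact_gt0. Qed.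

Lemma coef_laguerre a n i : (i <= n)%N -> (laguerre_std a n)`_i =
  (-1) ^+ i * (\prod_(i <= j < n) (a + j.+1%:R)) / (n - i)`!%:R / i`!%:R.
Proof. by move=> ni; rewrite /laguerre_std coef_poly ltnS ni. Qed.

Lemma coef_laguerre_gt a n i : (n < i)%N -> (laguerre_std a n)`_i = 0.
Proof. by move=> ni; rewrite /laguerre_std coef_poly ltnS leqNgt ni. Qed.

Lemma laguerre_std0 a : laguerre_std a 0 = 1.
Proof.
apply/polyP => -[|i]; last by rewrite coef_laguerre_gt// coef1.
by rewrite coef_laguerre// coef1 big_geq// !fact0 expr0 !divr1 mulr1.
Qed.

Lemma prod_shift a i n : (i <= n)%N ->
  \prod_(i <= j < n.+1) (a + j.+1%:R) = (a + i.+1%:R) * \prod_(i <= j < n) (a + 1 + j.+1%:R).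
Proof.
move=> ni; rewrite big_ltn ?ltnS// big_add1/=; congr (_ * _).
by apply: eq_bigr => j _; rewrite -[j.+2%:R]natr1; ring.
Qed.

Lemma laguerre_std_pascal a n :
  laguerre_std (a + 1) n.+1 - laguerre_std (a + 1) n = laguerre_std a n.+1.
Proof.
apply/polyP => i; rewrite coefB.
have [ni|ni|->] := ltngtP i n.+1; last first.
- by rewrite [X in _ - X]coef_laguerre_gt// subr0 !coef_laguerre// !big_geq.
- by rewrite !coef_laguerre_gt ?subrr// ltnW.
rewrite ltnS in ni.
rewrite !coef_laguerre ?(leqW ni)// (@prod_shift a i n ni) big_nat_recr//=.
rewrite subSn// factS natrM.
set P := \prod_(i <= j < n) _.
have f1 := factn0 i; have f2 := factn0 (n - i).
have f3 : (n - i).+1%:R != 0 :> R by rewrite pnatr_eq0.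
have E : n.+1%:R = (n - i).+1%:R + i%:R :> R by rewrite -natrD addSn subnK.
rewrite E -[i.+1%:R]natr1.
move: f1 f2 f3; move: (i`!%:R) ((n - i)`!%:R) ((n - i).+1%:R) (i%:R) P ((-1) ^+ i) => x y z t P s x0 y0 z0.
by field; rewrite x0 y0 z0.
Qed.

(** Pascal's identity L_n^(a+1) - L_(n-1)^(a+1) = L_n^a shows that the
    extension to -2 < a <= -1 is given by the same formula as the standard
    case. *)
Lemma laguerreE a n : laguerre a n = laguerre_std a n.
Proof.
rewrite /laguerre; case: ltP => // _; case: n => [|n]; first by rewrite laguerre_std0.
exact: laguerre_std_pascal.
Qed.

(** For the weight w_a = x^a e^{-x}, (w_{a+1} q)' = w_a (raising_op a q): this
    is the formal adjoint of - d/dx, from the weight of index a to that of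
    index a + 1. *)
Definition raising_op a q : {poly R} := 'X * q^`() + (a + 1) *: q - 'X * q.

(** The raising form of Rodrigues' formula; it is checked on coefficients. *)
Lemma laguerre_raising a n :
  n.+1%:R *: laguerre_std a n.+1 = raising_op a (laguerre_std (a + 1) n).
Proof.
apply/polyP => i; rewrite coefZ coefB coefD coefZ !coefXM coef_deriv.
case: i => [|i] /=.
  rewrite subr0 add0r !coef_laguerre// prod_shift// !subn0 factS natrM.
  have f2 := factn0 n.
  have f3 : n.+1%:R != 0 :> R by rewrite pnatr_eq0.
  rewrite fact0 !divr1 !expr0 !mul1r; move: f2 f3; set P := \prod_(0 <= j < n) _.
  move: (n`!%:R) (n.+1%:R) P => x y P x0 y0.
  by field; rewrite x0 y0.
have [ni|ni|nE] := ltngtP i n; last first.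
- rewrite nE [in RHS]coef_laguerre_gt// mul0rn mulr0 add0r sub0r !coef_laguerre//.
  rewrite !big_geq// !subnn fact0 factS natrM exprS.
  have f2 := factn0 n.
  have f3 : n.+1%:R != 0 :> R by rewrite pnatr_eq0.
  move: f2 f3; move: (n`!%:R) (n.+1%:R) ((-1) ^+ n) => x y s x0 y0.
  by field; rewrite x0 y0.
- rewrite !coef_laguerre_gt ?ltnS ?(leqW (ltnW ni)) ?(leqW ni) ?(ltnW ni)//.
  by rewrite mulr0 mul0rn mulr0 add0r subr0.
have ni1 := ltnW ni; have ni2 : (i.+1 <= n.+1)%N by [].
rewrite -[(laguerre_std (a + 1) n)`_i.+1 *+ i.+1]mulr_natr !coef_laguerre //.
rewrite (@prod_shift a i.+1 n ni).
rewrite [in X in _ - X](big_ltn ni).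
set P := \prod_(i.+1 <= j < n) _.
have [k kE] : exists k, (n - i = k.+1)%N by exists (n - i).-1; rewrite prednK// subn_gt0.
rewrite subSS kE.
have -> : (n - i.+1 = k)%N by rewrite subnS kE.
rewrite !factS !natrM exprS.
have E : n.+1%:R = k.+1%:R + i.+1%:R :> R.
  by rewrite -natrD addnS -kE subnK// ltnW.
have f1 := factn0 i; have f2 := factn0 k.
have f3 : k.+1%:R != 0 :> R by rewrite pnatr_eq0.
have f4 : i.+1%:R != 0 :> R by rewrite pnatr_eq0.
rewrite E -[i.+2%:R]natr1.
move: f1 f2 f3 f4; move: (i`!%:R) (k`!%:R) (k.+1%:R) (i.+1%:R) P ((-1) ^+ i) => x y z t P s x0 y0 z0 t0.
by field; rewrite x0 y0 z0 t0.
Qed.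

Lemma size_laguerre a n : size (laguerre_std a n) = n.+1.
Proof.
rewrite /laguerre_std size_poly_eq// big_geq// subnn fact0 divr1 mulr1.
by rewrite mulf_neq0 ?invr_eq0 ?factn0// expf_neq0// oppr_eq0 oner_eq0.
Qed.

Lemma laguerre_derivn a n : (laguerre_std a n)^`(n) = ((-1) ^+ n)%:P.
Proof.
apply/polyP => i; rewrite coef_derivn coefC; case: i => [|i].
  rewrite addn0 ffactnn coef_laguerre// big_geq// subnn fact0 divr1 mulr1.
  by rewrite -[LHS]mulr_natr divfK ?factn0.
by rewrite coef_laguerre_gt ?mul0rn// addnS ltnS leq_addr.
Qed.

(** For a + i > -1 this is Gamma(a+i+1), the i-th moment of x^a e^{-x}. For -2
    < a <= -1 and i = 0 the integral diverges, and this formula is its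
    analytic continuation; at the pole a = -1 the zeroth moment only ever
    occurs with the coefficient 0. *)
Definition moment a i : R := Gamma (a + i%:R + 2) / (a + i%:R + 1).

Definition moment_fun a q : R := \sum_(i < size q) q`_i * moment a i.
Notation M := moment_fun.

Lemma moment_fun_wide a q n : (size q <= n)%N -> M a q = \sum_(i < n) q`_i * moment a i.
Proof.
move=> qn; rewrite /M (big_ord_widen n (fun i => q`_i * moment a i) qn) big_mkcond.
apply: eq_bigr => i _; case: ltnP => // qi; by rewrite nth_default ?mul0r.
Qed.

Lemma moment_funD a q r : M a (q + r) = M a q + M a r.
Proof.
pose n := maxn (size q) (size r).
rewrite !(@moment_fun_wide _ _ n) ?leq_maxl ?leq_maxr ?(leq_trans (size_polyD _ _))//.
by rewrite -big_split/=; apply: eq_bigr => i _; rewrite coefD mulrDl.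
Qed.

Lemma moment_funZ a (c : R) q : M a (c *: q) = c * M a q.
Proof.
rewrite (@moment_fun_wide _ _ (size q)) ?size_scale_leq// /M mulr_sumr.
by apply: eq_bigr => i _; rewrite coefZ; ring.
Qed.

Lemma moment_funB a q r : M a (q - r) = M a q - M a r.
Proof. by rewrite -scaleN1r moment_funD moment_funZ mulN1r. Qed.

Lemma moment_fun0 a : M a 0 = 0.
Proof. by rewrite /M size_poly0 big_ord0. Qed.

Lemma moment_fun_sum a (I : Type) (s : seq I) (F : I -> {poly R}) :
  M a (\sum_(i <- s) F i) = \sum_(i <- s) M a (F i).
Proof.
elim: s => [|i s IH]; first by rewrite !big_nil moment_fun0.
by rewrite !big_cons moment_funD IH.
Qed.

Lemma moment_funXn a n : M a 'X^n = moment a n.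
Proof.
rewrite (@moment_fun_wide _ _ n.+1) ?size_polyXn// big_ord_recr/= big1.
  by rewrite add0r coefXn eqxx mul1r.
by move=> i _; rewrite coefXn ltn_eqF ?mul0r.
Qed.

Lemma momentS a i : -2 < a -> a + i%:R + 1 != 0 ->
  moment a i.+1 = (a + i%:R + 1) * moment a i.
Proof.
move=> a2 ai; have ige : 0 <= i%:R :> R by [].
have p : 0 < a + i%:R + 2 by lra.
rewrite /moment -natr1.
have -> : a + (i%:R + 1) + 2 = a + i%:R + 2 + 1 by ring.
rewrite GammaS//.
have -> : a + (i%:R + 1) + 1 = a + i%:R + 2 by ring.
rewrite mulrAC mulfV ?gt_eqF// mul1r mulrC divfK//.
Qed.

Lemma moment_fun_partsXn a i j : -2 < a -> (a = -1 -> (0 < i)%N) ->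
  M a ('X^i * raising_op a 'X^j) = - M (a + 1) (('X^i)^`() * 'X^j).
Proof.
move=> a2 ai.
have E : 'X^i * raising_op a 'X^j = (a + 1 + j%:R) *: 'X^(i + j) - 'X^((i + j).+1) :> {poly R}.
  rewrite /raising_op derivXn -!mul_polyC -mulr_natl !polyCD polyC_natr exprS exprD.
  case: j => [|j] /=; first by ring.
  by rewrite !exprS; ring.
rewrite E moment_funB moment_funZ !moment_funXn.
have nz : a + (i + j)%:R + 1 != 0.
  have [e|ne] := eqVneq a (-1).
    rewrite e addrAC addNr add0r.
    by rewrite pnatr_eq0 addn_eq0 negb_and -lt0n ai.
  case: (i + j)%N => [|k]; first by rewrite addr0 addr_eq0.
  have := ler0n R k; rewrite -natr1 => k0; rewrite gt_eqF//; lra.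
rewrite momentS//.
case: i ai nz {E} => [|i] ai nz.
  rewrite expr0 derivC mul0r moment_fun0 add0n; by ring.
rewrite derivXn -['X^(i.+1.-1) *+ _]scaler_nat -scalerAl moment_funZ -exprD moment_funXn addSn.
have -> : moment (a + 1) (i + j) = moment a (i + j).+1.
  by rewrite /moment -natr1; congr (Gamma _ / _); ring.
by rewrite -[(i + j).+1%:R]natr1 -[i.+1%:R]natr1 natrD; ring.
Qed.

End laguerre_algebra.

(** * Orthogonality of the extended Laguerre polynomials *)

Section laguerre_orthogonality.
Context {R : realType}.
Notation mu := (@lebesgue_measure R).
Implicit Types (a : R) (q r : {poly R}) (n i : nat).
Notation M := moment_fun.

Lemma poly_span_ind (P : {poly R} -> Prop) :
  (forall r s, P r -> P s -> P (r + s)) -> (forall c r, P r -> P (c *: r)) ->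
  (forall j, P 'X^j) -> forall r, P r.
Proof.
move=> PD PZ PX r; rewrite -[r]coefK poly_def.
apply: big_ind => [|//|i _]; last exact: PZ.
by rewrite -(scale0r 'X^0); exact: PZ.
Qed.

Lemma raising_opD a q r : raising_op a (q + r) = raising_op a q + raising_op a r.
Proof. by rewrite /raising_op derivD scalerDr; ring. Qed.

Lemma raising_opZ a (c : R) q : raising_op a (c *: q) = c *: raising_op a q.
Proof. by rewrite /raising_op derivZ -!mul_polyC; ring. Qed.

(** The algebraic form of an integration by parts, valid for the continued
    moments. By linearity, monomials suffice; for a = -1 they must be
    multiples of x, so q is first divided by x. *)
Lemma moment_fun_parts a q r : -2 < a -> (a = -1 -> q.[0] = 0) ->
  M a (q * raising_op a r) = - M (a + 1) (q^`() * r).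
Proof.
move=> a2.
have step1 i : (a = -1 -> (0 < i)%N) ->
    M a ('X^i * raising_op a r) = - M (a + 1) (('X^i)^`() * r).
  move=> ai; elim/poly_span_ind: r => [r s Hr Hs|c r Hr|j].
  - by rewrite raising_opD [X in M a X]mulrDr [X in M (a + 1) X]mulrDr !moment_funD Hr Hs opprD.
  - by rewrite raising_opZ -!scalerAr !moment_funZ Hr mulrN.
  - exact: moment_fun_partsXn.
have [ae|an] := eqVneq a (-1); last first.
  move=> _; elim/poly_span_ind: q => [q s Hq Hs|c q Hq|i].
  - by rewrite derivD !mulrDl !moment_funD Hq Hs opprD.
  - by rewrite derivZ -!scalerAl !moment_funZ Hq mulrN.
  - by apply: step1 => e; move: an; rewrite e eqxx.
move=> /(_ ae) q0.
have /factor_theorem[s ->] : root q 0 by apply/eqP.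
rewrite subr0; elim/poly_span_ind: s => [s t Hq Hs|c s Hq|i].
- by rewrite mulrDl derivD !mulrDl !moment_funD Hq Hs opprD.
- by rewrite -scalerAl derivZ -!scalerAl !moment_funZ Hq mulrN.
- by rewrite -exprSr; apply: step1.
Qed.

(** Integrate by parts n times, by [laguerre_raising]: this is Rodrigues'
    formula. *)
Lemma moment_fun_laguerre a n q : -2 < a -> (a = -1 -> q.[0] = 0) ->
  M a (q * laguerre_std a n) = (-1) ^+ n / n`!%:R * M (a + n%:R) q^`(n).
Proof.
elim: n a q => [|n IH] a q a2 q0.
  by rewrite laguerre_std0 mulr1 addr0 derivn0 fact0 expr0 divr1 mul1r.
have n1 : n.+1%:R != 0 :> R by rewrite pnatr_eq0.
apply: (mulfI n1); rewrite -moment_funZ scalerAr laguerre_raising moment_fun_parts//.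
have a12 : -2 < a + 1 by lra.
have a1n : a + 1 = -1 -> (q^`()).[0] = 0 by lra.
rewrite (IH _ _ a12 a1n) -derivSn (_ : a + 1 + n%:R = a + n.+1%:R); last by rewrite -natr1; ring.
rewrite factS natrM exprS.
have := factn0 (R := R) n; move: (n`!%:R) (n.+1%:R) ((-1) ^+ n) n1 => x y s y0 x0.
by field; rewrite x0 y0.
Qed.

Lemma laguerre_horner0 n : (0 < n)%N -> (laguerre_std (-1 : R) n).[0] = 0.
Proof.
move=> n0; rewrite horner_coef0 coef_laguerre// big_ltn// (_ : -1 + 1%:R = 0) ?addNr//.
by rewrite !mul0r mulr0 !mul0r.
Qed.

(** By [moment_fun_laguerre] the product is a moment of the k-th derivative of
    L_j, which is 0 for j < k and the constant (-1)^k for j = k. *)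
Lemma laguerre_orthogonal a j k : -2 < a -> (a = -1 -> (0 < j)%N /\ (0 < k)%N) ->
  M a (laguerre_std a j * laguerre_std a k) = if j == k then moment a k / k`!%:R else 0.
Proof.
move=> a2.
wlog jk : j k / (j <= k)%N.
  move=> H ak; have [jk|kj] := leqP j k; first exact: H.
  rewrite mulrC H ?(ltnW kj)//; last by move=> /ak[].
  by rewrite eq_sym; case: eqP => // ->.
move=> ak; rewrite moment_fun_laguerre//; last first.
  by move=> ae; rewrite ae; have [j0 _] := ak ae; rewrite laguerre_horner0.
case: eqP => [<-|/eqP jn].
  rewrite laguerre_derivn.
  have -> : M (a + j%:R) ((-1) ^+ j)%:P = (-1) ^+ j * moment a j.
    rewrite -[X in M _ X]mulr1 mul_polyC moment_funZ -(expr0 'X) moment_funXn.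
    by rewrite /moment addr0.
  rewrite mulrACA -mulrA [X in _ * X]mulrC mulrCA -expr2 sqrr_sign; ring.
have -> : (laguerre_std a j)^`(k) = 0.
  apply/polyP => i; rewrite coef_derivn coef0 coef_laguerre_gt ?mul0rn//.
  by rewrite (@leq_trans k) ?leq_addr// ltn_neqAle jn.
by rewrite moment_fun0 mulr0.
Qed.

Variable b : R.
Hypothesis b0 : 0 < b.

Definition dilate q : {poly R} := q \Po (b *: 'X).

Lemma horner_dilate q (x : R) : (dilate q).[x] = q.[b * x].
Proof. by rewrite /dilate horner_comp !hornerE. Qed.

(** On monomials this is [Gamma_scale]. If a <= -1, only multiples of x are
    concerned, and the moments that occur are convergent integrals. *)
Lemma integral_dilate a q : -2 < a -> (a <= -1 -> q.[0] = 0) ->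
  integrable_on half_line (fun x => (dilate q).[x] * wt b a x) /\
  b `^ (a + 1) * \int[mu]_(x in half_line) ((dilate q).[x] * wt b a x) = M a q.
Proof.
move=> a2.
have mono i : -1 < a + i%:R -> integrable_on half_line (fun x => (dilate 'X^i).[x] * wt b a x) /\
    b `^ (a + 1) * \int[mu]_(x in half_line) ((dilate 'X^i).[x] * wt b a x) = M a 'X^i.
  move=> ai.
  have E x : x \in half_line -> b ^+ i * wt b (a + i%:R) x = (dilate 'X^i).[x] * wt b a x.
    move=> /set_mem; rewrite half_lineE => x0.
    by rewrite horner_dilate hornerXn wtD// exprMn mulrA.
  have iw := integrable_wt b0 ai.
  split; first by apply: eq_integrable_on (integrable_onZ (b ^+ i) measurable_half_line iw).
  rewrite -(@eq_Rintegral _ _ _ mu _ _ _ E) RintegralZl//.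
  have ai1 : 0 < a + i%:R + 1 by lra.
  rewrite moment_funXn /moment (_ : a + i%:R + 2 = a + i%:R + 1 + 1); last by ring.
  rewrite (GammaS ai1) mulrAC mulfV ?gt_eqF// mul1r -(Gamma_scale ai1 b0) addrK mulrA.
  congr (_ * _); rewrite -powR_mulrn ?(ltW b0)// -powRD ?(gt_eqF b0) ?implybT//.
  by congr (_ `^ _); ring.
pose good s := integrable_on half_line (fun x => (dilate s).[x] * wt b a x) /\
    b `^ (a + 1) * \int[mu]_(x in half_line) ((dilate s).[x] * wt b a x) = M a s.
have goodD s r : good s -> good r -> good (s + r).
  move=> [iq eq] [ir er].
  have E x : (dilate s).[x] * wt b a x + (dilate r).[x] * wt b a x = (dilate (s + r)).[x] * wt b a x.
    by rewrite !horner_dilate hornerD; ring.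
  split; first by apply: eq_integrable_on (integrable_onD measurable_half_line iq ir) => // x _.
  rewrite moment_funD -eq -er -mulrDr -RintegralD//; congr (_ * _).
  by apply: eq_Rintegral => x _; rewrite E.
have goodZ c s : good s -> good (c *: s).
  move=> [iq eq].
  have E x : c * ((dilate s).[x] * wt b a x) = (dilate (c *: s)).[x] * wt b a x.
    by rewrite !horner_dilate hornerZ; ring.
  split; first by apply: eq_integrable_on (integrable_onZ c measurable_half_line iq) => // x _.
  rewrite moment_funZ -eq [RHS]mulrCA -[c * Rintegral _ _ _]RintegralZl//; congr (_ * _).
  by apply: eq_Rintegral => x _; rewrite E.
rewrite -/(good q).
have [a1 _|a1 /(_ isT) q0] := ltP (-1) a.
  apply: poly_span_ind q => // i; apply: mono.
  by have := ler0n R i; lra.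
have /factor_theorem[s ->] : root q 0 by apply/eqP.
rewrite subr0; elim/poly_span_ind: s => [s t Hq Hs|c s Hq|i].
- by rewrite mulrDl; exact: goodD.
- by rewrite -scalerAl; exact: goodZ.
- rewrite -exprSr; apply: mono.
  by rewrite -natr1; have := ler0n R i; lra.
Qed.

Lemma laguerre_span a n q : (size q <= n)%N ->
  exists c : nat -> R, q = \sum_(j < n) c j *: laguerre_std a j.
Proof.
elim: n q => [|n IH] q qn.
  by exists (fun=> 0); rewrite big_ord0; apply/eqP; rewrite -size_poly_leq0.
pose t := q`_n / (laguerre_std a n)`_n.
have ln : (laguerre_std a n)`_n != 0.
  by rewrite -[X in _`_X]/(n.+1.-1) -(size_laguerre a n) -lead_coefE lead_coef_eq0 -size_poly_gt0 size_laguerre.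
have [|c E] := IH (q - t *: laguerre_std a n).
  apply/leq_sizeP => i ni; rewrite coefB coefZ.
  move: ni; rewrite leq_eqVlt => /predU1P[<-|ni]; first by rewrite divfK// subrr.
  by rewrite coef_laguerre_gt// mulr0 subr0 nth_default// (leq_trans qn).
exists (fun j => if j == n then t else c j).
rewrite big_ord_recr/= eqxx -[LHS](subrK (t *: laguerre_std a n)) E; congr (_ + _).
by apply: eq_bigr => j _; rewrite ltn_eqF.
Qed.

Lemma size_dilate q : size (dilate q) = size q.
Proof.
rewrite /dilate size_comp_poly2// size_scale ?size_polyX//.
by rewrite gt_eqF.
Qed.

End laguerre_orthogonality.

(** * Diagonal systems and orthogonal projection *)

Section galerkin_projection.
Context {R : realType}.
Notation mu := (@lebesgue_measure R).
Variable b : R.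
Hypothesis b0 : 0 < b.

Lemma undilate (q : {poly R}) : exists Q, [/\ q = dilate b Q, size Q = size q & Q.[0] = q.[0]].
Proof.
have bn : b != 0 by rewrite gt_eqF.
exists (dilate b^-1 q); split.
- rewrite /dilate -comp_polyA comp_polyZ comp_polyX scalerA mulVf// scale1r.
  by rewrite comp_polyXr.
- by rewrite size_dilate// invr_gt0.
- by rewrite horner_dilate mulr0.
Qed.

Lemma dilate_sum N (c : nat -> R) (L : nat -> {poly R}) (x : R) :
  (dilate b (\sum_(k < N) c k *: L k)).[x] = \sum_(k < N) c k * (dilate b (L k)).[x].
Proof.
rewrite horner_dilate horner_sum; apply: eq_bigr => k _.
by rewrite hornerZ horner_dilate.
Qed.

Lemma scalerM (s t : R) (P Q : {poly R}) : (s *: P) * (t *: Q) = (s * t) *: (P * Q).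
Proof. by rewrite -scalerAl -scalerAr scalerA. Qed.

(** Expand q in the Laguerre basis. Testing p against L_j leaves d j times the
    squared norm of L_j, which the diagonal system identifies with the
    integral of g against L_j. For al = -1 the index 0 is excluded on both
    sides. *)
Lemma galerkin_orthogonal (al : R) N (g : R -> R) (d : nat -> R) :
  let p := \sum_(k < N) d k *: laguerre_std al k in
  -2 < al ->
  (forall q : {poly R}, integrable_on half_line (fun x => g x * q.[x] * wt b al x)) ->
  (forall k, (k < N)%N -> (al = -1 -> (0 < k)%N) ->
    d k * (moment al k / k`!%:R) = b `^ (al + 1) *
      \int[mu]_(x in half_line) (g x * (dilate b (laguerre_std al k)).[x] * wt b al x)) ->
  (al = -1 -> d 0%N = 0) -> (al <= -1 -> p.[0] = 0) ->
  forall q : {poly R}, (size q <= N)%N -> (al = -1 -> q.[0] = 0) ->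
    \int[mu]_(x in half_line) ((g x - (dilate b p).[x]) * q.[x] * wt b al x) = 0.
Proof.
move=> p al2 gi dE d0 p0 q qN q0.
have [Q [qQ sQ Q0]] := undilate q.
have [c cE] : exists c : nat -> R, Q = \sum_(j < N) c j *: laguerre_std al j.
  by apply: laguerre_span; rewrite sQ.
have c0 : al = -1 -> (0 < N)%N -> c 0%N = 0.
  move=> ae; case: (N) cE => // n cE _.
  have : Q.[0] = 0 by rewrite Q0 q0.
  rewrite cE big_ord_recl/= laguerre_std0 hornerD hornerZ hornerC mulr1 horner_sum big1 ?addr0//.
  by move=> i _; rewrite hornerZ ae laguerre_horner0 ?mulr0.
have bp : b `^ (al + 1) != 0 by rewrite gt_eqF// powR_gt0.
apply: (mulfI bp); rewrite mulr0.
have pq0 : al <= -1 -> (p * Q).[0] = 0 by move=> h; rewrite hornerM p0// mul0r.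
have [ipq Ipq] := integral_dilate b0 al2 pq0.
have E x : g x * q.[x] * wt b al x - (dilate b (p * Q)).[x] * wt b al x =
    (g x - (dilate b p).[x]) * q.[x] * wt b al x.
  by rewrite qQ !horner_dilate hornerM; ring.
transitivity (b `^ (al + 1) * (\int[mu]_(x in half_line) (g x * q.[x] * wt b al x) -
    \int[mu]_(x in half_line) ((dilate b (p * Q)).[x] * wt b al x))).
  rewrite -(@RintegralB _ _ _ mu _ _ _ measurable_half_line (gi q) ipq); congr (_ * _).
  by apply: eq_Rintegral => x _; rewrite E.
rewrite mulrBr Ipq.
have -> : \int[mu]_(x in half_line) (g x * q.[x] * wt b al x) =
    \sum_(j < N) c j * \int[mu]_(x in half_line) (g x * (dilate b (laguerre_std al j)).[x] * wt b al x).
  have gj j := gi (dilate b (laguerre_std al j)).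
  rewrite -(Rintegral_lincomb c N measurable_half_line gj).2; apply: eq_Rintegral => x _.
  rewrite qQ cE dilate_sum mulr_sumr mulr_suml; apply: eq_bigr => j _.
  by ring.
rewrite mulr_sumr cE mulr_sumr moment_fun_sum -sumrB; apply: big1 => j _.
rewrite mulr_suml moment_fun_sum mulrCA.
have [jz|jz] := boolP ((al == -1) && (nat_of_ord j == 0%N)).
  move: jz => /andP[/eqP ae /eqP j0]; have N0 : (0 < N)%N by rewrite (leq_ltn_trans _ (ltn_ord j)).
  rewrite j0 c0// mul0r sub0r big1 ?oppr0// => k _.
  by rewrite scale0r mulr0 moment_fun0.
have jc : al = -1 -> (0 < j)%N by move=> ae; move: jz; rewrite ae eqxx/= lt0n.
rewrite -dE// (bigD1 j)//= big1 ?addr0.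
  rewrite scalerM moment_funZ laguerre_orthogonal ?eqxx//; last by move=> /jc.
  by ring.
move=> k kj; rewrite scalerM moment_funZ.
have [kz|kz] := boolP ((al == -1) && (nat_of_ord k == 0%N)).
  by move: kz => /andP[/eqP ae /eqP k0]; rewrite k0 d0// !mul0r.
have kc : al = -1 -> (0 < k)%N by move=> ae; move: kz; rewrite ae eqxx/= lt0n.
rewrite laguerre_orthogonal//; last by move=> ae; split; [exact: kc|exact: jc].
by rewrite (_ : (nat_of_ord k == nat_of_ord j) = false) ?mulr0//; exact: negbTE.
Qed.

End galerkin_projection.

(** * The fractional derivative of x^lambda e^{-sigma x} q(x) *)

Section fractional_derivative.
Context {R : realType}.
Notation mu := (@lebesgue_measure R).
Variables (sigma nu : R).
Hypothesis nu01 : 0 < nu < 1.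
Implicit Types (u v : R -> R) (q : {poly R}).

Lemma frac_order2 : frac_order (2 - nu) = 2%N.
Proof.
rewrite /frac_order; congr S; apply: Num.Theory.truncn_def.
by apply/andP; split; move: nu01; lra.
Qed.

Lemma frac_kernelE u x t : frac_kernel sigma (2 - nu) u x t =
  (x - t) `^ (nu - 1) * expR (- sigma * (x - t)) * u t.
Proof. by rewrite /frac_kernel frac_order2; congr (_ `^ _ * _ * _); lra. Qed.

(** The factor e^{-sigma x} turns d/dx + sigma into d/dx. *)
Lemma subst_op_near (F G : R -> R) (x dG : R) :
  (\forall y \near x, F y = expR (- sigma * y) * G y) -> is_derive x 1 G dG ->
  derivable F x 1 /\ subst_op sigma F x = expR (- sigma * x) * dG.
Proof.
move=> FG hG.
have h := is_derive_mul (is_derive_expl (- sigma) x) hG.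
have hF : is_derive x 1 F (- sigma * expR (- sigma * x) * G x + expR (- sigma * x) * dG).
  by apply: near_eq_is_derive h; near do apply/esym.
split; first by case: hF.
rewrite /subst_op derive1E derive_val (nbhs_singleton FG); ring.
Unshelve. all: by end_near. Qed.

Definition powpoly (s : R) q (x : R) : R := x `^ s * q.[x].

(** x^s q has derivative x^(s-1) (euler s q). *)
Definition euler (s : R) q : {poly R} := s *: q + 'X * q^`().

Lemma coef_euler s q i : (euler s q)`_i = (s + i%:R) * q`_i.
Proof.
rewrite coefD coefZ coefXM coef_deriv; case: i => [|i] /=; first by ring.
by rewrite -mulr_natr; ring.
Qed.

Lemma is_derive_powpoly s q (x : R) : 0 < x ->
  is_derive x 1 (powpoly s q) (powpoly (s - 1) (euler s q) x).
Proof.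
move=> x0; apply: is_derive_congr (is_derive_mul (is_derive1_powR s x0) (is_derive_poly q x)) _ _ => //.
have E : x `^ s = x * x `^ (s - 1).
  rewrite -{1}(subrK 1 s) (@powRD R x (s - 1)) ?(gt_eqF x0) ?implybT//.
  by rewrite powRr1 ?(ltW x0)// mulrC.
by rewrite /powpoly /euler !hornerE E; ring.
Qed.

Lemma iter_subst_powpoly (F : R -> R) s q :
  (forall x : R, 0 < x -> F x = expR (- sigma * x) * powpoly s q x) ->
  forall x : R, 0 < x -> [/\ \forall y \near x, derivable F y 1,
    derivable (subst_op sigma F) x 1 &
    subst_op sigma (subst_op sigma F) x =
      expR (- sigma * x) * powpoly (s - 2) (euler (s - 1) (euler s q)) x].
Proof.
move=> FE.
have N (x : R) : 0 < x -> \forall y \near x, 0 < y by exact: lt_nbhsr.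
have step1 (x : R) : 0 < x -> derivable F x 1 /\
    subst_op sigma F x = expR (- sigma * x) * powpoly (s - 1) (euler s q) x.
  move=> x0; apply: subst_op_near; last exact: is_derive_powpoly.
  by near=> y; apply: FE; near: y; exact: N.
move=> x x0.
have [d2 E2] : derivable (subst_op sigma F) x 1 /\
    subst_op sigma (subst_op sigma F) x =
    expR (- sigma * x) * powpoly (s - 1 - 1) (euler (s - 1) (euler s q)) x.
  apply: subst_op_near; last exact: is_derive_powpoly.
  by near=> y; apply: (step1 _ _).2; near: y; exact: N.
split => //; last by rewrite E2; congr (_ * powpoly _ _ _); lra.
by near=> y; apply: (step1 _ _).1; near: y; exact: N.
Unshelve. all: by end_near. Qed.

Section trial.
Variable lambda : R.
Hypothesis lambda0 : 0 < lambda.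

(** The factor by which the fractional integral of order nu multiplies the
    coefficient of x^(lambda+i). *)
Definition fint_coef i : R :=
  Gamma nu * Gamma (lambda + i%:R + 1) / Gamma (nu + (lambda + i%:R + 1)).

(** The exponentials of the kernel and of u combine to e^{-sigma y}, and the
    remaining integrals of (y - t)^(nu-1) t^(lambda+i) are beta integrals. *)
Lemma frac_int_powpoly u q y : 0 < y ->
  (forall t, 0 < t -> u t = expR (- sigma * t) * powpoly lambda q t) ->
  integrable_on `]0, y[ (frac_kernel sigma (2 - nu) u y) /\
  frac_int sigma (2 - nu) u y =
    expR (- sigma * y) * powpoly (lambda + nu) (\poly_(i < size q) (fint_coef i * q`_i)) y.
Proof.
move=> y0 uE; have /andP[nu0 _] := nu01.
pose B i (t : R) : R := (y - t) `^ (nu - 1) * t `^ (lambda + i%:R + 1 - 1).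
have B0 i : 0 < lambda + i%:R + 1 by have := ler0n R i; move: lambda0; lra.
have BI i := beta_integral nu0 (B0 i) y0.
have mD : measurable (`]0, y[%classic : set R) by exact: measurable_itv.
have E t : t \in (`]0, y[%classic : set R) ->
    \sum_(i < size q) expR (- sigma * y) * q`_i * B i t = frac_kernel sigma (2 - nu) u y t.
  rewrite inE/= in_itv/= => /andP[t0 ty].
  rewrite frac_kernelE uE// /powpoly horner_coef !mulr_sumr; apply: eq_bigr => i _.
  rewrite /B addrK (@powRD R t lambda) ?(gt_eqF t0) ?implybT// powR_mulrn ?(ltW t0)//.
  by rewrite [in LHS](_ : - sigma * y = - sigma * (y - t) + - sigma * t) ?expRD; ring.
have [S1 S2] := Rintegral_lincomb (fun i => expR (- sigma * y) * q`_i) (size q) mD (fun i => (BI i).1).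
split; first exact: eq_integrable_on E S1.
rewrite /frac_int -(@eq_Rintegral _ _ _ mu _ _ _ E) S2 /powpoly horner_poly !mulr_sumr.
apply: eq_bigr => i _; rewrite (BI i).2 -/(fint_coef i).
rewrite (_ : nu + (lambda + i%:R + 1) - 1 = lambda + nu + i%:R); last by lra.
rewrite (@powRD R y (lambda + nu)) ?(gt_eqF y0) ?implybT// powR_mulrn ?(ltW y0)//.
ring.
Qed.

Let al := lambda + nu - 2.

Definition frac_factor i : R :=
  Gamma (lambda + i%:R + 1) / Gamma (al + i%:R + 2) * (al + i%:R + 1).

Definition frac_poly q : {poly R} := \poly_(i < size q) (frac_factor i * q`_i).

Lemma coef_frac_poly q i : (frac_poly q)`_i = frac_factor i * q`_i.
Proof. by rewrite coef_poly; case: ltnP => // h; rewrite nth_default ?mulr0. Qed.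

Lemma al_gt0 i : 0 < al + i%:R + 2.
Proof. by have := ler0n R i; move: nu01 lambda0; rewrite /al; lra. Qed.

(** The two derivatives multiply the coefficient of x^(lambda+nu+i) by
    (lambda+nu+i) (lambda+nu+i-1); the first factor is absorbed by the
    functional equation of Gamma. *)
Lemma Ds_powpoly u q x : 0 < x ->
  (forall t, 0 < t -> u t = expR (- sigma * t) * powpoly lambda q t) ->
  Ds_exists sigma (2 - nu) u x /\
  Ds sigma (2 - nu) u x = expR (- sigma * x) * powpoly al (frac_poly q) x.
Proof.
move=> x0 uE; have /andP[nu0 _] := nu01.
have [d1 d2 E] := iter_subst_powpoly (fun y y0 => (frac_int_powpoly y0 uE).2) x0.
split.
  rewrite /Ds_exists frac_order2; split; last exact: d2.
    near=> y; apply: (frac_int_powpoly _ uE).1; near: y; exact: lt_nbhsr.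
  by move=> [_|j jlt]; [exact: d1|discriminate jlt].
have e2 : Gamma (2%:R - (2 - nu)) = Gamma nu by congr Gamma; lra.
rewrite /Ds frac_order2 /= e2 E /powpoly.
set P := euler _ _; have -> : P = Gamma nu *: frac_poly q.
  apply/polyP => i; rewrite !coef_euler coefZ coef_frac_poly coef_poly.
  case: ltnP => h; last by rewrite nth_default ?mulr0.
  have ap := al_gt0 i.
  have e1 : nu + (lambda + i%:R + 1) = al + i%:R + 2 + 1 by rewrite /al; ring.
  rewrite /fint_coef e1 (GammaS ap) /frac_factor /al.
  have := Gamma_gt0 ap; rewrite /al; move: ap; rewrite /al => ap gp.
  move: gp; move: (Gamma (lambda + nu - 2 + i%:R + 2)) (Gamma nu) (Gamma (lambda + i%:R + 1)) => A B C A0.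
  by field; rewrite (gt_eqF A0)/=; apply/eqP => h1; move: ap; lra.
rewrite hornerZ; have := Gamma_gt0 nu0 => g0.
rewrite mulrCA; congr (_ * _); rewrite mulrCA; congr (_ * _); rewrite mulKf// gt_eqF//.
Unshelve. all: by end_near. Qed.

Lemma frac_factorS i : frac_factor i * (lambda + i.+1%:R) = frac_factor i.+1 * (al + i.+1%:R).
Proof.
have ap := al_gt0 i; have gp := Gamma_gt0 ap.
have lp : 0 < lambda + i%:R + 1 by have := ler0n R i; move: lambda0; lra.
rewrite /frac_factor -[i.+1%:R]natr1.
have -> : lambda + (i%:R + 1) + 1 = lambda + i%:R + 1 + 1 by ring.
have -> : al + (i%:R + 1) + 2 = al + i%:R + 2 + 1 by ring.
rewrite (GammaS lp) (GammaS ap); move: ap gp; move: (Gamma (lambda + i%:R + 1)) (Gamma (al + i%:R + 2)) => C A ap A0.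
by field; rewrite (gt_eqF A0) (gt_eqF ap).
Qed.

Lemma frac_factor_prod i k : (i <= k)%N ->
  frac_factor i * \prod_(i <= j < k) (lambda + j.+1%:R) =
  frac_factor k * \prod_(i <= j < k) (al + j.+1%:R).
Proof.
elim: k => [|k IH]; first by rewrite leqn0 => /eqP ->; rewrite !big_geq.
rewrite leq_eqVlt => /predU1P[->|]; first by rewrite !big_geq.
rewrite ltnS => ik; rewrite !big_nat_recr//= mulrA IH// mulrAC frac_factorS; ring.
Qed.

Lemma coef_dilate b q i : (dilate b q)`_i = q`_i * b ^+ i.
Proof.
have -> : dilate b q = \poly_(i < size q) (q`_i * b ^+ i).
  by rewrite /dilate comp_polyE poly_def; apply: eq_bigr => j _; rewrite exprZn scalerA.
by rewrite coef_poly; case: ltnP => // h; rewrite nth_default ?mul0r.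
Qed.

(** The coefficient of x^i in L_k^a contains the product of a+j+1 over i <= j
    < k; the recurrence of [frac_factor], applied for these j, replaces a =
    lambda by a = al. *)
Lemma frac_poly_laguerre b k :
  frac_poly (dilate b (laguerre_std lambda k)) = frac_factor k *: dilate b (laguerre_std al k).
Proof.
apply/polyP => i; rewrite coef_frac_poly coefZ !coef_dilate.
have [ik|ki] := leqP i k; last by rewrite !coef_laguerre_gt// !mul0r !mulr0.
have E := frac_factor_prod ik.
rewrite !coef_laguerre//.
transitivity ((frac_factor i * \prod_(i <= j < k) (lambda + j.+1%:R)) *
   ((-1) ^+ i / (k - i)`!%:R / i`!%:R * b ^+ i)); first by ring.
by rewrite E; ring.
Qed.

End trial.

End fractional_derivative.

(** * Fractional derivatives of differences *)

Section difference.
Context {R : realType}.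
Notation mu := (@lebesgue_measure R).

Import HBNNSimple.

(** The function f need not be measurable: its integral is the supremum of
    those of the simple functions below f, and these are almost everywhere at
    most g. This is needed since nothing ensures that the fractional
    derivative of u is measurable off the set where it equals f. *)
Lemma integral_le_ae (D : set R) (f g : R -> \bar R) : measurable D ->
  (forall x, D x -> 0 <= f x)%E -> measurable_fun D g -> (forall x, D x -> 0 <= g x)%E ->
  {ae mu, forall x, D x -> (f x <= g x)%E} ->
  (\int[mu]_(x in D) f x <= \int[mu]_(x in D) g x)%E.
Proof.
move=> mD f0 mg g0 fg.
have p0 (h : R -> \bar R) : (forall x, D x -> 0 <= h x)%E -> forall x, (0 <= (h \_ D) x)%E.
  by move=> h0 x; rewrite patchE; case: ifPn => // /set_mem; exact: h0.
rewrite integral_mkcond [leRHS]integral_mkcond (@ge0_integralTE _ _ _ mu _ (p0 _ f0)).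
apply: ge_ereal_sup => _ [h /= hf <-].
rewrite -integralT_nnsfun; apply: ae_ge0_le_integral => //.
- by move=> x _; rewrite /= lee_fin; exact: fun_ge0.
- exact/measurable_EFinP.
- by move=> x _; exact: p0.
- exact: (proj1 (measurable_restrictT g mD)).
apply: ae_imp fg => x fgx _; apply: le_trans (hf x) _; rewrite !patchE.
by case: ifPn => // /set_mem.
Qed.

Lemma subst_opB (sigma : R) (F G H : R -> R) (x : R) :
  (\forall y \near x, H y = F y - G y) -> derivable F x 1 -> derivable G x 1 ->
  subst_op sigma H x = subst_op sigma F x - subst_op sigma G x.
Proof.
move=> HE dF dG; rewrite /subst_op !derive1E (near_eq_derive (1 : R) HE) (nbhs_singleton HE).
by rewrite (deriveB dF dG); ring.
Qed.

Lemma iter_subst_opB (sigma : R) (F G H : R -> R) (x : R) :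
  (\forall y \near x, H y = F y - G y) ->
  (\forall y \near x, derivable F y 1) -> (\forall y \near x, derivable G y 1) ->
  derivable (subst_op sigma F) x 1 -> derivable (subst_op sigma G) x 1 ->
  subst_op sigma (subst_op sigma H) x =
  subst_op sigma (subst_op sigma F) x - subst_op sigma (subst_op sigma G) x.
Proof.
move=> E dF dG d1F d1G; apply: (subst_opB _ _ d1F d1G).
by apply: filterS3 (near_join E) dF dG => y; exact: subst_opB.
Qed.

(** The operator is built from total functions, so linearity has to be derived
    from the existence of the integrals and derivatives near x. *)
Lemma DsB (sigma nu : R) (u v : R -> R) (x : R) : 0 < nu < 1 ->
  Ds_exists sigma (2 - nu) u x -> Ds_exists sigma (2 - nu) v x ->
  Ds sigma (2 - nu) (fun y => u y - v y) x =
  Ds sigma (2 - nu) u x - Ds sigma (2 - nu) v x.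
Proof.
move=> nu01; rewrite /Ds_exists /Ds (frac_order2 nu01) => -[iu du d1u] [iv dv d1v].
have {}du := du 0%N isT; have {}dv := dv 0%N isT.
rewrite -mulrBr; congr (_ * _).
set w := fun y => u y - v y.
have E : \forall y \near x, frac_int sigma (2 - nu) w y =
    frac_int sigma (2 - nu) u y - frac_int sigma (2 - nu) v y.
  near=> y.
  have iuy : integrable_on `]0, y[ (frac_kernel sigma (2 - nu) u y) by near: y.
  have ivy : integrable_on `]0, y[ (frac_kernel sigma (2 - nu) v y) by near: y.
  rewrite /frac_int -(@RintegralB _ _ _ mu _ _ _ (measurable_itv _) iuy ivy).
  by apply: eq_Rintegral => t _; rewrite /frac_kernel /w; ring.
exact: (iter_subst_opB E du dv d1u d1v).
Unshelve. all: by end_near. Qed.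

End difference.

(** * Polynomials and singular weights *)

Section singular_weight.
Context {R : realType}.
Variable b : R.
Hypothesis b0 : 0 < b.

(** Up to integrable terms, p w_al is p(0) w_al, and x w_al does not tend to 0
    at 0 when al <= -1, so w_al is not integrable. *)
Lemma horner0_of_integrable (al : R) (p : {poly R}) : -2 < al -> al <= -1 ->
  integrable_on half_line (fun x => p.[x] * wt b al x) -> p.[0] = 0.
Proof.
move=> al2 al1 ip; apply/eqP; apply: contraT => pn.
have [q qE] : exists q, p = q * 'X + (p.[0])%:P.
  have /factor_theorem[q qE] : root (p - (p.[0])%:P) 0.
    by rewrite /root !hornerE subrr.
  by exists q; rewrite -[LHS](subrK (p.[0])%:P) {1}qE subr0.
have al3 : -1 < al + 1 by lra.
have i1 := integrable_horner_wt b0 q al3.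
have iw : integrable_on half_line (wt b al).
  have := integrable_onZ (p.[0])^-1 measurable_half_line (integrable_onB measurable_half_line ip i1).
  apply: eq_integrable_on => // x; rewrite inE half_lineE => x0.
  have pE : p.[x] = q.[x] * x + p.[0] by rewrite {1}qE !hornerE.
  rewrite wtS// pE; move: q.[x] (wt b al x) (p.[0]) pn => s t u u0; by field.
have [x [x0 x1]] := vanish0 (fun x _ => wt_ge0 b al x) iw (expR_gt0 (- b)) ltr01.
rewrite -wtS// /wt => /lt_geF/negP[].
apply: (@le_trans _ _ (1 * expR (- (b * x)))).
  by rewrite mul1r ler_expR lerN2 ler_piMr// ltW.
rewrite ler_wpM2r ?expR_ge0// /powR gt_eqF// -[leLHS]expR0 ler_expR.
by apply: mulr_le0; [lra|exact: ln_le0 (ltW x1)].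
Qed.

End singular_weight.

(** * The Petrov-Galerkin solution as a projection *)

Section weighted_space.
Context {R : realType}.
Notation mu := (@lebesgue_measure R).

Lemma weight_ge0 (sigma a x : R) : 0 <= weight sigma a x.
Proof. exact: (wt_ge0 (2 * sigma) a x). Qed.

Lemma wnorm_sqr (w v : R -> R) : (forall x, 0 < x -> 0 <= w x) ->
  (wnorm w v ^+ 2 = \int[mu]_(x in half_line) ((v x) ^+ 2 * w x)%:E)%E.
Proof.
move=> w0; rewrite /wnorm sqr_sqrte//; apply: integral_ge0 => x.
by rewrite half_lineE => x0; rewrite lee_fin mulr_ge0 ?sqr_ge0 ?w0.
Qed.

Lemma sqrte_lty (x : \bar R) : (sqrte x < +oo -> x < +oo)%E.
Proof. by case: x => //= r _; rewrite ltry. Qed.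

Lemma wnorm_integrable (w v : R -> R) : measurable_fun half_line w ->
  measurable_fun half_line v -> (forall x, 0 < x -> 0 <= w x) ->
  (wnorm w v ^+ 2 < +oo)%E -> integrable_on half_line (fun x => v x ^+ 2 * w x).
Proof.
move=> mw mv w0; rewrite wnorm_sqr// => fin; apply: integrable_onP => //.
  by apply: measurable_funM => //; exact: measurable_funX.
apply: le_lt_trans fin; rewrite le_eqVlt; apply/orP; left; apply/eqP/eq_integral => x.
by rewrite inE half_lineE => x0; rewrite abse_EFin ger0_norm// mulr_ge0 ?sqr_ge0 ?w0.
Qed.

(** A finite sum of squares has finite terms; weak derivatives are replaced by
    absolutely continuous representatives. *)
Lemma Bspace_chain (sigma al : R) (m : nat) (g : R -> R) : Bspace sigma al m g ->
  [/\ forall k, (k <= m)%N -> measurable_fun half_line (wderivn k g),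
      forall k, (k <= m)%N -> integrable_on half_line
        (fun x => wderivn k g x ^+ 2 * wt (2 * sigma) (al + k%:R) x) &
      deriv_chain m (fun k => wderivn k g)].
Proof.
move=> [mg wd Bfin].
have mk k : (k <= m)%N -> measurable_fun half_line (wderivn k g).
  by case: k => [//|k km]; have [_ [] //] := wd k km.
split=> //; last by move=> k km; exact: weak_derivative_ac (wd k km).
move=> k km; apply: wnorm_integrable (mk k km) _ _.
- exact: measurable_wt.
- by move=> x _; exact: wt_ge0.
have km' : (k < m.+1)%N by [].
move: Bfin; rewrite /Bnorm => /sqrte_lty; rewrite (bigD1 (Ordinal km'))// => fin.
apply: le_lt_trans fin; apply: leeDl; apply: sume_ge0 => i _.
rewrite wnorm_sqr; last by move=> x _; exact: weight_ge0.
by apply: integral_ge0 => x _; rewrite lee_fin mulr_ge0 ?sqr_ge0 ?weight_ge0.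
Qed.

End weighted_space.

Section petrov_galerkin_solution.
Context {R : realType}.
Notation mu := (@lebesgue_measure R).
Variables (nu lambda sigma : R).
Hypotheses (nu01 : 0 < nu < 1) (lambda01 : 0 < lambda < 1) (sigma0 : 0 < sigma).
Let al := lambda + nu - 2.
Let b := 2 * sigma.

Let b0 : 0 < b. Proof. by rewrite mulr_gt0. Qed.
Let al2 : -2 < al. Proof. by move: nu01 lambda01; rewrite /al; lra. Qed.

Lemma g_of_wt (f : R -> R) (x : R) : 0 < x ->
  g_of sigma nu lambda f x * wt b al x = f x * expR (- sigma * x).
Proof.
move=> x0; rewrite /g_of /wt.
have -> : x `^ (2 - lambda - nu) = (x `^ al)^-1.
  by rewrite -powRN; congr (_ `^ _); rewrite /al; ring.
have -> : expR (- (b * x)) = expR (- sigma * x) / expR (sigma * x).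
  by rewrite -expRN -expRD; congr expR; rewrite /b; ring.
have h1 : x `^ al != 0 by rewrite gt_eqF// powR_gt0.
have h2 := lt0r_neq0 (expR_gt0 (sigma * x)).
move: (x `^ al) (expR (sigma * x)) h1 h2 => s t s0 t0; field.
by rewrite s0 t0.
Qed.

Section expansion.
Variable c : nat -> R.
Let ct k := c k * k.+1%:R `^ (- ((lambda - nu + 2) / 2)).
(** The coefficients, in the Laguerre basis of index al, of the polynomial p
    such that D_s^{2-nu} u_N = x^al e^{-sigma x} p. *)
Definition galerkin_coef k := ct k * frac_factor nu lambda k.

Lemma Ds_galerkin N (uN : R -> R) (x : R) : 0 < x ->
  (forall x, 0 <= x -> uN x = \sum_(k < N.+1) c k * trial_basis sigma nu lambda k x) ->
  Ds_exists sigma (2 - nu) uN x /\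
  Ds sigma (2 - nu) uN x = expR (- sigma * x) *
    (x `^ al * (dilate b (\sum_(k < N.+1) galerkin_coef k *: laguerre_std al k)).[x]).
Proof.
move=> x0 uE; have /andP[lam0 _] := lambda01.
pose U : {poly R} := \sum_(k < N.+1) ct k *: dilate b (laguerre_std lambda k).
have uU (t : R) : 0 < t -> uN t = expR (- sigma * t) * powpoly lambda U t.
  move=> t0; rewrite uE ?(ltW t0)// /powpoly horner_sum !mulr_sumr; apply: eq_bigr => k _.
  rewrite hornerZ horner_dilate /trial_basis /laguerre_hat laguerreE /ct /b; ring.
have [E1 E2] := Ds_powpoly nu01 lam0 x0 uU; split => //.
rewrite E2 /powpoly; congr (_ * (_ * _.[x])).
apply/polyP => i; rewrite coef_frac_poly coef_dilate !coef_sum mulr_sumr mulr_suml.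
apply: eq_bigr => k _.
rewrite !coefZ /galerkin_coef -mulrA [RHS]mulrAC mulrCA -coef_frac_poly frac_poly_laguerre//.
by rewrite coefZ coef_dilate; ring.
Qed.

(** The powers of k + 1 in the normalizations of the trial and test functions
    cancel, and [frac_factor] is Gamma(lambda+k+1) divided by k! times the
    squared norm of L_k^al. *)
Lemma galerkin_coef_moment (f : R -> R) (k : nat) : (al = -1 -> (0 < k)%N) ->
  (1 / (2 * sigma)) `^ (lambda + nu - 1) *
    (Gamma (lambda + k%:R + 1) / (Gamma (k%:R + 1) * k.+1%:R `^ lambda)) * c k =
  (k.+1%:R `^ ((lambda + nu - 2) / 2))^-1 *
    \int[mu]_(x in half_line) (f x * expR (- sigma * x) *
       (laguerre (lambda + nu - 2) k).[2 * sigma * x]) ->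
  galerkin_coef k * (moment al k / k`!%:R) = b `^ (al + 1) *
    \int[mu]_(x in half_line) (g_of sigma nu lambda f x *
       (dilate b (laguerre_std al k)).[x] * wt b al x).
Proof.
move=> ak; rewrite Gamma_fact.
have -> : \int[mu]_(x in half_line) (f x * expR (- sigma * x) *
       (laguerre (lambda + nu - 2) k).[2 * sigma * x]) =
    \int[mu]_(x in half_line) (g_of sigma nu lambda f x *
       (dilate b (laguerre_std al k)).[x] * wt b al x).
  apply: eq_Rintegral => x; rewrite inE half_lineE => x0.
  by rewrite [RHS]mulrAC g_of_wt// laguerreE horner_dilate.
set I := Rintegral _ _ _.
have q0 : 0 < k.+1%:R :> R by rewrite ltr0n.
set q : R := k.+1%:R.
have -> : (1 / (2 * sigma)) `^ (lambda + nu - 1) = (b `^ (al + 1))^-1.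
  rewrite div1r -powR_inv1 ?ltW// -powRrM -powRN; congr (_ `^ _); rewrite /al; ring.
have -> : q `^ lambda = q `^ ((lambda + nu - 2) / 2) * q `^ ((lambda - nu + 2) / 2).
  rewrite -powRD ?(gt_eqF q0) ?implybT//; congr (_ `^ _); lra.
rewrite /galerkin_coef /ct /frac_factor /moment powRN -/al -/q.
have z1 : b `^ (al + 1) != 0 by rewrite gt_eqF// powR_gt0.
have z2 : q `^ ((lambda + nu - 2) / 2) != 0 by rewrite gt_eqF// powR_gt0.
have z3 : q `^ ((lambda - nu + 2) / 2) != 0 by rewrite gt_eqF// powR_gt0.
have z4 : k`!%:R != 0 :> R by exact: factn0.
have /andP[lam0 _] := lambda01.
have z5 : Gamma (al + k%:R + 2) != 0 by rewrite gt_eqF// Gamma_gt0// al_gt0.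
have z6 : al + k%:R + 1 != 0.
  case: k ak {q0 q z2 z3 z4 z5 I} => [|k] ak.
    by rewrite addr0; apply/eqP => h; have /ak : al = -1 by lra.
  by rewrite -natr1 gt_eqF//; have := ler0n R k; move: al2; lra.
move: z1 z2 z3 z4 z5 z6.
move: (b `^ _) (q `^ ((lambda + nu - 2) / 2)) (q `^ ((lambda - nu + 2) / 2)) => B Q1 Q2.
move: (k`!%:R) (Gamma (al + k%:R + 2)) (al + k%:R + 1) (Gamma (lambda + k%:R + 1)) (c k) => F G A L C.
move=> z1 z2 z3 z4 z5 z6 /(congr1 (fun z => Q1 * (B * z))).
have -> : Q1 * (B * (Q1^-1 * I)) = B * I by field.
move=> <-; field.
by rewrite z1 z2 z3 z4 z5 z6.
Qed.

Lemma galerkin_coef0 : al = -1 -> galerkin_coef 0 = 0.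
Proof.
move=> ae; rewrite /galerkin_coef /frac_factor -/al.
by have -> : al + 0%:R + 1 = 0; [rewrite ae addr0 addNr|rewrite !mulr0].
Qed.

End expansion.

(** Testing with the first test function shows that p w_al and g_f w_al are
    integrable. In particular p vanishes at 0 if al <= -1, and
    [galerkin_orthogonal] applies. *)
Lemma galerkin_error N (f uN : R -> R) :
  measurable_fun half_line (g_of sigma nu lambda f) ->
  integrable_on half_line (fun x => g_of sigma nu lambda f x ^+ 2 * wt b al x) ->
  petrov_galerkin sigma nu lambda N f uN ->
  exists p : {poly R}, [/\ (size p <= N.+1)%N, al <= -1 -> p.[0] = 0,
    wt_orthogonal b al N.+1 (fun x => g_of sigma nu lambda f x - p.[x]) &
    forall x, 0 < x -> Ds_exists sigma (2 - nu) uN x /\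
      Ds sigma (2 - nu) uN x = expR (- sigma * x) * (x `^ al * p.[x])].
Proof.
move=> mg ig2 [conv [c [uE sys]]].
set g := g_of _ _ _ _ in mg ig2 *.
pose p0 : {poly R} := \sum_(k < N.+1) galerkin_coef c k *: laguerre_std al k.
pose p := dilate b p0.
have DsE x (x0 : 0 < x) := Ds_galerkin x0 uE.
have sp : (size p <= N.+1)%N.
  rewrite size_dilate//; apply: (leq_trans (size_sum _ _ _)).
  apply/bigmax_leqP => k _; apply: leq_trans (size_scale_leq _ _) _.
  by rewrite size_laguerre.
have [ip ig1] : integrable_on half_line (fun x => p.[x] * wt b al x) /\
    integrable_on half_line (fun x => g x * wt b al x).
  have [|i1 i2] := conv (test_basis sigma nu lambda 0).
    exists (fun n => (n == 0%N)%:R) => x _.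
    by rewrite big_ord_recl/= mul1r big1 ?addr0// => i _; rewrite mul0r.
  have tE x : 0 < x -> test_basis sigma nu lambda 0 x * weight_hat2 lambda nu x = expR (- sigma * x).
    move=> x0; rewrite /test_basis /laguerre_hat laguerreE laguerre_std0 hornerC mulr1 powR1 mul1r.
    rewrite /weight_hat2 mulrAC -powRD ?(gt_eqF x0) ?implybT//.
    by rewrite (_ : lambda + nu - 2 + (2 - lambda - nu) = 0) ?powRr0 ?mul1r//; ring.
  split.
    apply: eq_integrable_on i1 => // x; rewrite inE half_lineE => x0.
    rewrite -mulrA tE// (DsE x x0).2 /wt -/p.
    rewrite (_ : - (b * x) = - sigma * x + - sigma * x) ?expRD; last by rewrite /b; ring.
    by rewrite /p /p0; ring.
  apply: eq_integrable_on i2 => // x; rewrite inE half_lineE => x0.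
  by rewrite -mulrA tE// g_of_wt.
have p00 : al <= -1 -> p.[0] = 0 by move=> al1; exact: horner0_of_integrable ip.
have ip2 : integrable_on half_line (fun x => p.[x] ^+ 2 * wt b al x).
  have [al1|al1] := ltP (-1) al; first exact: integrable_sqr_horner.
  by apply: integrable_sqr_horner0 => //; exact: p00.
have ng : wt_orthogonal b al 0 g.
  split => // q; rewrite size_poly_leq0 => /eqP -> _.
  rewrite (@eq_Rintegral _ _ _ mu _ (fun=> 0)) ?Rintegral_cst ?mul0r// => x _.
  by rewrite horner0 mulr0 mul0r.
exists p; split => //; split.
- by apply: measurable_funB => //; exact: measurable_horner.
- by apply: integrable_sqrB => //; exact: measurable_horner.
- apply: eq_integrable_on (integrable_onB _ ig1 ip) => // x _.
  by rewrite mulrBl.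
move=> q qN q0; apply: galerkin_orthogonal => //.
- by move=> r; exact: (wt_orthogonal_int b0 r al2 ng).
- by move=> k kN ak; apply: galerkin_coef_moment => //; exact: sys.
- exact: galerkin_coef0.
- by move=> /p00; rewrite horner_dilate mulr0.
Qed.

End petrov_galerkin_solution.

(** * The rate of convergence *)

(** The product is at least ((N + 1) / m)^m b^m by [prod_lower_bound]. *)
Lemma approximation_rate (R : realType) (b A B : R) (m N : nat) :
  0 < b -> (1 <= N)%N -> (m <= N.+1)%N -> 0 <= A -> 0 <= B ->
  \prod_(i < m) ((N.+1 - i)%:R * b) * A <= B ->
  Num.sqrt A <= Num.sqrt (m%:R ^+ m / b ^+ m) * N%:R `^ (- (m%:R / 2)) * Num.sqrt B.
Proof.
move=> b0 N1 mN A0 B0; rewrite big_split/= prodr_const card_ord => le.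
have bm : 0 < b ^+ m by rewrite exprn_gt0.
have N0 : 0 < N%:R :> R by rewrite ltr0n.
have Nm : 0 < N%:R ^+ m :> R by rewrite exprn_gt0.
have -> : N%:R `^ (- (m%:R / 2)) = Num.sqrt ((N%:R ^+ m)^-1) :> R.
  rewrite powRN powRrM powR12_sqrt ?powR_ge0// powR_mulrn ?ltW//.
  by rewrite sqrtrV// ltW.
have mm : 0 <= m%:R ^+ m / b ^+ m :> R by rewrite divr_ge0 ?exprn_ge0 ?(ltW b0).
have Nv : 0 <= (N%:R ^+ m)^-1 :> R by rewrite invr_ge0 ltW.
set X : R := m%:R ^+ m / b ^+ m; set Y : R := (N%:R ^+ m)^-1.
have XY : 0 <= X * Y by rewrite mulr_ge0.
rewrite -(sqrtrM _ mm) -(sqrtrM _ XY) ler_wsqrtr//.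
have P := prod_lower_bound R mN.
have NN : N%:R ^+ m <= N.+1%:R ^+ m :> R by rewrite lerXn2r ?nnegrE ?ler0n// ler_nat.
have -> : X * Y * B = m%:R ^+ m * B / (b ^+ m * N%:R ^+ m).
  by rewrite /X /Y invfM; ring.
rewrite ler_pdivlMr ?mulr_gt0//.
have m0 : 0 <= m%:R ^+ m :> R by rewrite exprn_ge0.
apply: le_trans (ler_wpM2l m0 le).
rewrite [leRHS](_ : _ = A * (b ^+ m * (m%:R ^+ m * \prod_(i < m) (N.+1 - i)%:R))); last by ring.
rewrite ler_wpM2l// ler_wpM2l ?(ltW bm)//.
exact: le_trans NN P.
Qed.

Theorem theorem2 (R : realType) (nu lambda sigma : R) (m : nat)
    (hnu : 0 < nu < 1) (hlambda : 0 < lambda < 1) (hsigma : 0 < sigma) :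
  exists C : R, forall (f u : R -> R),
    is_solution sigma nu f u ->
    Bspace sigma (lambda + nu - 2) m (g_of sigma nu lambda f) ->
    forall (N : nat) (uN : R -> R), (1 <= N)%N -> (m <= N.+1)%N ->
      petrov_galerkin sigma nu lambda N f uN ->
      (wnorm (weight_hat2 lambda nu)
         (Ds sigma (2 - nu) (fun x => u x - uN x)%R)
       <= (C * N%:R `^ (- (m%:R / 2)))%:E *
          wnorm (weight sigma (lambda + nu + m%:R - 2))
            (wderivn m (g_of sigma nu lambda f)))%E.
Proof.
have b0 : 0 < 2 * sigma by rewrite mulr_gt0.
(* This is (m / b)^(m/2), from the product of the Poincare constants. *)
exists (Num.sqrt (m%:R ^+ m / (2 * sigma) ^+ m)) => f u [ae_sol _ _] /Bspace_chain[mg ig dg].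
move=> N uN N1 mN pg.
set al := lambda + nu - 2 in mg ig dg *; set g := g_of _ _ _ _ in mg ig dg *.
set b := 2 * sigma in b0 mg ig dg *.
have al2 : -2 < al by move: hnu hlambda; rewrite /al; lra.
have ig0 : integrable_on half_line (fun x => g x ^+ 2 * wt b al x).
  by have := ig 0%N isT; rewrite addr0.
have [p [sp p0 ne DsN]] := galerkin_error hnu hlambda hsigma (mg 0%N isT) ig0 pg.
have le := laguerre_approximation b0 al2 mN mg ig dg sp p0 ne.
have [me ie2 _ _] := ne.
set A := \int[_]_(x in _) _ in le; set B := \int[_]_(x in _) _ in le.
have A0 : 0 <= A by exact: integral_sqr_wt_ge0.
have B0 : 0 <= B by exact: integral_sqr_wt_ge0.
have BE : wnorm (weight sigma (lambda + nu + m%:R - 2)) (wderivn m g) = (Num.sqrt B)%:E.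
  rewrite /wnorm /B (_ : lambda + nu + m%:R - 2 = al + m%:R); last by rewrite /al; ring.
  rewrite -[RHS]/(sqrte (_%:E)); congr sqrte.
  exact: (integrable_on_EFin measurable_half_line (ig m (leqnn m))).
have AE : (wnorm (weight_hat2 lambda nu) (Ds sigma (2 - nu) (fun x => u x - uN x)%R)
    <= (Num.sqrt A)%:E)%E.
  rewrite -[leRHS]/(sqrte (A%:E)) lee_sqrt ?lee_fin//.
  rewrite /A -(integrable_on_EFin measurable_half_line ie2).
  apply: integral_le_ae => //.
  - by move=> x _; rewrite lee_fin mulr_ge0 ?sqr_ge0 ?powR_ge0.
  - by apply/measurable_EFinP; exact: integrable_on_measurable ie2.
  - by move=> x _; rewrite lee_fin mulr_ge0 ?sqr_ge0 ?wt_ge0.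
  apply: ae_imp ae_sol => x sol; rewrite half_lineE => x0.
  have [exu Du] := sol x0; have [exN DN] := DsN x x0.
  rewrite lee_fin (DsB hnu exu exN) Du DN -/al -/g /weight_hat2 le_eqVlt; apply/orP; left; apply/eqP.
  have E := g_of_wt nu lambda sigma f x0; rewrite -/al -/b -/g in E.
  have xal : x `^ (2 - lambda - nu) = (x `^ al)^-1.
    by rewrite -powRN; congr (_ `^ _); rewrite /al; ring.
  have xn : x `^ al != 0 by rewrite gt_eqF// powR_gt0.
  have e2 : expR (- (b * x)) = expR (- sigma * x) * expR (- sigma * x).
    by rewrite -expRD; congr expR; rewrite /b; ring.
  have en := lt0r_neq0 (expR_gt0 (- sigma * x)).
  move: E; rewrite xal /wt e2; move: xn en.
  move: (x `^ al) (expR (- sigma * x)) (g x) p.[x] (f x) => X Y G P F X0 Y0 E.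
  have -> : F = G * X * Y by apply: (mulIf Y0); rewrite -E; ring.
  by field.
rewrite BE -EFinM; apply: le_trans AE _; rewrite lee_fin.
exact: approximation_rate.
Qed.
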